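(* Fix a compact oriented Riemannian $4$-manifold $(M,g)$. For a Riemannian metric $h$ on $M$, define the functional $$\mathcal{A}_g(h):=\int_M \mathrm{scal}_{g\text{-}h}\,dV_h .$$ Then the Euler--Lagrange equation of $\mathcal{A}_g$ with respect to variations of $h$ (with $g$ fixed) is $$\mathrm{Ric}_{g\text{-}h}=\frac{\mathrm{scal}_{g\text{-}h}}{4}\,h .$$ Consequently, the critical points of $\mathcal{A}_g$ are exactly the Riemannian metrics $h$ for which $\mathrm{Rm}_g(\Lambda^+_h,\Lambda^-_h)=0$.
   Context: Manifolds and metrics are smooth; compact manifolds are without boundary. A Riemannian metric $h$ is a critical point of $\mathcal{A}_g$ if the first variation of $\mathcal{A}_g$ at $h$ vanishes for all smooth variations of $h$ through Riemannian metrics (equivalently, $\frac{d}{dt}\big|_{t=0}\mathcal{A}_g(h+tv)=0$ for every smooth symmetric $(0,2)$-tensor $v$); $g$ is kept fixed. The curvature tensor of $g$ is $\mathrm{Rm}_g(v,w,x,y)=g(\nabla_v\nabla_w x-\nabla_w\nabla_v x-\nabla_{[v,w]}x,\,y)$, with $\nabla$ the Levi-Civita connection of $g$. In an oriented $h$-orthonormal frame $\{e_1,\dots,e_4\}$, with $R_{ijkl}:=\mathrm{Rm}_g(e_i,e_j,e_k,e_l)$, the mixed Ricci tensor and mixed scalar curvature of $(g,h)$ are $(\mathrm{Ric}_{g\text{-}h})_{jl}:=\sum_{i=1}^4R_{ijli}$ and $\mathrm{scal}_{g\text{-}h}:=\sum_{j=1}^4(\mathrm{Ric}_{g\text{-}h})_{jj}$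 (curvature of $g$, contracted with $h$). In the integral, $dV_h$ is the Riemannian volume form of $h$. $\mathrm{Rm}_g$ is also viewed as a symmetric bilinear form on $\Lambda^2=\Lambda^2(TM)$ via $\mathrm{Rm}_g(v\wedge w,x\wedge y)=\mathrm{Rm}_g(v,w,x,y)$. The bundle $\Lambda^2$ carries the inner product $\langle v\wedge w,x\wedge y\rangle_h=h(v,x)h(w,y)-h(v,y)h(w,x)$; the Hodge star $*_h:\Lambda^2\to\Lambda^2$ is defined by $\xi\wedge *_h\eta=\langle\xi,\eta\rangle_h\,\omega_h$, with $\omega_h\in\Lambda^4(TM)$ the positively oriented $h$-unit element, and $\Lambda^\pm_h$ are its $\pm1$-eigenspaces. The condition $\mathrm{Rm}_g(\Lambda^+_h,\Lambda^-_h)=0$ means $\mathrm{Rm}_g(\xi,\eta)=0$ at every point for all $\xi\in\Lambda^+_h$, $\eta\in\Lambda^-_h$. *)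

(* Defs.v *)
From HB Require Import structures.
From mathcomp Require Import all_boot all_order all_algebra.
From mathcomp Require Import all_classical all_reals all_analysis.
From mathcomp Require Import ring.

Set Implicit Arguments.
Unset Strict Implicit.
Unset Printing Implicit Defensive.

Import Order.TTheory GRing.Theory Num.Theory.
Import numFieldNormedType.Exports.

Local Open Scope classical_set_scope.
Local Open Scope ring_scope.

Section Smooth4Manifolds.
Variable R : realType.

Notation E := ('rV[R]_4).

(* C^infinity on U (used for open U only): every iterated directional
   derivative exists and is Frechet differentiable at every point of U. *)
Definition smooth_on (W : normedModType R) (U : set E) (f : E -> W) : Prop :=
  forall (s : seq E) (x : E), U x ->
    differentiable (foldr (fun v (F : E -> W) => 'D_v F) f s) x.

(* A smooth oriented atlas of dimension 4 on the topological space M.  [inv i]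
   matters only on the image of [dom i] under [crd i]. *)
Record oriented_atlas (M : topologicalType) := OrientedAtlas {
  idx : choiceType;
  dom : idx -> set M;
  crd : idx -> M -> E;
  inv : idx -> E -> M;
  img := fun i => crd i @` dom i;
  overlap := fun i j => crd i @` (dom i `&` dom j);
  transition := fun i j => crd j \o inv i;
  dom_open : forall i, open (dom i);
  dom_cover : forall p, exists i, dom i p;
  img_open : forall i, open (img i);
  crdK : forall i p, dom i p -> inv i (crd i p) = p;
  crd_continuous : forall i p, dom i p -> {for p, continuous (crd i)};
  inv_continuous : forall i x, img i x -> {for x, continuous (inv i)};
  transition_smooth : forall i j, smooth_on (overlap i j) (transition i j);
  transition_oriented : forall i j x, overlap i j x ->
    0 < \det ('J (transition i j) x)
}.

Section Tensors.
Variables (M : topologicalType) (A : oriented_atlas M).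

(* Component matrices T i x of a (0,2)-tensor field in every chart i; the
   values for x outside [img i] are irrelevant.  Tangent vectors are row
   vectors of components, pushed forward by v |-> v *m 'J _ x. *)
Definition tensor_field := idx A -> E -> 'M[R]_4.

Definition form (B : 'M[R]_4) (v w : E) : R := (v *m B *m w^T) 0 0.

Definition smooth_tensor (T : tensor_field) : Prop :=
  (forall i a b, smooth_on (img i) (fun x => T i x a b : R)) /\
  (forall i j x, overlap i j x ->
     let J := 'J (transition i j) x in
     T i x = J *m T j (transition i j x) *m J^T).

Definition smooth_symmetric_tensor (T : tensor_field) : Prop :=
  smooth_tensor T /\ (forall i x, img i x -> (T i x)^T = T i x).

Definition riemannian_metric (h : tensor_field) : Prop :=
  smooth_symmetric_tensor h /\
  (forall i x, img i x -> forall v : E, v != 0 -> 0 < form (h i x) v v).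

End Tensors.

Section Curvature.
(* g : components of a metric in one chart. *)
Variable g : E -> 'M[R]_4.

Definition basis (a : 'I_4) : E := delta_mx 0 a.

(* Vector fields in a chart are functions E -> E. *)
Definition bracket (v w : E -> E) : E -> E :=
  fun x => 'D_(v x) w x - 'D_(w x) v x.

(* (D_u g)(v, w) for constant v and w *)
Definition dmetric (x u v w : E) : R := 'D_u (fun y => form (g y) v w : R) x.

(* The covector g(nabla_v w, -) for constant v and w (Koszul formula). *)
Definition christoffel_flat (x v w : E) : E :=
  \row_l (2^-1 * (dmetric x v w (basis l) + dmetric x w v (basis l)
                  - dmetric x (basis l) v w)).

Definition christoffel (x v w : E) : E :=
  christoffel_flat x v w *m invmx (g x).

(* The Levi-Civita connection of g. *)
Definition nabla (v w : E -> E) : E -> E :=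
  fun x => 'D_(v x) w x + christoffel x (v x) (w x).

(* The vectors v, w, y, z at x are extended to constant vector fields. *)
Definition Rm (x v w y z : E) : R :=
  let V : E -> E := cst v in let W : E -> E := cst w in
  let Y : E -> E := cst y in
  form (g x) (nabla V (nabla W Y) x - nabla W (nabla V Y) x
              - nabla (bracket V W) Y x) z.

Lemma formE (B : 'M[R]_4) (v w : E) :
  form B v w = \sum_(a < 4) \sum_(b < 4) v 0 a * w 0 b * B a b.
Proof.
rewrite /form mxE exchange_big; apply: eq_bigr => b _ /=.
rewrite !mxE mulr_suml; apply: eq_bigr => a _.
by rewrite mulrAC.
Qed.

Lemma formC (B : 'M[R]_4) (v w : E) : B^T = B -> form B v w = form B w v.
Proof.
move=> BT; rewrite !formE exchange_big; apply: eq_bigr => b _.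
by apply: eq_bigr => a _; rewrite -{1}BT mxE (mulrC (v 0 a)).
Qed.

Lemma dmetricC (x u v w : E) : (\forall y \near x, (g y)^T = g y) ->
  dmetric x u v w = dmetric x u w v.
Proof.
move=> gT; apply: near_eq_derive; near=> y; apply: formC.
by near: y.
Unshelve. all: by end_near. Qed.

Lemma nabla_torsion_free (v w : E -> E) (x : E) :
  (\forall y \near x, (g y)^T = g y) ->
  nabla v w x - nabla w v x = bracket v w x.
Proof.
move=> gT; rewrite /nabla /bracket.
suff -> : christoffel x (w x) (v x) = christoffel x (v x) (w x).
  by rewrite opprD addrACA subrr addr0.
congr (_ *m _); apply/rowP => l; rewrite !mxE; congr (_ * (_ - _)).
  exact: addrC.
exact: dmetricC.
Qed.

Lemma dmetricE (x u v w : E) :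
  (forall a b, differentiable (fun y => g y a b : R) x) ->
  dmetric x u v w =
  form (\matrix_(a, b) 'd (fun y => g y a b : R) x u) v w.
Proof.
move=> dg; have dg' a b k : differentiable (fun y => k * g y a b : R) x.
  exact: differentiableM.
rewrite /dmetric (_ : (fun y => _) =
  (\sum_(a < 4) \sum_(b < 4) (fun y => v 0 a * w 0 b * g y a b : R))); last first.
  apply/funext => y; rewrite formE fct_sumE; apply: eq_bigr => a _.
  by rewrite fct_sumE.
rewrite derive_sum; last first.
  move=> a; apply/derivable_sum => b; exact: diff_derivable.
rewrite formE; apply: eq_bigr => a _; rewrite derive_sum; last first.
  by move=> b; exact: diff_derivable.
apply: eq_bigr => b _; rewrite mxE -deriveE //.
by rewrite deriveMl //; exact: diff_derivable.
Qed.

Lemma dmetric_sumr (x u v w : E) :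
  (forall a b, differentiable (fun y => g y a b : R) x) ->
  dmetric x u v w = \sum_l dmetric x u v (basis l) * w 0 l.
Proof.
move=> dg; under eq_bigr do rewrite dmetricE //.
rewrite dmetricE // /form mxE; apply: eq_bigr => l _.
by rewrite /basis trmx_delta -colE !mxE.
Qed.

Lemma dmetric_suml (x u v w : E) :
  (forall a b, differentiable (fun y => g y a b : R) x) ->
  dmetric x u v w = \sum_l dmetric x (basis l) v w * u 0 l.
Proof.
move=> dg; under eq_bigr do rewrite dmetricE // formE mulr_suml.
rewrite dmetricE // formE [RHS]exchange_big; apply: eq_bigr => a _ /=.
under [RHS]eq_bigr do rewrite mulr_suml.
rewrite [RHS]exchange_big; apply: eq_bigr => b _ /=.
rewrite mxE [in LHS](row_sum_delta u) linear_sum mulr_sumr.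
apply: eq_bigr => l _; rewrite mxE linearZ -[RHS]mulrA.
by rewrite [X in _ = _ * X]mulrC.
Qed.

Lemma nabla_metric (x u v w : E) :
  (forall a b, differentiable (fun y => g y a b : R) x) ->
  (\forall y \near x, (g y)^T = g y) -> g x \in unitmx ->
  dmetric x u v w = form (g x) (nabla (cst u) (cst v) x) w
                  + form (g x) v (nabla (cst u) (cst w) x).
Proof.
move=> dg gT gU; have gxT : (g x)^T = g x by exact: nbhs_singleton gT.
have flatE p q r : form (g x) (nabla (cst p) (cst q) x) r =
    2^-1 * (dmetric x p q r + dmetric x q p r - dmetric x r p q).
  rewrite /nabla derive_cst add0r /form /christoffel mulmxKV //.
  rewrite mxE (dmetric_sumr _ q) // (dmetric_sumr _ p) // (dmetric_suml r) //.
  rewrite -big_split -sumrB mulr_sumr; apply: eq_bigr => l _ /=.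
  by rewrite !mxE -mulrDl -mulrBl mulrA.
rewrite [form _ v _]formC // !flatE (dmetricC u w v) //.
by field.
Qed.

(* The rows of e form a positively oriented orthonormal basis for the inner
   product with matrix hx. *)
Definition oriented_frame (hx e : 'M[R]_4) : Prop :=
  e *m hx *m e^T = 1%:M /\ 0 < \det e.

Definition mixed_Ric (x : E) (e : 'M[R]_4) (j l : 'I_4) : R :=
  \sum_(i < 4) Rm x (row i e) (row j e) (row l e) (row i e).

Definition mixed_scal_frame (x : E) (e : 'M[R]_4) : R :=
  \sum_(j < 4) mixed_Ric x e j j.

(* Computed in some oriented hx-orthonormal frame, on which the value does not
   depend. *)
Definition mixed_scal (x : E) (hx : 'M[R]_4) : R :=
  mixed_scal_frame x (xget 0 [set e | oriented_frame hx e]).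

End Curvature.

Section Bivectors.
(* Lambda^2 of a tangent space: xi stands for the sum over a < b of
   xi a b *: (basis a /\ basis b); v /\ w is v^T *m w - w^T *m v. *)
Definition bivector (xi : 'M[R]_4) : Prop := xi^T = - xi.

(* The bilinear map on Lambda^2 determined by its values
   F v w x y on pairs (v /\ w, x /\ y). *)
Definition bilinear_ext (F : E -> E -> E -> E -> R) (xi eta : 'M[R]_4) : R :=
  \sum_(a < 4) \sum_(b < 4 | (a < b)%N) \sum_(c < 4) \sum_(d < 4 | (c < d)%N)
    xi a b * eta c d * F (basis a) (basis b) (basis c) (basis d).

Definition bivector_inner (hx : 'M[R]_4) : 'M[R]_4 -> 'M[R]_4 -> R :=
  bilinear_ext (fun v w x y =>
    form hx v x * form hx w y - form hx v y * form hx w x).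

(* Lambda^4 is identified with R by the coefficient of the coordinate
   4-vector, so that v /\ w /\ x /\ y is a determinant. *)
Definition bivector_wedge : 'M[R]_4 -> 'M[R]_4 -> R :=
  bilinear_ext (fun v w x y => \det (\matrix_(k < 4) nth 0 [:: v; w; x; y] k)).

(* omega_h; the coordinate 4-vector has h-length sqrt (det h). *)
Definition unit_4vector (hx : 'M[R]_4) : R := (Num.sqrt (\det hx))^-1.

Definition is_hodge_star (hx eta zeta : 'M[R]_4) : Prop :=
  bivector zeta /\
  forall xi, bivector xi ->
    bivector_wedge xi zeta = bivector_inner hx xi eta * unit_4vector hx.

Definition hodge_eigenspace (s : R) (hx : 'M[R]_4) : set 'M[R]_4 :=
  [set eta | bivector eta /\ is_hodge_star hx eta (s *: eta)].

Definition Lambda_plus := hodge_eigenspace 1.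
Definition Lambda_minus := hodge_eigenspace (-1).

Definition Rm_bivector (g : E -> 'M[R]_4) (x : E) : 'M[R]_4 -> 'M[R]_4 -> R :=
  bilinear_ext (Rm g x).

End Bivectors.

Section Integration.
Variables (M : topologicalType) (A : oriented_atlas M).

Definition point4 (z : R * R * R * R) : E :=
  let: (x0, x1, x2, x3) := z in \row_(k < 4) nth 0 [:: x0; x1; x2; x3] k.

Definition lebesgue4 : set (R * R * R * R) -> \bar R :=
  (((@lebesgue_measure R \x @lebesgue_measure R) \x @lebesgue_measure R)
     \x @lebesgue_measure R)%E.

(* A finite continuous partition of unity, each function being compactly
   supported in the domain of a chart. *)
Definition partition_of_unity (s : seq (idx A * (M -> R))) : Prop :=
  (forall i rho, (i, rho) \in s ->
     [/\ continuous rho, (forall p, 0 <= rho p) &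
         exists K : set M, [/\ compact K, K `<=` dom i &
                               forall p, ~ K p -> rho p = 0]]) /\
  (forall p, \sum_(c <- s) c.2 p = 1).

(* The integral over M of f dV_h, where f i is the coordinate expression of
   a function in the chart i.  As usual the result does not depend on the
   partition of unity; a fixed one is used for all f and h. *)
Definition volume_integral (h : tensor_field A) (f : idx A -> E -> R) : R :=
  \sum_(c <- xget [::] [set s | partition_of_unity s])
    let: (i, rho) := c in
    Rintegral lebesgue4 [set z | img i (point4 z)]
      (fun z => let x := point4 z in
                rho (inv i x) * f i x * Num.sqrt (\det (h i x))).

End Integration.

Section Functional.
Variables (M : topologicalType) (A : oriented_atlas M).

Definition mixed_action (g h : tensor_field A) : R :=
  volume_integral h (fun i x => mixed_scal (g i) x (h i x)).

Definition critical_point (g h : tensor_field A) : Prop :=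
  forall v : tensor_field A, smooth_symmetric_tensor v ->
    is_derive (0 : R) (1 : R)
      (fun t : R => mixed_action g (fun i x => h i x + t *: v i x)) (0 : R).

(* The equality of symmetric tensors Ric_{g-h} = (scal_{g-h} / 4) h. *)
Definition euler_lagrange (g h : tensor_field A) : Prop :=
  forall i x, img i x -> forall e, oriented_frame (h i x) e ->
  forall j l : 'I_4,
    mixed_Ric (g i) x e j l
    = mixed_scal (g i) x (h i x) / 4 * form (h i x) (row j e) (row l e).

Definition Rm_preserves_duality (g h : tensor_field A) : Prop :=
  forall i x, img i x -> forall xi eta,
    Lambda_plus (h i x) xi -> Lambda_minus (h i x) eta ->
    Rm_bivector (g i) x xi eta = 0.

End Functional.

End Smooth4Manifolds.

(* Main.v *)
(**
In each chart the first variation of scal_{g-h} dV_h in the direction v is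
<(scal/2) h - 2 Ric, v>_h dV_h, with Ric = Ric_{g-h} and scal = scal_{g-h}.
The symmetric tensor T = (scal/2) h - 2 Ric vanishes exactly when the
Euler-Lagrange equation holds.  It is smooth, and it transforms as a tensor
because Rm_g does, so it is an admissible variation: if h is critical then the
integral of |T|_h^2 vanishes, whence T = 0.  Differentiation under the integral
sign is legitimate since the cutoff functions have compact support in the charts.

At a point, choose an oriented h-orthonormal frame e_0, ..., e_3.  The bivectors
e_0^e_1 +- e_2^e_3, e_0^e_2 -+ e_1^e_3, e_0^e_3 +- e_1^e_2 span Lambda^+-, and
the nine components of Rm_g between Lambda^+ and Lambda^- are linear combinations
of the nine components of the trace-free part of Ric, and conversely.
*)
Require Import Defs.
From HB Require Import structures.
From mathcomp Require Import all_boot all_order all_algebra.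
From mathcomp Require Import all_classical all_reals all_analysis.
From mathcomp Require Import perm measurable_realfun ring lra.

Set Implicit Arguments.
Unset Strict Implicit.
Unset Printing Implicit Defensive.

Import Order.TTheory GRing.Theory Num.Theory.
Import numFieldNormedType.Exports.

Local Open Scope classical_set_scope.
Local Open Scope ring_scope.

Local Notation basis := (@Defs.basis _).
Local Notation form := Defs.form.
Local Notation inv := (@Defs.inv _ _ _).

(** * Symmetry of second derivatives *)

(** Two choices hidden in the definitions shape the proof. [mixed_scal] uses a frame picked by
    [xget], with no control on how it varies; every trace is therefore rewritten as a contraction
    with the inverse metric ([ricci], [scal]). As [g] is fixed, [scal] is then a quadratic form in
    [invmx h] whose coefficients do not vary, and its derivative is pure algebra. [volume_integral]
    uses a chosen partition of unity with the empty list as default, so one has to be constructed: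
    otherwise the action could be identically zero. Positivity of [h + t *: v] is another obstacle:
    it holds for small [t] only, with a uniform bound only over a compact set. Cutoffs hide the rest
    of each chart. Smoothness means differentiability of all iterated directional derivatives, so
    the symmetries of [Rm] and its behaviour under transition maps rest on equality of mixed
    derivatives. The pointwise algebra views curvature as a symmetric bilinear form on Lambda^2
    ([curvlike]); one change-of-frame lemma then serves curvature, inner product and wedge product
    alike. *)

Lemma ltr_normB_half (R : realFieldType) (a b d : R) :
  `|a| < d / 2 -> `|b| < d / 2 -> `|a - b| < d.
Proof. by have := ler_normB a b; lra. Qed.

(** Differentiability depends only on the germ: the little-o expansion of [f] serves for [g], and
    uniqueness of the linear part identifies the differentials. Formulas valid only inside a chart
    can thus be differentiated. *)
Lemma near_eq_differentiable (R : realFieldType) (V W : normedModType R)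
    (f g : V -> W) (x : V) :
  (\forall y \near x, f y = g y) -> differentiable f x -> differentiable g x.
Proof.
move=> fg df.
have [cf fE] := (diff_locallyP x f).1 df.
have gE : g \o shift x = cst (g x) + 'd f x +o_ (0 : V) id.
  apply/eqaddoP => e e0; move/eqaddoP : fE => /(_ e e0).
  have fg0 : \forall h \near (0 : V), f (h + x) = g (h + x).
    by have := fg; rewrite (near_shift 0) subr0.
  have fgx : f x = g x by exact: nbhs_singleton fg.
  by apply: filterS2 fg0 => h E; rewrite !fctE /= -E -fgx.
apply/diff_locallyP; have -> : 'd g x = 'd f x :> (V -> W) by exact: diff_unique.
by split.
Qed.

Section DirectionalDerivatives.
Variables (R : realType) (V : normedModType R).
Implicit Types (f : V -> R) (x u v : V) (U : set V).

Lemma is_derive_line f x u (r : R) : derivable f (x + r *: u) u ->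
  is_derive r 1 (fun r : R => f (x + r *: u) : R) ('D_u f (x + r *: u)).
Proof.
have E : (fun h : R => h^-1 *: (f (x + (h *: (1 : R) + r) *: u) - f (x + r *: u))) =
         (fun h => h^-1 *: ((f \o shift (x + r *: u)) (h *: u) - f (x + r *: u))).
  apply/funext => h /=; congr (_ *: (f _ - _)).
  by rewrite /GRing.scale /= mulr1 -/(GRing.scale _ _) scalerDl addrCA.
move=> df; apply: DeriveDef; rewrite ?/derivable ?/derive /= ?E //.
Qed.

Lemma mean_value_line f x u (s : R) : 0 < s ->
  (forall r, 0 <= r <= s -> differentiable f (x + r *: u)) ->
  exists2 c, 0 < c < s & f (x + s *: u) - f x = s * 'D_u f (x + c *: u).
Proof.
move=> s0 df.
have D (r : R) : 0 <= r <= s ->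
    is_derive r 1 (fun r : R => f (x + r *: u) : R) ('D_u f (x + r *: u)).
  by move=> rs; apply: is_derive_line; apply: diff_derivable; exact: df.
have [|c|c] := @MVT R (fun r : R => f (x + r *: u)) (fun r => 'D_u f (x + r *: u)) 0 s s0.
- by move=> r; rewrite in_itv /= => /andP[r0 rs]; apply: D; rewrite !ltW.
- by apply: derivable_within_continuous => r; rewrite in_itv /= => rs; apply: ex_derive; exact: D.
- rewrite in_itv /= => cs; rewrite scale0r addr0 subr0 mulrC => E.
  by exists c.
Qed.

Lemma nbhs_segments x u v U : nbhs x U ->
  exists2 s : R, 0 < s & forall a b : R, 0 <= a <= s -> 0 <= b <= s ->
    U (x + a *: u + b *: v).
Proof.
move=> Ux.
have c : {for (0, 0), continuous (fun p : R * R => x + p.1 *: u + p.2 *: v)}.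
  apply: cvgD; [apply: cvgD; first exact: cvg_cst|].
  - by apply: cvgZr_tmp; exact: cvg_fst.
  - by apply: cvgZr_tmp; exact: cvg_snd.
have /c : nbhs (x + (0 : R) *: u + (0 : R) *: v) U by rewrite !scale0r !addr0.
move=> [[A B] /= [/nbhs_ballP[r r0 rA] /nbhs_ballP[t t0 tB]] AB].
(* Halving makes room for the closed ranges of [a] and [b] inside the open balls. *)
exists (Num.min r t / 2); first by rewrite divr_gt0// lt_min; apply/andP.
have h (a : R) : 0 <= a <= Num.min r t / 2 -> `|a| < Num.min r t.
  move=> /andP[a0 ar]; rewrite ger0_norm// (le_lt_trans ar)// ltr_pdivrMr// ltr_pMr ?ltr1n//.
  by rewrite lt_min; apply/andP.
move=> a b /h ha /h hb; apply: (AB (a, b)); split => /=.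
  by apply: rA; rewrite /ball /= sub0r normrN (lt_le_trans ha) // ge_min lexx.
by apply: tB; rewrite /ball /= sub0r normrN (lt_le_trans hb) // ge_min lexx orbT.
Qed.

(** Two mean value theorems: along [u] for the increment [F] of [f] in the direction [v], then along
    [v] for ['D_u f]. *)
Lemma second_difference f x u v U (s : R) : 0 < s ->
  (forall a b : R, 0 <= a <= s -> 0 <= b <= s -> U (x + a *: u + b *: v)) ->
  (forall y, U y -> differentiable f y) ->
  (forall y, U y -> differentiable ('D_u f : V -> R) y) ->
  exists2 p : V, U p & s * (s * 'D_v ('D_u f : V -> R) p) =
    f (x + s *: u + s *: v) - f (x + s *: u) - f (x + s *: v) + f x.
Proof.
move=> s0 sU df d2f.
pose F y := f (y + s *: v) - f y.
have ss : 0 <= s <= s by rewrite lexx ltW.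
have z0 : 0 <= (0 : R) <= s by rewrite lexx ltW.
have dF1 r : 0 <= r <= s -> differentiable (fun y => f (y + s *: v)) (x + r *: u).
  move=> rs; apply: (@differentiable_comp _ _ _ _ (fun y => y + s *: v) f) => //.
  by apply: df; exact: sU.
have dF0 r : 0 <= r <= s -> differentiable f (x + r *: u).
  by move=> rs; apply: df; rewrite -[x + _]addr0 -(scale0r v); exact: sU.
have dF r : 0 <= r <= s -> differentiable F (x + r *: u).
  by move=> rs; apply: differentiableB; [exact: dF1|exact: dF0].
have [c /andP[c0 cs]] := mean_value_line s0 dF.
have cs' : 0 <= c <= s by rewrite !ltW.
have -> : 'D_u F (x + c *: u) = 'D_u f (x + c *: u + s *: v) - 'D_u f (x + c *: u).
  rewrite (_ : F = (fun y => f (y + s *: v)) - f) //.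
  rewrite (deriveB (diff_derivable (dF1 c cs')) (diff_derivable (dF0 c cs'))).
  congr (_ - _); apply: (f_equal (fun k : R -> R => lim (k @ 0^'))).
  apply: funext => h /=.
  by rewrite !addrA.
move=> E; have [r rs|d /andP[d0 ds] E2] := @mean_value_line ('D_u f) (x + c *: u) v s s0.
  by apply: d2f; exact: sU.
exists (x + c *: u + d *: v); first by apply: sU => //; rewrite !ltW.
rewrite -E2 -E /F; ring.
Qed.

(** The second difference is symmetric in [u] and [v], so the two mixed derivatives agree at points
    [p] and [q] arbitrarily close to [x]. If they differed at [x], continuity with tolerance half
    the gap would be violated. *)
Theorem deriveC f x u v U : open U -> U x ->
  (forall y, U y -> differentiable f y) ->
  (forall y, U y -> differentiable ('D_u f : V -> R) y) ->
  (forall y, U y -> differentiable ('D_v f : V -> R) y) ->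
  {for x, continuous ('D_v ('D_u f : V -> R) : V -> R)} ->
  {for x, continuous ('D_u ('D_v f : V -> R) : V -> R)} ->
  'D_v ('D_u f : V -> R) x = 'D_u ('D_v f : V -> R) x.
Proof.
move=> oU Ux df du dv cuv cvu.
set a := 'D_v _ x; set b := 'D_u _ x.
apply/eqP; rewrite -subr_eq0 -normr_eq0 eq_sym; apply/negPn/negP => ne.
suff : `|a - b| < `|a - b| by rewrite ltxx.
pose e := `|a - b| / 2.
have e0 : 0 < e by rewrite divr_gt0 // lt_neqAle ne normr_ge0.
move/cvgrPdist_lt : cuv => /(_ _ e0) Huv.
move/cvgrPdist_lt : cvu => /(_ _ e0) Hvu.
pose W := U `&` [set y | `|a - 'D_v ('D_u f : V -> R) y| < e]
     `&` [set y | `|b - 'D_u ('D_v f : V -> R) y| < e].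
have nW : nbhs x W.
  apply: filterI; last exact: Hvu.
  by apply: filterI; [exact: open_nbhs_nbhs|exact: Huv].
have [s s0 sW] := nbhs_segments u v nW.
have WU y : W y -> U y by move=> [[]].
have [||p Wp Ep] := @second_difference f x u v W s s0 sW.
- by move=> y /WU; exact: df.
- by move=> y /WU; exact: du.
have [|||q Wq Eq] := @second_difference f x v u W s s0.
- by move=> r t hr ht; rewrite addrAC; exact: sW.
- by move=> y /WU; exact: df.
- by move=> y /WU; exact: dv.
have pq : 'D_v ('D_u f : V -> R) p = 'D_u ('D_v f : V -> R) q.
  have s1 : s != 0 by rewrite gt_eqF.
  have E : s * (s * 'D_v ('D_u f : V -> R) p) = s * (s * 'D_u ('D_v f : V -> R) q).
    apply: etrans Ep _; apply: etrans _ (esym Eq).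
    have -> : x + s *: v + s *: u = x + s *: u + s *: v by rewrite addrAC.
    by congr (_ + _); exact: addrAC.
  exact: (mulfI s1 (mulfI s1 E)).
move: Wp Wq => [[_ /= hp] _] [_ /= hq].
move: (ltr_normB_half hp hq); congr (`|_| < _).
by rewrite opprB addrA -pq subrK.
Qed.

End DirectionalDerivatives.

(** * Closure properties of smooth functions *)

Section SmoothFunctions.
Variables (R : realType).
Notation E := ('rV[R]_4).
Implicit Types (U : set E) (W : normedModType R).

(** Counts [n + 1] orders of differentiability. The product rule turns one function into several, so
    closure properties go by induction on the order rather than on a sequence of directions. *)
Fixpoint Cn W (n : nat) U (f : E -> W) : Prop :=
  (forall x, U x -> differentiable f x) /\
  (if n is m.+1 then forall v, Cn m U ('D_v f : E -> W) else True).

Lemma smooth_on_diff W U (f : E -> W) x : smooth_on U f -> U x -> differentiable f x.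
Proof. by move=> sf; exact: (sf [::]). Qed.

(** [foldr] applies the last direction of the sequence first, so differentiating [f] beforehand
    appends [v] at the end. *)
Lemma smooth_on_derive W U (f : E -> W) v :
  smooth_on U f -> smooth_on U ('D_v f : E -> W).
Proof. by move=> sf s; have := sf (rcons s v); rewrite foldr_rcons. Qed.

Lemma smooth_onP W U (f : E -> W) : smooth_on U f <-> forall n, Cn n U f.
Proof.
split=> [sf n|Cf s].
  elim: n f sf => [|n IH] f sf; split=> //=; try by move=> x; exact: smooth_on_diff.
  by move=> v; apply: IH; exact: smooth_on_derive.
move: {Cf} (Cf (size s)); elim/last_ind: s f => [|s v IH] f.
  by move=> [df _] x; exact: df.
by rewrite size_rcons foldr_rcons => -[_ /(_ v)]; exact: IH.
Qed.

Lemma Cn_weaken W n U (f : E -> W) : Cn n.+1 U f -> Cn n U f.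
Proof.
elim: n f => [|n IH] f [df Df]; split=> // v.
by apply: IH; exact: Df.
Qed.

Lemma Cn_ext W n U (f g : E -> W) : open U -> (forall x, U x -> f x = g x) ->
  Cn n U f -> Cn n U g.
Proof.
move=> oU; elim: n f g => [|n IH] f g fg [df Df]; split=> //.
- move=> x Ux; apply: near_eq_differentiable (df _ Ux).
  by apply: filterS (open_nbhs_nbhs (conj oU Ux)); exact: fg.
- move=> x Ux; apply: near_eq_differentiable (df _ Ux).
  by apply: filterS (open_nbhs_nbhs (conj oU Ux)); exact: fg.
- move=> v; apply: IH (Df v) => x Ux; apply: near_eq_derive.
  by apply: filterS (open_nbhs_nbhs (conj oU Ux)); exact: fg.
Qed.

Lemma Cn_cst W n U (a : W) : Cn n U (cst a).
Proof.
elim: n a => [|n IH] a; split=> // v.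
by rewrite (_ : ('D_v (cst a) : E -> W) = cst 0); [exact: IH|apply/funext => x; exact: derive_cst].
Qed.

Lemma CnD W n U (f g : E -> W) : open U ->
  Cn n U f -> Cn n U g -> Cn n U (f \+ g).
Proof.
move=> oU; elim: n f g => [|n IH] f g [df Df] [dg Dg]; split=> //.
- by move=> x Ux; apply: differentiableD; [exact: df|exact: dg].
- by move=> x Ux; apply: differentiableD; [exact: df|exact: dg].
- move=> v; apply: Cn_ext oU _ (IH _ _ (Df v) (Dg v)) => x Ux /=.
  by rewrite -deriveD //; apply: diff_derivable; [exact: df|exact: dg].
Qed.

(** The Leibniz rule keeps an undifferentiated factor in each summand; [Cn_weaken] lowers its order
    for the induction. *)
Lemma CnM n U (f g : E -> R) : open U ->
  Cn n U f -> Cn n U g -> Cn n U (f \* g).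
Proof.
move=> oU; elim: n f g => [|n IH] f g.
  move=> [df _] [dg _]; split=> // x Ux.
  by apply: differentiableM; [exact: df|exact: dg].
move=> Cf Cg; have [df Df] := Cf; have [dg Dg] := Cg; split=> [x Ux|v].
  by apply: differentiableM; [exact: df|exact: dg].
have H := CnD oU (IH _ _ (Cn_weaken Cf) (Dg v)) (IH _ _ (Cn_weaken Cg) (Df v)).
apply: Cn_ext oU _ H => x Ux /=.
by rewrite (deriveM (diff_derivable (df x Ux)) (diff_derivable (dg x Ux))).
Qed.

Lemma CnV n U (f : E -> R) : open U -> (forall x, U x -> f x != 0) ->
  Cn n U f -> Cn n U (fun x => (f x)^-1).
Proof.
move=> oU f0; elim: n => [|n IH] Cf; have [df Df] := Cf.
  by split=> // x Ux; apply: differentiableV; [exact: df|exact: f0].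
split=> [x Ux|v].
  by apply: differentiableV; [exact: df|exact: f0].
have CV := IH (Cn_weaken Cf).
have H := CnM oU (CnM oU CV CV) (CnM oU (@Cn_cst R n U (-1 : R)) (Df v)).
apply: Cn_ext oU _ H => x Ux /=.
rewrite (deriveV (f0 x Ux) (diff_derivable (df x Ux))) expr2 invfM.
by rewrite /GRing.scale /=; ring.
Qed.

Section Closure.
Variables (U : set E) (oU : open U).

Lemma smooth_on_ext W (f g : E -> W) : (forall x, U x -> f x = g x) ->
  smooth_on U f -> smooth_on U g.
Proof. by move=> fg /smooth_onP Cf; apply/smooth_onP => n; exact: Cn_ext (Cf n). Qed.

Lemma smooth_on_cst W (a : W) : smooth_on U (fun=> a).
Proof. by apply/smooth_onP => n; exact: Cn_cst. Qed.

Lemma smooth_onD W (f g : E -> W) :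
  smooth_on U f -> smooth_on U g -> smooth_on U (fun x => f x + g x).
Proof. by move=> /smooth_onP Cf /smooth_onP Cg; apply/smooth_onP => n; exact: CnD. Qed.

Lemma smooth_onM (f g : E -> R) :
  smooth_on U f -> smooth_on U g -> smooth_on U (fun x => f x * g x).
Proof. by move=> /smooth_onP Cf /smooth_onP Cg; apply/smooth_onP => n; exact: CnM. Qed.

Lemma smooth_onV (f : E -> R) : (forall x, U x -> f x != 0) ->
  smooth_on U f -> smooth_on U (fun x => (f x)^-1).
Proof. by move=> f0 /smooth_onP Cf; apply/smooth_onP => n; exact: CnV. Qed.

Lemma smooth_onN (f : E -> R) : smooth_on U f -> smooth_on U (fun x => - f x).
Proof.
move=> sf; apply: (@smooth_on_ext R (fun x => (-1) * f x)) => [x _|]; first by rewrite mulN1r.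
by apply: smooth_onM => //; exact: smooth_on_cst.
Qed.

Lemma smooth_onB (f g : E -> R) :
  smooth_on U f -> smooth_on U g -> smooth_on U (fun x => f x - g x).
Proof. by move=> sf sg; apply: smooth_onD => //; exact: smooth_onN. Qed.

Lemma smooth_on_sum (I : Type) (r : seq I) (P : pred I) (f : I -> E -> R) :
  (forall i, P i -> smooth_on U (f i)) ->
  smooth_on U (fun x => \sum_(i <- r | P i) f i x).
Proof.
move=> sf; elim: r => [|i r IH].
  apply: (@smooth_on_ext R (fun=> 0)) => [x _|]; [by rewrite big_nil|exact: smooth_on_cst].
apply: (@smooth_on_ext R (fun x => (if P i then f i x else 0) + \sum_(i <- r | P i) f i x)).
  by move=> x _; rewrite big_cons; case: ifP => // _; rewrite add0r.
apply: smooth_onD IH; have := sf i; case: (P i) => [/(_ isT)//|_]; exact: smooth_on_cst.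
Qed.

Lemma smooth_on_prod (I : Type) (r : seq I) (P : pred I) (f : I -> E -> R) :
  (forall i, P i -> smooth_on U (f i)) ->
  smooth_on U (fun x => \prod_(i <- r | P i) f i x).
Proof.
move=> sf; elim: r => [|i r IH].
  apply: (@smooth_on_ext R (fun=> 1)) => [x _|]; [by rewrite big_nil|exact: smooth_on_cst].
apply: (@smooth_on_ext R (fun x => (if P i then f i x else 1) * \prod_(i <- r | P i) f i x)).
  by move=> x _; rewrite big_cons; case: ifP => // _; rewrite mul1r.
apply: smooth_onM IH; have := sf i; case: (P i) => [/(_ isT)//|_]; exact: smooth_on_cst.
Qed.

Lemma smooth_on_det n (f : E -> 'M[R]_n) :
  (forall i j, smooth_on U (fun x => f x i j : R)) ->
  smooth_on U (fun x => \det (f x)).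
Proof.
move=> sf; apply: smooth_on_sum => s _; apply: smooth_onM; first exact: smooth_on_cst.
by apply: smooth_on_prod => i _; exact: sf.
Qed.

(** Cramer's rule: a cofactor divided by the determinant. *)
Lemma smooth_on_invmx n (f : E -> 'M[R]_n) i j :
  (forall x, U x -> f x \in unitmx) ->
  (forall i j, smooth_on U (fun x => f x i j : R)) ->
  smooth_on U (fun x => invmx (f x) i j : R).
Proof.
move=> fU sf.
apply: (@smooth_on_ext R (fun x => (\det (f x))^-1 * cofactor (f x) j i)).
  by move=> x Ux; rewrite /invmx fU // !mxE.
apply: smooth_onM.
  apply: smooth_onV; last exact: smooth_on_det.
  by move=> x /fU; rewrite unitmxE unitfE.
apply: smooth_onM; first exact: smooth_on_cst.
apply: smooth_on_det => k l.
by apply: (@smooth_on_ext R (fun x => f x (lift j k) (lift i l))) => [x _|];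
  [rewrite !mxE|exact: sf].
Qed.

Lemma smooth_on_continuous W (f : E -> W) x :
  smooth_on U f -> U x -> {for x, continuous f}.
Proof. by move=> sf Ux; apply: differentiable_continuous; exact: smooth_on_diff Ux. Qed.

Lemma smooth_on_deriveC (f : E -> R) u v x : smooth_on U f -> U x ->
  'D_u ('D_v f : E -> R) x = 'D_v ('D_u f : E -> R) x.
Proof.
move=> sf Ux; apply: (@deriveC _ _ f x v u U) => //.
- by move=> y; exact: smooth_on_diff.
- by move=> y; apply: smooth_on_diff; exact: smooth_on_derive.
- by move=> y; apply: smooth_on_diff; exact: smooth_on_derive.
- by apply: smooth_on_continuous Ux; do 2!apply: smooth_on_derive.
- by apply: smooth_on_continuous Ux; do 2!apply: smooth_on_derive.
Qed.

End Closure.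
End SmoothFunctions.

(** * Multilinear forms and the chain rule *)

Section Multilinear.
Variable R : realType.
Notation E := ('rV[R]_4).

(** Linearity is encoded as expansion in the basis: a form depending on a point becomes a finite sum
    of coefficient functions, to which the product rule applies. *)
Definition linform (L : E -> R) : Prop :=
  forall u, L u = \sum_b u 0 b * L (basis b).

Definition bilform (B : E -> E -> R) : Prop :=
  (forall u, linform (B u)) /\ (forall w, linform (B^~ w)).

Lemma linformP (L : E -> R) :
  (forall u v, L (u + v) = L u + L v) -> (forall c u, L (c *: u) = c * L u) ->
  linform L.
Proof.
move=> LD LZ u; rewrite {1}(row_sum_delta u).
have L0 : L 0 = 0 by rewrite -(scale0r 0) LZ mul0r.
rewrite (big_morph L LD L0); apply: eq_bigr => b _; exact: LZ.
Qed.

Lemma linformD (L : E -> R) u v : linform L -> L (u + v) = L u + L v.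
Proof.
move=> lL; rewrite !(lL (u + v), lL u, lL v) -big_split; apply: eq_bigr => b _ /=.
by rewrite mxE mulrDl.
Qed.

Lemma linformZ (L : E -> R) c u : linform L -> L (c *: u) = c * L u.
Proof.
move=> lL; rewrite (lL (c *: u)) (lL u) mulr_sumr; apply: eq_bigr => b _ /=.
by rewrite mxE mulrA.
Qed.

Lemma linformN (L : E -> R) u : linform L -> L (- u) = - L u.
Proof. by move=> lL; rewrite -scaleN1r linformZ // mulN1r. Qed.

Lemma linformB (L : E -> R) u v : linform L -> L (u - v) = L u - L v.
Proof. by move=> lL; rewrite linformD // linformN. Qed.

Lemma linform_add (L1 L2 : E -> R) :
  linform L1 -> linform L2 -> linform (fun u => L1 u + L2 u).
Proof.
move=> l1 l2 u; rewrite (l1 u) (l2 u) -big_split.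
by apply: eq_bigr => b _; rewrite mulrDr.
Qed.

Lemma linform_scale c (L : E -> R) : linform L -> linform (fun u => c * L u).
Proof. by move=> lL u; rewrite (lL u) mulr_sumr; apply: eq_bigr => b _; rewrite mulrCA. Qed.

Lemma linform_opp (L : E -> R) : linform L -> linform (fun u => - L u).
Proof. by move=> lL u; rewrite (lL u) -sumrN; apply: eq_bigr => b _; rewrite mulrN. Qed.

Lemma linform_sum (I : finType) (L : I -> E -> R) :
  (forall i, linform (L i)) -> linform (fun u => \sum_i L i u).
Proof.
move=> lL u; under eq_bigr do rewrite lL.
by rewrite exchange_big; apply: eq_bigr => b _; rewrite mulr_sumr.
Qed.

Lemma bilform_form (B : 'M[R]_4) : bilform (form B).
Proof.
split=> u v; rewrite formE.
  rewrite exchange_big; apply: eq_bigr => b _; rewrite formE mulr_sumr.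
  apply: eq_bigr => a _; rewrite (bigD1 b) //= big1 ?addr0.
    by rewrite /basis mxE !eqxx mulr1 mulrCA mulrA.
  by move=> c /negPf cb; rewrite /basis mxE cb andbF mulr0 mul0r.
apply: eq_bigr => a _; rewrite formE [in RHS](bigD1 a) //= [X in _ * (_ + X)]big1 ?addr0.
  by rewrite mulr_sumr; apply: eq_bigr => b _; rewrite /basis mxE !eqxx mul1r mulrA.
by move=> c /negPf ca; rewrite big1 // => b _; rewrite /basis mxE ca andbF !mul0r.
Qed.

Lemma derive_entry n (phi : E -> 'rV[R]_n) x v a : differentiable phi x ->
  'D_v (fun y => phi y 0 a : R) x = 'D_v phi x 0 a.
Proof. by move=> dp; rewrite derive_mx ?mxE //; exact: diff_derivable. Qed.

Lemma differentiable_entry n (phi : E -> 'rV[R]_n) x a : differentiable phi x ->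
  differentiable (fun y => phi y 0 a : R) x.
Proof.
move=> dp; apply: (@differentiable_comp _ _ _ _ phi (fun N : 'rV[R]_n => N 0 a)) => //.
exact: differentiable_coord.
Qed.

Lemma differentiable_rV n (phi : E -> 'rV[R]_n) x :
  (forall a, differentiable (fun y => phi y 0 a : R) x) -> differentiable phi x.
Proof.
move=> dp; rewrite (_ : phi = \sum_a (fun y => phi y 0 a *: (delta_mx 0 a : 'rV[R]_n))).
  by apply: differentiable_sum => a; exact: differentiableZl.
by apply/funext => y; rewrite fct_sumE -row_sum_delta.
Qed.

Lemma derive_comp (f : E -> R) (phi : E -> E) x v :
  differentiable phi x -> differentiable f (phi x) ->
  'D_v (fun y => f (phi y)) x = 'D_('D_v phi x) f (phi x).
Proof.
move=> dp df; rewrite !deriveE //; last exact: differentiable_comp.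
exact: (congr1 (fun k : E -> R => k v) (diff_comp dp df)).
Qed.

Lemma differentiable_sum_mul (f g : 'I_4 -> E -> R) x :
  (forall b, differentiable (f b) x) -> (forall b, differentiable (g b) x) ->
  differentiable (fun y => \sum_b f b y * g b y) x.
Proof.
move=> df dg; rewrite (_ : (fun y => _) = \sum_b (f b * g b)).
  by apply: differentiable_sum => b; exact: differentiableM.
by apply/funext => y; rewrite fct_sumE.
Qed.

Lemma derive_sum_mul (f g : 'I_4 -> E -> R) x v :
  (forall b, differentiable (f b) x) -> (forall b, differentiable (g b) x) ->
  'D_v (fun y => \sum_b f b y * g b y) x =
  \sum_b ('D_v (f b) x * g b x + f b x * 'D_v (g b) x).
Proof.
move=> df dg; rewrite (_ : (fun y => _) = \sum_b (f b * g b)); last first.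
  by apply/funext => y; rewrite fct_sumE.
rewrite derive_sum => [|b]; last first.
  by apply: diff_derivable; exact: differentiableM.
apply: eq_bigr => b _; rewrite deriveM; [|exact: diff_derivable..].
by rewrite addrC /GRing.scale /= [g b x * _]mulrC.
Qed.

Section Chain.
Variables (phi u w : E -> E) (x : E).
Hypotheses (dphi : differentiable phi x) (du : differentiable u x)
  (dw : differentiable w x).

Section Linear.
Variable L : E -> E -> R.
Hypotheses (lL : forall p, linform (L p))
  (dL : forall b, differentiable (fun p => L p (basis b)) (phi x)).

Let LE : (fun y => L (phi y) (u y)) =
  fun y => \sum_b u y 0 b * L (phi y) (basis b).
Proof. by apply/funext => y; exact: lL. Qed.

Let dLphi b : differentiable (fun y => L (phi y) (basis b)) x.
Proof. exact: (@differentiable_comp _ _ _ _ phi (fun p => L p (basis b))). Qed.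

Lemma differentiable_linear : differentiable (fun y => L (phi y) (u y)) x.
Proof.
by rewrite LE; apply: differentiable_sum_mul => // b; exact: differentiable_entry.
Qed.

(** Product rule for the expansion in the basis: the coefficients vary along [phi] with the argument
    frozen, or the argument varies with the coefficients frozen. *)
Lemma derive_linear v : 'D_v (fun y => L (phi y) (u y)) x =
  'D_('D_v phi x) (fun p => L p (u x)) (phi x) + L (phi x) ('D_v u x).
Proof.
rewrite LE derive_sum_mul //; last by move=> b; exact: differentiable_entry.
rewrite big_split /= addrC (lL (phi x) ('D_v u x)); congr (_ + _); last first.
  by apply: eq_bigr => b _; rewrite derive_entry.
rewrite (_ : (fun p => L p (u x)) = (fun p => \sum_b u x 0 b * L p (basis b))); last first.
  by apply/funext => p; exact: lL.
rewrite (@derive_sum_mul (fun b => cst (u x 0 b))) //.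
by apply: eq_bigr => b _; rewrite derive_cst mul0r add0r
  (@derive_comp (fun p => L p (basis b)) phi).
Qed.

End Linear.

Variable B : E -> E -> E -> R.
Hypotheses (bB : forall p, bilform (B p))
  (dB : forall a b, differentiable (fun p => B p (basis a) (basis b)) (phi x)).

Let dBu t b : differentiable (fun p => B p t (basis b)) (phi x).
Proof.
rewrite (_ : (fun p => _) = (fun p => \sum_a t 0 a * B p (basis a) (basis b))).
  by apply: (@differentiable_sum_mul (fun a => cst (t 0 a))).
by apply/funext => p; exact: (bB p).2.
Qed.

Let BE : (fun y => B (phi y) (u y) (w y)) =
  fun y => \sum_b w y 0 b * B (phi y) (u y) (basis b).
Proof. by apply/funext => y; exact: (bB (phi y)).1. Qed.

Let dBphi b : differentiable (fun y => B (phi y) (u y) (basis b)) x.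
Proof.
apply: (@differentiable_linear (fun p t => B p t (basis b))) => // p.
exact: (bB p).2.
Qed.

Lemma differentiable_bilinear : differentiable (fun y => B (phi y) (u y) (w y)) x.
Proof.
by rewrite BE; apply: differentiable_sum_mul => // b; exact: differentiable_entry.
Qed.

Lemma derive_bilinear v : 'D_v (fun y => B (phi y) (u y) (w y)) x =
  'D_('D_v phi x) (fun p => B p (u x) (w x)) (phi x)
  + B (phi x) ('D_v u x) (w x) + B (phi x) (u x) ('D_v w x).
Proof.
rewrite BE derive_sum_mul //; last by move=> b; exact: differentiable_entry.
rewrite big_split /= addrC ((bB (phi x)).1 (u x) ('D_v w x)); congr (_ + _); last first.
  by apply: eq_bigr => b _; rewrite derive_entry.
rewrite (_ : (fun p => B p (u x) (w x)) =
  (fun p => \sum_b w x 0 b * B p (u x) (basis b))); last first.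
  by apply/funext => p; exact: (bB p).1.
rewrite (@derive_sum_mul (fun b => cst (w x 0 b))) // ((bB (phi x)).1 _ (w x)) -big_split.
apply: eq_bigr => b _ /=; rewrite derive_cst mul0r add0r -mulrDr; congr (_ * _).
rewrite (@derive_linear (fun p t => B p t (basis b))) // => p.
exact: (bB p).2.
Qed.

End Chain.
End Multilinear.

Section NearChain.
Variable R : realType.
Notation E := ('rV[R]_4).
Variables (phi u w : E -> E) (x : E).
Hypotheses (dphi : differentiable phi x) (du : differentiable u x)
  (dw : differentiable w x).

Let nphi (P : set E) : (\forall p \near phi x, P p) -> \forall y \near x, P (phi y).
Proof. by apply: (@differentiable_continuous _ _ _ _ phi). Qed.

(** Christoffel symbols are known to be bilinear only over a chart image. Replacing [B] by the zero
    form wherever bilinearity fails gives a form bilinear everywhere with the same germ at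
    [phi x]. *)
Lemma near_differentiable_bilinear (B : E -> E -> E -> R) :
  (\forall p \near phi x, bilform (B p)) ->
  (forall a b, differentiable (fun p => B p (basis a) (basis b)) (phi x)) ->
  differentiable (fun y => B (phi y) (u y) (w y)) x.
Proof.
move=> bB dB; pose B' p := if `[< bilform (B p) >] then B p else fun _ _ => 0.
have BB' : \forall p \near phi x, B p = B' p.
  by apply: filterS bB => p /asboolP; rewrite /B' => ->.
have bB' p : bilform (B' p).
  by rewrite /B'; case: asboolP => // _; split=> t s; rewrite big1 // => b _; rewrite mulr0.
apply: near_eq_differentiable (differentiable_bilinear dphi du dw bB' _).
  by apply: filterS (nphi BB') => y /= ->.
by move=> a b; apply: near_eq_differentiable (dB a b); apply: filterS BB' => p /= ->.
Qed.

Lemma near_derive_bilinear (B : E -> E -> E -> R) v :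
  (\forall p \near phi x, bilform (B p)) ->
  (forall a b, differentiable (fun p => B p (basis a) (basis b)) (phi x)) ->
  'D_v (fun y => B (phi y) (u y) (w y)) x =
  'D_('D_v phi x) (fun p => B p (u x) (w x)) (phi x)
  + B (phi x) ('D_v u x) (w x) + B (phi x) (u x) ('D_v w x).
Proof.
move=> bB dB; pose B' p := if `[< bilform (B p) >] then B p else fun _ _ => 0.
have BB' : \forall p \near phi x, B p = B' p.
  by apply: filterS bB => p /asboolP; rewrite /B' => ->.
have bB' p : bilform (B' p).
  by rewrite /B'; case: asboolP => // _; split=> t s; rewrite big1 // => b _; rewrite mulr0.
rewrite (_ : 'D_v _ x = 'D_v (fun y => B' (phi y) (u y) (w y)) x); last first.
  by apply: near_eq_derive; apply: filterS (nphi BB') => y /= ->.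
rewrite (_ : 'D__ _ (phi x) = 'D_('D_v phi x) (fun p => B' p (u x) (w x)) (phi x)); last first.
  by apply: near_eq_derive; apply: filterS BB' => y /= ->.
rewrite (nbhs_singleton BB') (derive_bilinear dphi du dw bB') // => a b.
by apply: near_eq_differentiable (dB a b); apply: filterS BB' => p ->.
Qed.

Lemma near_derive_linear (L : E -> E -> R) v :
  (\forall p \near phi x, linform (L p)) ->
  (forall b, differentiable (fun p => L p (basis b)) (phi x)) ->
  'D_v (fun y => L (phi y) (u y)) x =
  'D_('D_v phi x) (fun p => L p (u x)) (phi x) + L (phi x) ('D_v u x).
Proof.
move=> lL dL; pose L' p := if `[< linform (L p) >] then L p else fun _ => 0.
have LL' : \forall p \near phi x, L p = L' p.
  by apply: filterS lL => p /asboolP; rewrite /L' => ->.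
have lL' p : linform (L' p).
  by rewrite /L'; case: asboolP => // _ t; rewrite big1 // => b _; rewrite mulr0.
rewrite (_ : 'D_v _ x = 'D_v (fun y => L' (phi y) (u y)) x); last first.
  by apply: near_eq_derive; apply: filterS (nphi LL') => y /= ->.
rewrite (_ : 'D__ _ (phi x) = 'D_('D_v phi x) (fun p => L' p (u x)) (phi x)); last first.
  by apply: near_eq_derive; apply: filterS LL' => y /= ->.
rewrite (nbhs_singleton LL') (derive_linear dphi du lL') // => b.
by apply: near_eq_differentiable (dL b); apply: filterS LL' => p ->.
Qed.

End NearChain.

(** * The curvature tensor in a chart *)

(** Applied with [U] a whole chart image, and with [U] an overlap when two charts are compared. *)
Definition metric_on (R : realType) (U : set 'rV[R]_4) (g : 'rV[R]_4 -> 'M[R]_4) :=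
  [/\ open U, (forall a b, smooth_on U (fun x => g x a b : R)),
      (forall x, U x -> (g x)^T = g x) & (forall x, U x -> g x \in unitmx)].

Section MetricChart.
Variable R : realType.
Notation E := ('rV[R]_4).
Variables (g : E -> 'M[R]_4) (U : set E).
Hypothesis mg : metric_on U g.

Let oU : open U. Proof. by case: mg. Qed.
Let sg a b : smooth_on U (fun x => g x a b : R). Proof. by case: mg. Qed.
Let gT x : U x -> (g x)^T = g x. Proof. by case: mg => _ _ + _; exact. Qed.
Let gU x : U x -> g x \in unitmx. Proof. by case: mg => _ _ _; exact. Qed.

Local Notation Gamma := (christoffel g).

Let near_U x : U x -> \forall y \near x, U y.
Proof. by move=> Ux; exact: open_nbhs_nbhs. Qed.

Lemma metric_near_sym x : U x -> \forall y \near x, (g y)^T = g y.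
Proof. by move=> Ux; apply: filterS (near_U Ux) => y; exact: gT. Qed.

Lemma metric_diff x a b : U x -> differentiable (fun y => g y a b : R) x.
Proof. by move=> Ux; exact: smooth_on_diff Ux. Qed.

Lemma smooth_form v w : smooth_on U (fun x => form (g x) v w : R).
Proof.
apply: (@smooth_on_ext _ _ oU _ (fun x => \sum_a \sum_b v 0 a * w 0 b * g x a b)).
  by move=> x _; rewrite formE.
apply: smooth_on_sum => // a _; apply: smooth_on_sum => // b _.
by apply: smooth_onM => //; exact: smooth_on_cst.
Qed.

Lemma smooth_dmetric u v w : smooth_on U (fun x => dmetric g x u v w : R).
Proof. exact: (smooth_on_derive u (smooth_form v w)). Qed.

Lemma smooth_christoffel v w k : smooth_on U (fun x => Gamma x v w 0 k : R).
Proof.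
apply: (@smooth_on_ext _ _ oU _ (fun x => \sum_l
  (2^-1 * (dmetric g x v w (basis l) + dmetric g x w v (basis l)
    - dmetric g x (basis l) v w)) * invmx (g x) l k)).
  by move=> x _; rewrite [RHS]mxE; apply: eq_bigr => l _; rewrite mxE.
apply: smooth_on_sum => // l _; apply: smooth_onM => //; last exact: smooth_on_invmx.
apply: smooth_onM => //; first exact: smooth_on_cst.
apply: smooth_onB => //; last exact: smooth_dmetric.
by apply: smooth_onD => //; exact: smooth_dmetric.
Qed.

Lemma bilform_dmetric x u : U x -> bilform (dmetric g x u).
Proof.
move=> Ux; have [h1 h2] :=
  bilform_form (\matrix_(a, b) 'd (fun y => g y a b : R) x u).
have E2 v w : dmetric g x u v w = form (\matrix_(a, b) 'd (fun y => g y a b : R) x u) v w.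
  by apply: dmetricE => a b; exact: metric_diff.
by split=> v w; rewrite E2; under eq_bigr do rewrite E2; [exact: h1|exact: h2].
Qed.

Lemma linform_dmetric x v w : U x -> linform (fun u => dmetric g x u v w).
Proof.
move=> Ux u; rewrite dmetric_suml => [|a b]; last exact: metric_diff.
by apply: eq_bigr => l _; rewrite mulrC.
Qed.

(** Koszul's formula with an arbitrary last vector; [christoffel_flat] lists its values on the
    basis. *)
Definition koszul x v w z : R :=
  2^-1 * (dmetric g x v w z + dmetric g x w v z - dmetric g x z v w).

Lemma form_christoffel x v w z : U x ->
  form (g x) (Gamma x v w) z = koszul x v w z.
Proof.
move=> Ux; rewrite /koszul /Defs.form /christoffel mulmxKV ?gU // mxE.
rewrite ((bilform_dmetric v Ux).1 w z) ((bilform_dmetric w Ux).1 v z).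
rewrite (linform_dmetric v w Ux) -big_split -sumrB mulr_sumr.
by apply: eq_bigr => l _ /=; rewrite !mxE; ring.
Qed.

Lemma form_nondegenerate (B : 'M[R]_4) (v w : E) : B \in unitmx ->
  (forall z, form B v z = form B w z) -> v = w.
Proof.
move=> uB h; suff : v *m B = w *m B by move=> /(congr1 (mulmx^~ (invmx B))); rewrite !mulmxK.
apply/rowP => k; have := h (basis k).
by rewrite /Defs.form /Defs.basis trmx_delta -!colE !mxE.
Qed.

Lemma koszul_bilform x z : U x -> bilform (fun v w => koszul x v w z).
Proof.
move=> Ux; split=> t; apply: linform_scale; apply: linform_add.
- apply: linform_add; [exact: (bilform_dmetric t Ux).2|exact: linform_dmetric].
- by apply: linform_opp; exact: (bilform_dmetric z Ux).1.
- apply: linform_add; [exact: linform_dmetric|exact: (bilform_dmetric t Ux).2].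
- by apply: linform_opp; exact: (bilform_dmetric z Ux).2.
Qed.

Lemma koszulC x v w z : U x -> koszul x v w z = koszul x w v z.
Proof.
move=> Ux; rewrite /koszul [dmetric g x z v w]dmetricC; last exact: metric_near_sym.
by rewrite [_ + dmetric g x w v z]addrC.
Qed.

Lemma christoffelE x v w k :
  Gamma x v w 0 k = \sum_l invmx (g x) l k * koszul x v w (basis l).
Proof. by rewrite mxE; apply: eq_bigr => l _; rewrite mxE mulrC. Qed.

Lemma christoffelC x v w : U x -> Gamma x v w = Gamma x w v.
Proof.
move=> Ux; apply/rowP => k; rewrite !christoffelE.
by apply: eq_bigr => l _; rewrite koszulC.
Qed.

Lemma bilform_christoffel x k : U x -> bilform (fun v w => Gamma x v w 0 k).
Proof.
move=> Ux; split=> t.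
  under eq_fun do rewrite christoffelE.
  by apply: linform_sum => l; apply: linform_scale; exact: (koszul_bilform _ Ux).1.
under eq_fun do rewrite christoffelE.
by apply: linform_sum => l; apply: linform_scale; exact: (koszul_bilform _ Ux).2.
Qed.

Lemma differentiable_christoffel x v w : U x -> differentiable (fun p => Gamma p v w) x.
Proof.
move=> Ux; apply: differentiable_rV => k.
exact: smooth_on_diff (smooth_christoffel v w k) Ux.
Qed.

(* The value at x of nabla_v (nabla_w y) for constant vector fields. *)
Definition nabla2 x v w y : E :=
  'D_v (fun p => Gamma p w y) x + Gamma x v (Gamma x w y).

(** Constant fields commute, so the [bracket] term vanishes, and the covariant derivative of one
    constant field along another is a Christoffel vector field. *)
Lemma RmE x v w y z : U x ->
  Rm g x v w y z = form (g x) (nabla2 x v w y - nabla2 x w v y) z.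
Proof.
move=> Ux; rewrite /Rm; apply: (congr1 (fun t => form (g x) t z)).
have nE s t : nabla g (cst s) (cst t) = fun p => Gamma p s t.
  by apply/funext => p; rewrite /nabla derive_cst add0r.
rewrite (_ : nabla g (bracket _ _) _ x = 0); last first.
  rewrite /nabla /bracket derive_cst add0r !derive_cst subr0.
  apply/rowP => k; rewrite ((bilform_christoffel k Ux).2 _ 0) mxE big1 // => b _.
  by rewrite mxE mul0r.
by rewrite subr0 !nE.
Qed.

(** Differentiating [form (g p) (Gamma p w y) z] along [v] also differentiates [g]; metric
    compatibility turns that term into two Christoffel products, one of which completes [nabla2]. No
    derivative of [invmx (g x)] ever appears. *)
Lemma form_nabla2 x v w y z : U x ->
  form (g x) (nabla2 x v w y) z =
  'D_v (fun p => koszul p w y z) x - form (g x) (Gamma x w y) (Gamma x v z).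
Proof.
move=> Ux.
have [bl _] := bilform_form (g x); have [_ bl2] := bilform_form (g x).
rewrite /nabla2 (linformD _ _ (bl2 z)).
have -> : 'D_v (fun p => koszul p w y z) x =
  'D_v (fun p => form (g p) (Gamma p w y) z) x.
  by apply: near_eq_derive; apply: filterS (near_U Ux) => p Up; rewrite form_christoffel.
have did : differentiable (id : E -> E) x by [].
have dz : differentiable (cst z : E -> E) x by [].
have dG := differentiable_christoffel w y Ux.
have dcoef a b : differentiable (fun p => form (g p) (basis a) (basis b) : R) x.
  exact: smooth_on_diff (smooth_form _ _) Ux.
rewrite (derive_bilinear did dG dz (fun p => bilform_form (g p)) dcoef).
rewrite derive_id derive_cst [form (g x) _ 0](bl _ 0) [X in _ + X - _]big1 ?addr0; last first.
  by move=> b _; rewrite mxE mul0r.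
rewrite -/(dmetric g x v (Gamma x w y) z) nabla_metric; last 3 first.
- by move=> a b; exact: metric_diff.
- exact: metric_near_sym.
- exact: gU.
have nE s t : nabla g (cst s) (cst t) x = Gamma x s t by rewrite /nabla derive_cst add0r.
by rewrite !nE; ring.
Qed.

Definition Hess x u v w z : R := 'D_u (fun p => dmetric g p v w z) x.

Lemma Hess_sym12 x u v w z : U x -> Hess x u v w z = Hess x v u w z.
Proof. by move=> Ux; exact: (smooth_on_deriveC oU _ _ (smooth_form w z)). Qed.

Lemma Hess_sym34 x u v w z : U x -> Hess x u v w z = Hess x u v z w.
Proof.
move=> Ux; apply: near_eq_derive; apply: filterS (near_U Ux) => p Up.
by apply: dmetricC; exact: metric_near_sym.
Qed.

Lemma derive_koszul x u v w z : U x -> 'D_u (fun p => koszul p v w z) x =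
  2^-1 * (Hess x u v w z + Hess x u w v z - Hess x u z v w).
Proof.
move=> Ux.
have d a b c : derivable (fun p => dmetric g p a b c : R) x u.
  by apply: diff_derivable; exact: smooth_on_diff (smooth_dmetric _ _ _) Ux.
have d1 := derivableD (d v w z) (d w v z).
rewrite /Hess -(deriveD (d v w z) (d w v z)) -(deriveB d1 (d z v w)).
exact: (deriveMl _ (derivableB d1 (d z v w))).
Qed.

(** The classical coordinate formula for the lowered curvature tensor: second derivatives of the
    metric plus products of Christoffel symbols. The terms with both [v] and [w] as directions of
    differentiation cancel by equality of mixed derivatives. The antisymmetry in the last pair and
    the exchange of pairs are read off from it. *)
Lemma RmEsym x v w y z : U x -> Rm g x v w y z =
  2^-1 * (Hess x v y w z - Hess x v z w y - Hess x w y v z + Hess x w z v y)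
  - form (g x) (Gamma x w y) (Gamma x v z) + form (g x) (Gamma x v y) (Gamma x w z).
Proof.
move=> Ux; rewrite (RmE _ _ _ _ Ux).
apply: etrans (linformB (nabla2 x v w y) (nabla2 x w v y) ((bilform_form (g x)).2 z)) _.
apply: etrans (f_equal2 _ (form_nabla2 v w y z Ux)
  (congr1 (@GRing.opp R) (form_nabla2 w v y z Ux))) _.
rewrite !(derive_koszul _ _ _ _ Ux) (Hess_sym12 w v y z Ux).
move: (Hess x v w y z) (Hess x v y w z) (Hess x v z w y) (Hess x w y v z) (Hess x w z v y).
move: (form (g x) (Gamma x w y) (Gamma x v z)) (form (g x) (Gamma x v y) (Gamma x w z)) =>
  p q a b c d e.
ring.
Qed.

Lemma Rm_anti12 x v w y z : U x -> Rm g x w v y z = - Rm g x v w y z.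
Proof.
move=> Ux; apply: etrans (RmE w v y z Ux) _.
apply: etrans _ (esym (congr1 (@GRing.opp R) (RmE v w y z Ux))).
apply: etrans _ (linformN _ ((bilform_form (g x)).2 z)).
by apply: (congr1 (fun t => form (g x) t z)); rewrite opprB.
Qed.

Lemma Rm_anti34 x v w y z : U x -> Rm g x v w z y = - Rm g x v w y z.
Proof.
move=> Ux; rewrite (RmEsym v w z y Ux) (RmEsym v w y z Ux).
rewrite (Defs.formC (Gamma x w z) _ (gT Ux)) (Defs.formC (Gamma x v z) _ (gT Ux)).
move: (Hess x v y w z) (Hess x v z w y) (Hess x w y v z) (Hess x w z v y).
move: (form (g x) (Gamma x w y) (Gamma x v z)) (form (g x) (Gamma x v y) (Gamma x w z)) =>
  p q a b c d.
ring.
Qed.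

(** Exchanging the pairs swaps the directions of differentiation with the metric arguments in each
    second derivative; the symmetries of [Hess] and of [Gamma] restore the original four terms and
    the two products. *)
Lemma Rm_pair x v w y z : U x -> Rm g x y z v w = Rm g x v w y z.
Proof.
move=> Ux; rewrite (RmEsym y z v w Ux) (RmEsym v w y z Ux).
rewrite (christoffelC z v Ux) (christoffelC y w Ux) (christoffelC y v Ux).
rewrite (christoffelC z w Ux) (Defs.formC (Gamma x v z) _ (gT Ux)).
rewrite (Hess_sym12 y v z w Ux) (Hess_sym12 y w z v Ux).
rewrite (Hess_sym12 z v y w Ux) (Hess_sym12 z w y v Ux).
rewrite (Hess_sym34 v y z w Ux) (Hess_sym34 w y z v Ux).
rewrite (Hess_sym34 v z y w Ux) (Hess_sym34 w z y v Ux).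
move: (Hess x v y w z) (Hess x v z w y) (Hess x w y v z) (Hess x w z v y).
move: (form (g x) (Gamma x w y) (Gamma x v z)) (form (g x) (Gamma x v y) (Gamma x w z)) =>
  p q a b c d.
ring.
Qed.

Lemma Rm_lin4 x v w y : U x -> linform (Rm g x v w y).
Proof.
by move=> Ux z; rewrite RmE // ((bilform_form _).1 _ z); apply: eq_bigr => b _; rewrite RmE.
Qed.

Lemma smooth_Rm v w y z : smooth_on U (fun x => Rm g x v w y z : R).
Proof.
have sG s t : smooth_on U (fun x => form (g x) s t : R) by exact: smooth_form.
have sGG a b c d : smooth_on U (fun x => form (g x) (Gamma x a b) (Gamma x c d) : R).
  apply: (@smooth_on_ext _ _ oU _ (fun x => \sum_i \sum_j
     Gamma x a b 0 i * Gamma x c d 0 j * g x i j)); first by move=> x _; rewrite formE.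
  apply: smooth_on_sum => // i _; apply: smooth_on_sum => // j _.
  by apply: smooth_onM => //; apply: smooth_onM => //; exact: smooth_christoffel.
have sH a b c d : smooth_on U (fun x => Hess x a b c d).
  by apply: smooth_on_derive; exact: smooth_dmetric.
apply: (@smooth_on_ext _ _ oU _ (fun x =>
  2^-1 * (Hess x v y w z - Hess x v z w y - Hess x w y v z + Hess x w z v y)
  - form (g x) (Gamma x w y) (Gamma x v z) + form (g x) (Gamma x v y) (Gamma x w z))).
  by move=> x Ux; rewrite (RmEsym _ _ _ _ Ux).
apply: smooth_onD => //; apply: smooth_onB => //; apply: smooth_onM => //.
  exact: smooth_on_cst.
by apply: smooth_onD => //; apply: smooth_onB => //; exact: smooth_onB.
Qed.

End MetricChart.

(** * Change of charts *)

Section ChangeOfChart.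
Variable R : realType.
Notation E := ('rV[R]_4).
Variables (g1 g2 : E -> 'M[R]_4) (U1 U2 : set E) (phi : E -> E).
Hypotheses (mg1 : metric_on U1 g1) (mg2 : metric_on U2 g2)
  (phiU : forall x, U1 x -> U2 (phi x))
  (sphi : smooth_on U1 phi)
  (Junit : forall x, U1 x -> 'J phi x \in unitmx)
  (g12 : forall x, U1 x -> g1 x = 'J phi x *m g2 (phi x) *m ('J phi x)^T).

Let oU1 : open U1. Proof. by case: mg1. Qed.
Let oU2 : open U2. Proof. by case: mg2. Qed.
Let g2T x : U2 x -> (g2 x)^T = g2 x. Proof. by case: mg2 => _ _ + _; exact. Qed.
Let g2U x : U2 x -> g2 x \in unitmx. Proof. by case: mg2 => _ _ _; exact. Qed.

Local Notation P w x := (derive phi x w).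
Local Notation PF w := ('D_w phi : E -> E).

Let near_U1 x : U1 x -> \forall y \near x, U1 y.
Proof. by move=> Ux; exact: open_nbhs_nbhs. Qed.

Let near_U2 x : U1 x -> \forall y \near phi x, U2 y.
Proof. by move=> Ux; apply: open_nbhs_nbhs; split=> //; exact: phiU. Qed.

Let dphi x : U1 x -> differentiable phi x.
Proof. exact: smooth_on_diff. Qed.

Let dP w x : U1 x -> differentiable (PF w) x.
Proof. by move=> Ux; apply: smooth_on_diff Ux; exact: smooth_on_derive. Qed.

Lemma pushforwardE w x : U1 x -> P w x = w *m 'J phi x.
Proof. by move=> Ux; rewrite deriveEjacobian //; exact: dphi. Qed.

Lemma form_congr (B J : 'M[R]_4) v w : form (J *m B *m J^T) v w = form B (v *m J) (w *m J).
Proof. by rewrite /Defs.form trmx_mul !mulmxA. Qed.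

Lemma form_pullback v w x : U1 x -> form (g1 x) v w = form (g2 (phi x)) (P v x) (P w x).
Proof. by move=> Ux; rewrite g12 // form_congr !pushforwardE. Qed.

Lemma smooth_entry k : smooth_on U1 (fun y => phi y 0 k : R).
Proof.
apply/smooth_onP => n; move/smooth_onP : sphi => /(_ n).
elim: n (phi) => [|n IH] f [df Df]; split=> //.
- by move=> x /df; exact: differentiable_entry.
- by move=> x /df; exact: differentiable_entry.
- move=> v; apply: Cn_ext oU1 _ (IH _ (Df v)) => x Ux.
  by rewrite derive_entry //; exact: df.
Qed.

Lemma derive2_entry u v x k : U1 x ->
  'D_u (PF v) x 0 k = 'D_u ('D_v (fun y => phi y 0 k : R) : E -> R) x.
Proof.
move=> Ux; rewrite -derive_entry; last exact: dP.
apply: near_eq_derive; apply: filterS (near_U1 Ux) => y Uy.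
by rewrite derive_entry //; exact: dphi.
Qed.

Lemma derive2C u v x : U1 x -> 'D_u (PF v) x = 'D_v (PF u) x.
Proof.
move=> Ux; apply/rowP => k; apply: etrans (derive2_entry u v k Ux) _.
apply: etrans _ (esym (derive2_entry v u k Ux)).
exact: (smooth_on_deriveC oU1 _ _ (smooth_entry k)).
Qed.

Lemma dmetric_pullback u v w x : U1 x ->
  dmetric g1 x u v w = dmetric g2 (phi x) (P u x) (P v x) (P w x)
    + form (g2 (phi x)) ('D_u (PF v) x) (P w x)
    + form (g2 (phi x)) (P v x) ('D_u (PF w) x).
Proof.
move=> Ux; rewrite /dmetric -(@derive_bilinear _ phi (PF v) (PF w) x _ _ _ (fun p => form (g2 p))).
- by apply: near_eq_derive; apply: filterS (near_U1 Ux) => y Uy; exact: form_pullback.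
- exact: dphi.
- exact: dP.
- exact: dP.
- by move=> p; exact: bilform_form.
- by move=> a b; exact: smooth_on_diff (smooth_form mg2 _ _) (phiU Ux).
Qed.

(** Of the six second-derivative corrections in Koszul's formula four cancel in pairs; the other two
    coincide and absorb the factor [2^-1]. *)
Lemma koszul_correction (F : E -> E -> R) (pv pw pz hvw hwv hvz hzv hwz hzw : E) (a b c : R) :
  (forall s t, F s t = F t s) -> hwv = hvw -> hzv = hvz -> hzw = hwz ->
  2^-1 * (a + F hvw pz + F pw hvz + (b + F hwv pz + F pv hwz)
    - (c + F hzv pw + F pv hzw)) = 2^-1 * (a + b - c) + F hvw pz.
Proof. by move=> FC -> -> ->; rewrite (FC hvz); field. Qed.

(** The inhomogeneous transformation law of the connection. Both sides are paired with an arbitrary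
    vector, which is a pushforward because the Jacobian is invertible, and Koszul's formulas are
    compared. *)
Lemma christoffel_pullback v w x : U1 x ->
  P (christoffel g1 x v w) x =
  christoffel g2 (phi x) (P v x) (P w x) + 'D_v (PF w) x.
Proof.
move=> Ux; have U2x := phiU Ux; apply: (form_nondegenerate (g2U U2x)) => z'.
have -> : z' = P (z' *m invmx ('J phi x)) x by rewrite pushforwardE // mulmxKV // Junit.
move: (z' *m _) => z.
rewrite -(form_pullback _ _ Ux) (form_christoffel mg1) //.
have [bl1 bl2] := bilform_form (g2 (phi x)).
rewrite [RHS](linformD _ _ (bl2 (P z x))) (form_christoffel mg2) //.
rewrite /koszul !(dmetric_pullback _ _ _ Ux).
apply: koszul_correction (derive2C w v Ux) (derive2C z v Ux) (derive2C z w Ux).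
by move=> s t; apply: Defs.formC; exact: g2T.
Qed.

(* Correction terms symmetric in v and w, which cancel in the curvature. *)
Definition nabla2_sym x v w y : E :=
  christoffel g2 (phi x) ('D_v (PF w) x) (P y x)
  + (christoffel g2 (phi x) (P w x) ('D_v (PF y) x)
     + christoffel g2 (phi x) (P v x) ('D_w (PF y) x)).

Lemma eq_addl_sub (X d p T : R) : X = d + p -> X = T -> p = T - d.
Proof. by move=> -> <-; rewrite addrC addKr. Qed.

Lemma nabla2_collect (p1 p2 p3 t1 t2 t4 t5 d e e' h : R) :
  p1 = t1 + t2 + t4 + t5 - d -> p2 = p3 + d -> p3 = h + e -> t1 = e' ->
  p1 + p2 = e' + h + (t2 + (t4 + e)) + t5.
Proof. by move=> -> -> -> ->; ring. Qed.

Lemma nabla2_pullback v w y x : U1 x ->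
  P (nabla2 g1 x v w y) x =
  nabla2 g2 (phi x) (P v x) (P w x) (P y x)
  + nabla2_sym x v w y + 'D_v ('D_w (PF y) : E -> E) x.
Proof.
move=> Ux; have U2x := phiU Ux; apply/rowP => k.
have did : differentiable (id : E -> E) x by [].
have dG1 := differentiable_christoffel mg1 w y Ux.
pose N := christoffel g1 x w y.
(* The same derivative is computed twice: [H1] treats the pushforward as a linear form of a moving
   vector, [H2] first rewrites by the transformation law of the connection. *)
have H1 : 'D_v (fun p => P (christoffel g1 p w y) p 0 k : R) x =
    'D_v (PF N) x 0 k + P ('D_v (fun p => christoffel g1 p w y) x) x 0 k.
  rewrite (near_derive_linear did dG1 (L := fun p t => P t p 0 k)).
  - rewrite derive_id; congr (_ + _); rewrite derive_entry //; exact: dP.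
  - apply: filterS (near_U1 Ux) => p Up t; rewrite pushforwardE // mxE.
    apply: eq_bigr => b _; rewrite pushforwardE //; congr (_ * _).
    by rewrite /Defs.basis -rowE [RHS]mxE.
  - by move=> b; apply: differentiable_entry; exact: dP.
have H2 : 'D_v (fun p => P (christoffel g1 p w y) p 0 k : R) x =
    'D_(P v x) (fun p => christoffel g2 p (P w x) (P y x) 0 k : R) (phi x)
    + christoffel g2 (phi x) ('D_v (PF w) x) (P y x) 0 k
    + christoffel g2 (phi x) (P w x) ('D_v (PF y) x) 0 k
    + 'D_v ('D_w (PF y) : E -> E) x 0 k.
  have dd : differentiable ('D_w (PF y) : E -> E) x.
    by apply: smooth_on_diff Ux; do 2!apply: smooth_on_derive.
  have dB : differentiable (fun p => christoffel g2 (phi p) (P w p) (P y p) 0 k : R) x.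
    apply: (near_differentiable_bilinear (dphi Ux) (dP w Ux) (dP y Ux)
      (B := fun p t s => christoffel g2 p t s 0 k)).
      by apply: filterS (near_U2 Ux) => p U2p; exact: (bilform_christoffel mg2).
    by move=> a b; exact: smooth_on_diff (smooth_christoffel mg2 _ _ _) U2x.
  have HB : \forall p \near phi x, bilform (fun t s => christoffel g2 p t s 0 k).
    by apply: filterS (near_U2 Ux) => p U2p; exact: (bilform_christoffel mg2).
  have HC a b : differentiable
      (fun p => christoffel g2 p (basis a) (basis b) 0 k : R) (phi x).
    exact: smooth_on_diff (smooth_christoffel mg2 _ _ _) U2x.
  have E1 := near_derive_bilinear (dphi Ux) (dP w Ux) (dP y Ux) v HB HC.
  apply: etrans _ (f_equal2 +%R E1 (derive_entry v k dd)).
  apply: etrans _ (deriveD (diff_derivable dB) (diff_derivable (differentiable_entry k dd))).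
  apply: near_eq_derive; apply: filterS (near_U1 Ux) => p Up.
  by rewrite christoffel_pullback // mxE.
have A1 := eq_addl_sub H1 H2.
have addE (s t : E) : (s + t) 0 k = s 0 k + t 0 k by rewrite mxE.
have A2 := etrans (congr1 (fun t : E => t 0 k) (christoffel_pullback v N Ux)) (addE _ _).
have [lin _] := bilform_christoffel mg2 k U2x.
have A3 := etrans (congr1 (fun t => christoffel g2 (phi x) (P v x) t 0 k)
  (christoffel_pullback w y Ux)) (linformD _ _ (lin (P v x))).
have A4 := derive_entry (P v x) k (differentiable_christoffel mg2 (P w x) (P y x) U2x).
have PD s t : P (s + t) x = P s x + P t x by rewrite !pushforwardE // mulmxDl.
apply: etrans (congr1 (fun t : E => t 0 k) (PD _ _)) _; apply: etrans (addE _ _) _.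
apply: etrans _ (esym (addE _ _)); apply: etrans (nabla2_collect A1 A2 A3 A4) _.
apply: (congr1 (fun t => t + _)); apply: esym; apply: etrans (addE _ _) _.
apply: f_equal2; first exact: addE.
by apply: etrans (addE _ _) _; apply: f_equal2 => //; exact: addE.
Qed.

Lemma subr_add2 (a b s s' t t' : E) :
  s' = s -> t' = t -> a + s + t - (b + s' + t') = a - b.
Proof. by move=> -> ->; rewrite -(addrA a) -(addrA b) opprD addrACA subrr addr0. Qed.

(** Every term of [nabla2_pullback] that is not tensorial is symmetric in [v] and [w] and disappears
    on antisymmetrisation: [nabla2_sym] by equality of second derivatives of [phi], the third
    derivative by the same theorem for ['D_y] of each entry. *)
Lemma Rm_pullback v w y z x : U1 x ->
  Rm g1 x v w y z = Rm g2 (phi x) (P v x) (P w x) (P y x) (P z x).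
Proof.
move=> Ux; have U2x := phiU Ux.
rewrite (RmE mg1 _ _ _ _ Ux) (RmE mg2 _ _ _ _ U2x) form_pullback //.
apply: (congr1 (fun t => form (g2 (phi x)) t (P z x))).
have PB s t : P (s - t) x = P s x - P t x by rewrite !pushforwardE // mulmxBl.
apply: etrans (PB _ _) _.
apply: etrans (f_equal2 (fun s t => s - t) (nabla2_pullback v w y Ux) (nabla2_pullback w v y Ux)) _.
have E1 : 'D_w ('D_v (PF y) : E -> E) x = 'D_v ('D_w (PF y) : E -> E) x.
  apply/rowP => k.
  have E3 s t : 'D_s ('D_t (PF y) : E -> E) x 0 k =
      'D_s ('D_t ('D_y (fun y => phi y 0 k : R) : E -> R) : E -> R) x.
    rewrite -derive_entry; last by apply: smooth_on_diff Ux; do 2!apply: smooth_on_derive.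
    by apply: near_eq_derive; apply: filterS (near_U1 Ux) => p; exact: derive2_entry.
  apply: etrans (E3 _ _) (etrans _ (esym (E3 _ _))); apply: (smooth_on_deriveC oU1 _ _ _ Ux).
  exact: smooth_on_derive (smooth_entry k).
have E2 : nabla2_sym x w v y = nabla2_sym x v w y.
  exact: (f_equal2 +%R (congr1 (fun t => christoffel g2 (phi x) t (P y x))
    (derive2C w v Ux)) (addrC _ _)).
exact: subr_add2 E2 E1.
Qed.

End ChangeOfChart.

(** * Orthonormal frames *)

Section Frames.
Variable R : realType.
Notation E := ('rV[R]_4).

Definition spd n (B : 'M[R]_n) : Prop :=
  B^T = B /\ forall u : 'rV[R]_n, u != 0 -> 0 < (u *m B *m u^T) 0 0.

Lemma block_square1 (a : R) n (b : 'rV[R]_n) (C : 'M[R]_n) (x : R) (w : 'rV[R]_n) :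
  (row_mx x%:M w *m block_mx a%:M b b^T C *m (row_mx x%:M w)^T) 0 0
  = x * a * x + 2 * (x * (b *m w^T) 0 0) + (w *m C *m w^T) 0 0.
Proof.
rewrite tr_row_mx mul_row_block mul_row_col !mulmxDl tr_scalar_mx.
rewrite -!scalar_mxM !mul_scalar_mx !mul_mx_scalar -!scalemxAl.
have -> : w *m b^T = (b *m w^T)^T by rewrite trmx_mul trmxK.
by rewrite !mxE eqxx mulr1n; ring.
Qed.

Lemma spd_frame n (B : 'M[R]_n) : spd B -> exists e : 'M[R]_n, e *m B *m e^T = 1%:M.
Proof.
(* Cholesky: induction on the Schur complement S of the top left entry. *)
elim: n B => [|n IH] B [BT Bpos]; first by exists 1%:M; apply/matrixP => -[].
change n.+1 with (1 + n)%N in B, BT, Bpos |- *.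
pose a := B 0 0; pose b : 'rV[R]_n := ursubmx B; pose C : 'M[R]_n := drsubmx B.
have BE : B = block_mx a%:M b b^T C.
  rewrite -[LHS]submxK; congr block_mx.
    by rewrite [LHS]mx11_scalar /a !mxE; congr ((B _ _)%:M); apply/val_inj.
  by rewrite /b trmx_ursub BT.
have CT : C^T = C by rewrite /C trmx_drsub BT.
have q x (w : 'rV_n) : row_mx x%:M w != 0 ->
    0 < x * a * x + 2 * (x * (b *m w^T) 0 0) + (w *m C *m w^T) 0 0.
  by move=> /Bpos; rewrite BE block_square1.
have a0 : 0 < a.
  have := q 1 0; rewrite mul0mx trmx0 !mulmx0 !mxE !(mulr0, mul1r, mulr1, addr0).
  apply; apply/eqP => /(congr1 lsubmx); rewrite row_mxKl linear0.
  by move/matrixP => /(_ 0 0); rewrite !mxE eqxx => /eqP; rewrite oner_eq0.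
have an0 : a != 0 by rewrite gt_eqF.
pose S := C - a^-1 *: (b^T *m b).
have [|e' Se'] := IH S.
  split; first by rewrite /S linearB /= linearZ /= trmx_mul trmxK CT.
  (* Completing the square: this first coordinate minimises the form of [B], and the minimum is the
     form of [S] at [w]. *)
  move=> w w0; pose x := - (b *m w^T) 0 0 / a.
  have /(q x) : row_mx x%:M w != 0.
    by apply: contra w0 => /eqP/(congr1 rsubmx); rewrite row_mxKr linear0 => ->.
  congr (0 < _); rewrite /S mulmxBr mulmxBl -scalemxAr -scalemxAl !mulmxA.
  have -> : w *m b^T *m b *m w^T = ((b *m w^T) 0 0 * (b *m w^T) 0 0)%:M.
    rewrite -mulmxA scalar_mxM -!mx11_scalar; congr (_ *m _).
    by apply/matrixP => i j; rewrite -[w]trmxK -trmx_mul !ord1 trmxK mxE.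
  rewrite [in RHS]mxE [X in _ = _ + X]mxE [X in _ = _ - X]mxE [X in _ = _ - (_ * X)]mxE eqxx mulr1n.
  by rewrite /x; field.
pose r := Num.sqrt a.
have rr : r * r = a by rewrite -expr2 sqr_sqrtr // ltW.
have rn0 : r != 0 by rewrite gt_eqF // sqrtr_gt0.
(* The factor [r^-1] normalises the pivot; the lower left block clears the column [b^T]. *)
exists (block_mx (r^-1)%:M 0 (- a^-1 *: (e' *m b^T)) e').
rewrite BE tr_block_mx !mulmx_block trmx0 !mulmx0 !mul0mx !addr0.
rewrite [RHS]scalar_mx_block; congr block_mx.
- rewrite tr_scalar_mx -!scalar_mxM; congr (_%:M).
  by rewrite -rr; field.
- rewrite linearZ /= trmx_mul trmxK.
  rewrite -scalar_mxM !mul_scalar_mx -scalemxAl scalerA -scalerDl.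
  rewrite [X in X *: _](_ : _ = 0) ?scale0r //.
  by field; rewrite an0 rn0.
- rewrite -scalemxAl mul_mx_scalar scalerA mulNr mulVf // scaleN1r.
  by rewrite addNr mul0mx.
- rewrite -scalemxAl mul_mx_scalar scalerA mulNr mulVf // scaleN1r addNr mul0mx add0r.
  rewrite -Se' /S mulmxBr; congr (_ *m _).
  by rewrite addrC -scalemxAl -scalemxAr scaleNr mulmxA.
Qed.

(** Exchanging the first two vectors repairs a negative determinant, hence the size [n.+2]. *)
Lemma orientable_frame n (B : 'M[R]_n.+2) : spd B ->
  exists e : 'M[R]_n.+2, e *m B *m e^T = 1%:M /\ 0 < \det e.
Proof.
move=> /spd_frame[e eB].
have de : \det e != 0.
  apply/eqP => d0; have /(congr1 determinant) := eB.
  by rewrite !det_mulmx d0 !mul0r det1 => /eqP; rewrite eq_sym oner_eq0.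
have [ep|en] := ltP 0 (\det e); first by exists e.
exists (tperm_mx 0 (lift 0 0) *m e); split.
  rewrite trmx_mul tr_tperm_mx; set t := tperm_mx _ _.
  have -> : t *m e *m B *m (e^T *m t) = t *m (e *m B *m e^T) *m t by rewrite !mulmxA.
  rewrite eB mulmx1 /t.
  by rewrite -perm_mxM perm.tperm2 perm_mx1.
by rewrite det_mulmx det_perm perm.odd_tperm /= expr1 mulN1r oppr_gt0 lt_neqAle de.
Qed.

End Frames.

(** * Contractions and the Euler-Lagrange tensor *)

Section Contraction.
Variable R : realType.
Notation E := ('rV[R]_4).
Implicit Types (T : E -> E -> E -> E -> R) (B : E -> E -> R) (A H J e h : 'M[R]_4).

(** Symmetric bilinear forms on Lambda^2, written with four vector arguments. Linearity in the other
    slots follows from the symmetries. Instances are [Rm], [innerF] and [detF]. *)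
Definition curvlike T : Prop :=
  [/\ forall v w y, linform (T v w y),
      forall v w y z, T w v y z = - T v w y z,
      forall v w y z, T v w z y = - T v w y z &
      forall v w y z, T y z v w = T v w y z].

Lemma curvlike_lin3 T v w z : curvlike T -> linform (fun y => T v w y z).
Proof.
move=> [l4 _ a34 _]; rewrite (_ : (fun y => _) = fun y => - T v w z y).
  exact: linform_opp.
by apply/funext => y; rewrite a34.
Qed.

Lemma curvlike_lin2 T v y z : curvlike T -> linform (fun w => T v w y z).
Proof.
move=> cT; have [l4 _ _ p] := cT; rewrite (_ : (fun y => _) = fun w => T y z v w) //.
by apply/funext => w; rewrite p.
Qed.

Lemma curvlike_lin1 T w y z : curvlike T -> linform (fun v => T v w y z).
Proof.
move=> cT; have [_ _ _ p] := cT; rewrite (_ : (fun y => _) = fun v => T y z v w).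
  exact: curvlike_lin3.
by apply/funext => v; rewrite p.
Qed.

Lemma curvlike_rev T v w y z : curvlike T -> T z y w v = T v w y z.
Proof. by move=> [_ a12 a34 p]; rewrite p a12 a34 opprK. Qed.

(** In use, [H] is an inverse metric, the derivative of one, or a bivector. *)
Definition contr B H : R := \sum_a \sum_d H a d * B (basis a) (basis d).

Lemma form_basis A a b : form A (basis a) (basis b) = A a b.
Proof. by rewrite /Defs.form /Defs.basis trmx_delta -rowE -colE !mxE. Qed.

Lemma form_row A e j l : form A (row j e) (row l e) = (e *m A *m e^T) j l.
Proof.
rewrite /Defs.form -row_mul [LHS]mxE [RHS]mxE; apply: eq_bigr => k _.
by rewrite !mxE.
Qed.

Lemma bilform_mx B : bilform B ->
  B = form (\matrix_(a, b) B (basis a) (basis b)).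
Proof.
move=> [b1 b2]; apply/funext => u; apply/funext => v.
rewrite formE (b2 v u); apply: eq_bigr => a _; rewrite (b1 _ v) mulr_sumr.
by apply: eq_bigr => b _; rewrite mxE mulrA.
Qed.

Lemma contr_form A H : contr (form A) H = \tr (H *m A^T).
Proof.
apply: eq_bigr => a _; rewrite mxE; apply: eq_bigr => b _.
by rewrite form_basis mxE.
Qed.

Lemma contr_congr B H J : bilform B ->
  contr (fun u v => B (u *m J) (v *m J)) H = contr B (J^T *m H *m J).
Proof.
move=> /bilform_mx ->; set A := \matrix_(_, _) _.
have -> : (fun u v => form A (u *m J) (v *m J)) = form (J *m A *m J^T).
  by apply/funext => u; apply/funext => v; rewrite form_congr.
rewrite !contr_form !trmx_mul trmxK !mulmxA mxtrace_mulC !mulmxA.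
by rewrite -!mulmxA.
Qed.

(** Frees traces from the choice of frame: rows orthonormal for [h] satisfy [e^T *m e = invmx h]. *)
Lemma contr_frame B e : bilform B ->
  \sum_i B (row i e) (row i e) = contr B (e^T *m e).
Proof.
move=> /bilform_mx ->; set A := \matrix_(_, _) _.
rewrite contr_form -mxtrace_tr trmx_mul trmxK trmx_mul trmxK mxtrace_mulC.
rewrite -mulmxA mxtrace_mulC; apply: eq_bigr => i _; exact: form_row.
Qed.

Definition ricci T H : 'M[R]_4 :=
  \matrix_(b, c) contr (fun s t => T s (basis b) (basis c) t) H.

Definition scal T H : R := contr (form (ricci T H)) H.

Lemma form_ricci T H v w : curvlike T ->
  form (ricci T H) v w = contr (fun s t => T s v w t) H.
Proof.
move=> cT; have E1 s t : T s v w t = \sum_b \sum_c v 0 b * w 0 c * T s (basis b) (basis c) t.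
  rewrite (curvlike_lin2 s w t cT v); apply: eq_bigr => b _.
  rewrite (curvlike_lin3 s (basis b) t cT w) mulr_sumr.
  by apply: eq_bigr => c _; rewrite mulrA.
rewrite formE /contr; under [RHS]eq_bigr do under eq_bigr do rewrite E1 mulr_sumr.
under [RHS]eq_bigr do rewrite exchange_big.
rewrite [RHS]exchange_big; apply: eq_bigr => b _ /=.
under [RHS]eq_bigr do under eq_bigr do rewrite mulr_sumr.
under [RHS]eq_bigr do rewrite exchange_big.
rewrite [RHS]exchange_big; apply: eq_bigr => c _ /=.
rewrite mxE /contr mulr_sumr; apply: eq_bigr => a _; rewrite mulr_sumr.
by apply: eq_bigr => d _; rewrite mulrCA.
Qed.

Lemma bilform_outer T v w : curvlike T -> bilform (fun s t => T s v w t).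
Proof. by move=> cT; split=> t; [case: cT|exact: curvlike_lin1]. Qed.

Lemma ricci_sym T H : curvlike T -> H^T = H -> (ricci T H)^T = ricci T H.
Proof.
move=> cT HT; apply/matrixP => b c; rewrite !mxE /contr exchange_big.
apply: eq_bigr => a _; apply: eq_bigr => d _.
by rewrite (curvlike_rev _ _ _ _ cT) -{1}HT mxE.
Qed.

(** Equals [-2] times the trace-free part of the mixed Ricci tensor. This is special to dimension
    four, where the term [scal / 2] coming from the volume form matches the trace of
    [2 *: ricci]. *)
Definition el_tensor T h : 'M[R]_4 :=
  (scal T (invmx h) / 2) *: h - 2 *: ricci T (invmx h).

Lemma el_tensor_sym T h : curvlike T -> h^T = h -> (el_tensor T h)^T = el_tensor T h.
Proof.
move=> cT hT; rewrite /el_tensor linearB /= !linearZ /= hT ricci_sym //.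
by rewrite trmx_inv hT.
Qed.

Section Frame.
Variables (h e : 'M[R]_4) (T : E -> E -> E -> E -> R).
Hypotheses (eh : e *m h *m e^T = 1%:M) (cT : curvlike T).

Lemma frame_unit : e \in unitmx.
Proof. by have := mulmx1_unit (etrans (mulmxA _ _ _) eh) => -[]. Qed.

Lemma frame_inv : e^T *m e = invmx h /\ h \in unitmx.
Proof.
have H : h *m (e^T *m e) = 1%:M.
  by rewrite mulmxA; apply: mulmx1C; rewrite mulmxA.
have [hu _] := mulmx1_unit H; split=> //.
by rewrite -[RHS]mulmx1 -H (mulmxA (invmx h)) mulVmx // mul1mx.
Qed.

Lemma ricci_frame j l : \sum_i T (row i e) (row j e) (row l e) (row i e) =
  form (ricci T (invmx h)) (row j e) (row l e).
Proof.
rewrite form_ricci // -frame_inv.1.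
by rewrite (contr_frame e (bilform_outer (row j e) (row l e) cT)).
Qed.

Lemma scal_frame : \sum_j \sum_i T (row i e) (row j e) (row j e) (row i e) =
  scal T (invmx h).
Proof.
under eq_bigr do rewrite ricci_frame.
by rewrite (contr_frame e (bilform_form _)) frame_inv.1.
Qed.

Lemma el_tensor_frame :
  (forall j l, \sum_i T (row i e) (row j e) (row l e) (row i e) =
    scal T (invmx h) / 4 * form h (row j e) (row l e)) <-> el_tensor T h = 0.
Proof.
set s := scal T (invmx h); set r := ricci T (invmx h).
have el0 : el_tensor T h = 0 <-> r = (s / 4) *: h.
  rewrite /el_tensor -/s -/r; split=> [/eqP|rE].
    rewrite subr_eq0 => /eqP/(congr1 (fun A => 2^-1 *: A)).
    rewrite !scalerA mulVf ?pnatr_eq0 // scale1r => <-; congr (_ *: _); by field.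
  rewrite rE scalerA; have -> : 2 * (s / 4) = s / 2 by field.
  by rewrite subrr.
rewrite el0; split=> [H|rE j l].
  have E1 : e *m r *m e^T = e *m ((s / 4) *: h) *m e^T.
    apply/matrixP => j l; rewrite -form_row -ricci_frame H form_row.
    by rewrite -scalemxAr -scalemxAl [RHS]mxE.
  have /(congr1 (mulmx (invmx e))) := E1.
  rewrite !mulmxA mulVmx ?frame_unit // !mul1mx => /(congr1 (mulmx^~ (invmx e^T))).
  by rewrite !mulmxK // unitmx_tr frame_unit.
by rewrite ricci_frame -/r rE !form_row -scalemxAr -scalemxAl [LHS]mxE.
Qed.

(** The trace is the squared [h]-norm of [A]: in the frame it is the sum of the squares of the
    entries of [B]. *)
Lemma trace_frame_ge0 A : A^T = A ->
  0 <= \tr (invmx h *m A *m invmx h *m A) /\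
  (\tr (invmx h *m A *m invmx h *m A) = 0 -> A = 0).
Proof.
move=> AT; pose B := e *m A *m e^T.
have -> : \tr (invmx h *m A *m invmx h *m A) = \sum_i \sum_j B i j ^+ 2.
  rewrite -frame_inv.1.
  have -> : \tr (e^T *m e *m A *m (e^T *m e) *m A) = \tr (B *m B^T).
    rewrite /B !trmx_mul trmxK AT -!mulmxA mxtrace_mulC -!mulmxA.
    by [].
  by apply: eq_bigr => i _; rewrite mxE; apply: eq_bigr => j _; rewrite [B^T _ _]mxE expr2.
have ge i : 0 <= \sum_j B i j ^+ 2 by apply: sumr_ge0 => j _; exact: sqr_ge0.
split=> [|/eqP]; first exact: sumr_ge0.
rewrite psumr_eq0 // => /allP H.
have B0 : B = 0.
  apply/matrixP => i j; have := H i (mem_index_enum i) => /= /eqP/eqP.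
  rewrite psumr_eq0 => [/allP/(_ j (mem_index_enum j))/=|k _]; last exact: sqr_ge0.
  by rewrite sqrf_eq0 => /eqP ->; rewrite [RHS]mxE.
have /(congr1 (mulmx (invmx e))) := B0.
rewrite /B !mulmxA mulVmx ?frame_unit // mul1mx mulmx0 => /(congr1 (mulmx^~ (invmx e^T))).
by rewrite mulmxK ?unitmx_tr ?frame_unit // mul0mx.
Qed.

End Frame.

Lemma el_tensor_pullback T1 T2 h1 h2 J :
  curvlike T1 -> curvlike T2 -> J \in unitmx -> h2 \in unitmx ->
  h1 = J *m h2 *m J^T ->
  (forall v w y z, T1 v w y z = T2 (v *m J) (w *m J) (y *m J) (z *m J)) ->
  el_tensor T1 h1 = J *m el_tensor T2 h2 *m J^T.
Proof.
move=> c1 c2 Ju h2u hE TE.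
(* Inverse metrics transform contravariantly; with [contr_congr] this makes both contractions below
   invariant. *)
have HE : J^T *m invmx h1 *m J = invmx h2.
  have h1u : h1 \in unitmx by rewrite hE !unitmx_mul Ju h2u unitmx_tr.
  have -> : invmx h1 = invmx J^T *m invmx h2 *m invmx J.
    have K : h1 *m (invmx J^T *m invmx h2 *m invmx J) = 1%:M.
      by rewrite hE !mulmxA mulmxK ?unitmx_tr // mulmxK // mulmxV.
    by rewrite -[LHS]mulmx1 -K (mulmxA (invmx h1)) mulVmx // mul1mx.
  by rewrite !mulmxA mulmxV ?unitmx_tr // mul1mx mulmxKV.
have rE : ricci T1 (invmx h1) = J *m ricci T2 (invmx h2) *m J^T.
  apply/matrixP => b c; rewrite -[LHS]form_basis -[RHS]form_basis form_congr.
  rewrite !form_ricci // -HE -contr_congr; last exact: bilform_outer.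
  by congr contr; apply/funext => s; apply/funext => t; rewrite TE.
have sE : scal T1 (invmx h1) = scal T2 (invmx h2).
  rewrite /scal rE -HE -contr_congr; last exact: bilform_form.
  by congr contr; apply/funext => s; apply/funext => t; rewrite form_congr HE.
rewrite /el_tensor sE rE hE mulmxBr mulmxBl.
by rewrite -!scalemxAr -!scalemxAl.
Qed.

End Contraction.

(** * The pointwise first variation *)

Section MatrixFunctions.
Variables (R : realType) (V : normedModType R).
Implicit Types (x : V).

Lemma differentiable_bigsum (I : Type) (r : seq I) (f : I -> V -> R) x :
  (forall i, differentiable (f i) x) ->
  differentiable (fun y => \sum_(i <- r) f i y) x.
Proof.
move=> df; elim: r => [|i r IH].
  by under eq_fun do rewrite big_nil; exact: differentiable_cst.
by under eq_fun do rewrite big_cons; exact: differentiableD.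
Qed.

Lemma differentiable_bigprod (I : Type) (r : seq I) (f : I -> V -> R) x :
  (forall i, differentiable (f i) x) ->
  differentiable (fun y => \prod_(i <- r) f i y) x.
Proof.
move=> df; elim: r => [|i r IH].
  by under eq_fun do rewrite big_nil; exact: differentiable_cst.
by under eq_fun do rewrite big_cons; exact: differentiableM.
Qed.

Lemma differentiable_det n (f : V -> 'M[R]_n) x :
  (forall i j, differentiable (fun y => f y i j : R) x) ->
  differentiable (fun y => \det (f y)) x.
Proof.
move=> df; apply: differentiable_bigsum => s.
by apply: differentiableM => //; exact: differentiable_bigprod.
Qed.

Lemma near_unitmx n (f : V -> 'M[R]_n) x :
  (forall i j, differentiable (fun y => f y i j : R) x) -> f x \in unitmx ->
  \forall y \near x, f y \in unitmx.
Proof.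
move=> df; rewrite unitmxE unitfE => fx.
have : {for x, continuous (fun y => \det (f y))}.
  by apply: differentiable_continuous; exact: differentiable_det.
move=> /cvgr_neq0 /(_ fx); apply: filterS => y.
by rewrite unitmxE unitfE.
Qed.

Lemma differentiable_invmx n (f : V -> 'M[R]_n) x i j :
  (forall i j, differentiable (fun y => f y i j : R) x) -> f x \in unitmx ->
  differentiable (fun y => invmx (f y) i j : R) x.
Proof.
move=> df fu.
have : differentiable (fun y => (\det (f y))^-1 * cofactor (f y) j i) x.
  apply: differentiableM.
    by apply: differentiableV; [exact: differentiable_det|rewrite -unitfE -unitmxE].
  apply: differentiableM => //; apply: differentiable_det => k l.
  by under eq_fun do rewrite !mxE; exact: df.
apply: near_eq_differentiable; apply: filterS (near_unitmx df fu) => y fy.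
by rewrite /invmx fy !mxE.
Qed.

End MatrixFunctions.

(** * Derivatives of determinant, inverse and scalar contraction along a line of matrices *)

Section LineDerivatives.
Variable R : realType.
Implicit Types (h v A : 'M[R]_4).

(* Read off from the characteristic polynomial at -1/t. *)
Lemma det1D_trace A : exists q : {poly R},
  forall t : R, \det (1%:M + t *: A) = 1 + t * \tr A + t ^+ 2 * q.[t].
Proof.
pose c i := (char_poly A)`_i.
exists ((c 2%N)%:P - (c 1%N) *: 'X + (c 0%N) *: 'X^2) => t.
have [->|t0] := eqVneq t 0.
  by rewrite scale0r addr0 det1 mul0r addr0 expr0n mul0r addr0.
have -> : 1%:M + t *: A = (- t) *: ((- t^-1)%:M - A).
  by rewrite scalerBr scale_scalar_mx mulrNN divff // scaleNr opprK.
have -> : \det ((- t) *: ((- t^-1)%:M - A)) = (- t) ^+ 4 * (char_poly A).[- t^-1].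
  rewrite detZ; congr (_ * _); rewrite /char_poly -[RHS]/(horner_eval _ _) -det_map_mx.
  congr (\det _); apply/matrixP => i j; rewrite !mxE.
  by rewrite -[RHS]/(('X *+ (i == j) - (A i j)%:P).[- t^-1]) !hornerE hornerMn hornerX.
rewrite horner_coef size_char_poly !big_ord_recr big_ord0 /= add0r -!/(c _).
have -> : c 4%N = 1.
  by have := char_poly_monic A; rewrite monicE lead_coefE size_char_poly => /eqP.
have -> : c 3%N = - \tr A by exact: (char_poly_trace A isT).
rewrite !hornerE /=.
by field.
Qed.

Lemma is_derive_det1D A : is_derive (0 : R) (1 : R) (fun t : R => \det (1%:M + t *: A) : R) (\tr A).
Proof.
have [q qE] := det1D_trace A.
have -> : (fun t : R => \det (1%:M + t *: A)) = horner (1 + (\tr A) *: 'X + 'X^2 * q).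
  by apply/funext => t; rewrite qE !hornerE /=; ring.
apply: (is_derive_eq (is_derive_poly _ _)).
by rewrite !poly.derivE !hornerE /=; ring.
Qed.

(** Jacobi's formula, by factoring [h] out and differentiating at the identity. *)
Lemma is_derive_det h v : h \in unitmx ->
  is_derive (0 : R) (1 : R) (fun t : R => \det (h + t *: v) : R)
    (\det h * \tr (invmx h *m v)).
Proof.
move=> hu.
have -> : (fun t : R => \det (h + t *: v)) =
   (\det h *: (fun t : R => \det (1%:M + t *: (invmx h *m v)) : R)).
  apply/funext => t; rewrite !fctE /= [RHS]/GRing.scale /= -det_mulmx; congr (\det _).
  by rewrite mulmxDr mulmx1 -scalemxAr mulmxA mulmxV // mul1mx.
exact: (is_deriveZ _ (is_derive_det1D _)).
Qed.

Lemma differentiable_line h v t i j :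
  differentiable (fun t : R => (h + t *: v) i j : R) t.
Proof.
under eq_fun do rewrite mxE [X in _ + X]mxE.
by apply: differentiableD => //; exact: differentiableM.
Qed.

(** Near [0] the inverse satisfies the resolvent identity [X t = H - t H v X t], with [H = invmx h].
    In the product rule at [0] the unknown derivative of [X] is multiplied by [t = 0], so only
    [X 0 = H] remains. *)
Lemma is_derive_invmx h v i j : h \in unitmx ->
  is_derive (0 : R) (1 : R) (fun t : R => invmx (h + t *: v) i j : R)
    (- (invmx h *m v *m invmx h) i j).
Proof.
move=> hu; pose X t := invmx (h + t *: v).
have h0 : h + (0 : R) *: v \in unitmx by rewrite scale0r addr0.
have XE : \forall t \near (0 : R),
    X t i j = invmx h i j - t * \sum_k (invmx h *m v) i k * X t k j.
  apply: filterS (near_unitmx (fun i j => differentiable_line h v 0 i j) h0) => t ht.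
  have -> : \sum_k (invmx h *m v) i k * X t k j = (invmx h *m v *m X t) i j by rewrite mxE.
  have E1 : invmx h = X t + t *: (invmx h *m v *m X t).
    rewrite -[LHS]mulmx1 -(mulmxV ht) mulmxA mulmxDr mulVmx // mulmxDl mul1mx.
    by rewrite -scalemxAr -scalemxAl.
  have -> : invmx h i j = X t i j + t * (invmx h *m v *m X t) i j.
    by rewrite {1}E1 mxE [X in _ + X]mxE.
  by rewrite addrK.
have dX k l : differentiable (fun t : R => X t k l : R) 0.
  by apply: differentiable_invmx => // a b; exact: differentiable_line.
pose f t := \sum_k (invmx h *m v) i k * X t k j.
have df : derivable f 0 1.
  apply: diff_derivable; apply: differentiable_bigsum => k.
  exact: differentiableM.
have H := is_deriveB (is_derive_cst (invmx h i j) (0 : R) (1 : R))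
  (is_deriveM (is_derive_id (0 : R) (1 : R)) (derivableP df)).
have H2 : is_derive (0 : R) (1 : R) (fun t : R => invmx h i j - t * f t)
    (- (invmx h *m v *m invmx h) i j).
  apply: (is_derive_eq H); rewrite scale0r !add0r; congr (- _).
  rewrite [LHS]/GRing.scale /= mulr1 /f mxE; apply: eq_bigr => k _.
  by rewrite /X scale0r addr0.
apply: near_eq_is_derive H2.
by apply: filterS XE => t E; rewrite -[LHS]E.
Qed.

Lemma is_derive_bigsum (I : eqType) (r : seq I) (F : I -> R -> R)
    (D : I -> R) (t : R) :
  (forall i, i \in r -> is_derive t (1 : R) (F i) (D i)) ->
  is_derive t (1 : R) (fun s => \sum_(i <- r) F i s) (\sum_(i <- r) D i).
Proof.
elim: r => [|i r IH] H.
  rewrite big_nil (_ : (fun s => _) = cst 0); first exact: is_derive_cst.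
  by apply/funext => s; rewrite big_nil.
rewrite big_cons (_ : (fun s => _) = F i + (fun s => \sum_(j <- r) F j s)); last first.
  by apply/funext => s; rewrite big_cons.
apply: is_deriveD; first by apply: H; rewrite mem_head.
by apply: IH => j jr; apply: H; rewrite in_cons jr orbT.
Qed.

Section FirstVariation.
Variables (h v : 'M[R]_4) (T : 'rV[R]_4 -> 'rV[R]_4 -> 'rV[R]_4 -> 'rV[R]_4 -> R).
Hypotheses (cT : curvlike T) (hu : h \in unitmx) (hT : h^T = h) (dh : 0 < \det h).

Let H := invmx h.
Let X t := invmx (h + t *: v).
Let X' : 'M[R]_4 := - (H *m v *m H).

Let X0 : X 0 = H. Proof. by rewrite /X scale0r addr0. Qed.

Let dX i j : is_derive (0 : R) (1 : R) (fun t => X t i j : R) (X' i j).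
Proof. by rewrite mxE; exact: is_derive_invmx. Qed.

Lemma is_derive_ricci b c :
  is_derive (0 : R) (1 : R) (fun t => ricci T (X t) b c : R) (ricci T X' b c).
Proof.
under eq_fun do rewrite mxE /contr; rewrite mxE /contr.
apply: is_derive_bigsum => a _; apply: is_derive_bigsum => d _.
pose Tabcd := T (basis a) (basis b) (basis c) (basis d).
apply: (is_derive_eq (is_deriveM (dX a d) (is_derive_cst Tabcd (0 : R) (1 : R)))).
rewrite /Tabcd.
by rewrite scaler0 add0r [LHS]/GRing.scale /= mulrC.
Qed.

Lemma scalE A : scal T A = \sum_b \sum_c A b c * ricci T A b c.
Proof. by apply: eq_bigr => b _; apply: eq_bigr => c _; rewrite form_basis. Qed.

(** [scal T] is a quadratic form in the inverse metric and this is the symmetry of its polar form: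
    flipping both pairs of arguments leaves [T] unchanged. It is the source of the factor 2 in
    [is_derive_scal]. *)
Lemma ricci_polar A B :
  \sum_b \sum_c A b c * ricci T B b c = \sum_b \sum_c B b c * ricci T A b c.
Proof.
have E A1 B1 b c : A1 b c * ricci T B1 b c =
    \sum_a \sum_d A1 b c * B1 a d * T (basis a) (basis b) (basis c) (basis d).
  rewrite mxE /contr mulr_sumr; apply: eq_bigr => a _; rewrite mulr_sumr.
  by apply: eq_bigr => d _; rewrite mulrA.
under eq_bigr do under eq_bigr do rewrite E.
under [RHS]eq_bigr do under eq_bigr do rewrite E.
under eq_bigr do rewrite exchange_big.
rewrite exchange_big; apply: eq_bigr => a _.
under eq_bigr do rewrite exchange_big.
rewrite exchange_big; apply: eq_bigr => d _ /=.
apply: eq_bigr => b _; apply: eq_bigr => c _; have [_ a12 a34 _] := cT.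
by rewrite a12 a34 opprK [A _ _ * _]mulrC.
Qed.

Lemma is_derive_scal :
  is_derive (0 : R) (1 : R) (fun t => scal T (X t)) (- 2 * \tr (H *m v *m H *m ricci T H)).
Proof.
under eq_fun do rewrite scalE.
pose D := \sum_b \sum_c (X' b c * ricci T H b c + H b c * ricci T X' b c).
have HD : is_derive (0 : R) (1 : R) (fun t => \sum_b \sum_c X t b c * ricci T (X t) b c) D.
  apply: is_derive_bigsum => b _; apply: is_derive_bigsum => c _.
  apply: (is_derive_eq (is_deriveM (dX b c) (is_derive_ricci b c))).
  by rewrite X0 addrC; congr (_ + _); rewrite [LHS]/GRing.scale /= mulrC.
apply: (is_derive_eq HD); rewrite /D.
under eq_bigr do rewrite big_split; rewrite big_split /= (ricci_polar H).
have -> : \sum_b \sum_c X' b c * ricci T H b c = - \tr (H *m v *m H *m ricci T H).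
  rewrite -linearN /= -mulNmx; apply: eq_bigr => b _; rewrite mxE.
  apply: eq_bigr => c _; congr (_ * _).
  by rewrite -[in LHS](ricci_sym cT (H := H)) ?mxE // trmx_inv hT.
by ring.
Qed.

Lemma is_derive_density : is_derive (0 : R) (1 : R)
  (fun t => scal T (X t) * Num.sqrt (\det (h + t *: v)))
  (\tr (H *m el_tensor T h *m H *m v) * Num.sqrt (\det h)).
Proof.
have d0 : \det (h + (0 : R) *: v) = \det h by rewrite scale0r addr0.
have ds : 0 < \det (h + (0 : R) *: v) by rewrite d0.
have D2 := is_derive1_comp (is_derive1_sqrt ds) (is_derive_det v hu).
apply: (is_derive_eq (is_deriveM is_derive_scal D2)).
rewrite /comp d0 X0 /el_tensor -/H mulmxBr !mulmxBl linearB /=.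
rewrite -!scalemxAr -!scalemxAl !linearZ /= mulVmx // mul1mx.
have -> : \tr (H *m ricci T H *m H *m v) = \tr (H *m v *m H *m ricci T H).
  by rewrite -mulmxA mxtrace_mulC mulmxA.
have sn : Num.sqrt (\det h) != 0 by rewrite gt_eqF // sqrtr_gt0.
(* The chain rule leaves [\det h] over twice its root; writing it as the square of the root lets
   [field] cancel. *)
rewrite /GRing.scale /= -[in \det h * _](sqr_sqrtr (ltW dh)).
by field.
Qed.

End FirstVariation.

End LineDerivatives.

(** * The Einstein condition in four dimensions *)

Section Ordinals4.
Variable R : realType.

Definition i0 : 'I_4 := @Ordinal 4 0 isT.
Definition i1 : 'I_4 := @Ordinal 4 1 isT.
Definition i2 : 'I_4 := @Ordinal 4 2 isT.
Definition i3 : 'I_4 := @Ordinal 4 3 isT.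

Lemma ord4_neq :
  ((i0 == i1) = false) * ((i0 == i2) = false) * ((i0 == i3) = false) *
  ((i1 == i0) = false) * ((i1 == i2) = false) * ((i1 == i3) = false) *
  ((i2 == i0) = false) * ((i2 == i1) = false) * ((i2 == i3) = false) *
  ((i3 == i0) = false) * ((i3 == i1) = false) * ((i3 == i2) = false).
Proof. by do !split. Qed.

Lemma sum4 (F : 'I_4 -> R) : \sum_i F i = F i0 + F i1 + F i2 + F i3.
Proof.
rewrite !big_ord_recr big_ord0 /= add0r.
by congr (F _ + F _ + F _ + F _); apply/val_inj.
Qed.

Lemma ord4_ind (P : 'I_4 -> Prop) : P i0 -> P i1 -> P i2 -> P i3 -> forall i, P i.
Proof.
move=> p0 p1 p2 p3 [[|[|[|[|i]]]] Hi] //.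
- by rewrite (_ : Ordinal Hi = i0) //; apply/val_inj.
- by rewrite (_ : Ordinal Hi = i1) //; apply/val_inj.
- by rewrite (_ : Ordinal Hi = i2) //; apply/val_inj.
- by rewrite (_ : Ordinal Hi = i3) //; apply/val_inj.
Qed.

Lemma sum_pairs (F : 'I_4 -> 'I_4 -> R) : \sum_(a < 4) \sum_(b < 4 | (a < b)%N) F a b =
  F i0 i1 + F i0 i2 + F i0 i3 + F i1 i2 + F i1 i3 + F i2 i3.
Proof.
rewrite sum4; do 4!rewrite big_mkcond sum4 /=.
by rewrite !(add0r, addr0) !addrA.
Qed.

Lemma sum_pairs_sym (F : 'I_4 -> 'I_4 -> R) : (forall a b, F a b = F b a) ->
  (forall a, F a a = 0) -> \sum_a \sum_b F a b = 2 * \sum_(a < 4) \sum_(b < 4 | (a < b)%N) F a b.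
Proof.
move=> FC F0; rewrite sum_pairs sum4 !sum4 !F0.
rewrite (FC i1 i0) (FC i2 i0) (FC i3 i0) (FC i2 i1) (FC i3 i1) (FC i3 i2).
move: (F i0 i1) (F i0 i2) (F i0 i3) (F i1 i2) (F i1 i3) (F i2 i3) => a b c d e f.
by ring.
Qed.

End Ordinals4.

(** * Ricci tensor and off-diagonal curvature block in components *)

Section FrameComponents.
Variables (R : realType) (K : 'I_4 -> 'I_4 -> 'I_4 -> 'I_4 -> R).
Hypotheses (K12 : forall a b c d, K a b c d = - K b a c d)
  (K34 : forall a b c d, K a b c d = - K a b d c)
  (Kp : forall a b c d, K a b c d = K c d a b).

Let K11 a c d : K a a c d = 0.
Proof. by have := K12 a a c d; move: (K a a c d) => x; lra. Qed.

Let K33 a b c : K a b c c = 0.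
Proof. by have := K34 a b c c; move: (K a b c c) => x; lra. Qed.

(** With [Kcan], a rewriting system to normal form: increasing indices in each pair, and pairs in
    lexicographic order. It leaves 21 independent components as atoms for [lra] and [ring]. [K34']
    only reorders the arguments of [K34] so that the last two indices can be fixed alone. *)
Let Kpair :=
  (Kp i0 i2 i0 i1, Kp i0 i3 i0 i1, Kp i0 i3 i0 i2, Kp i1 i2 i0 i1, Kp i1 i2 i0 i2,
   Kp i1 i2 i0 i3, Kp i1 i3 i0 i1, Kp i1 i3 i0 i2, Kp i1 i3 i0 i3, Kp i1 i3 i1 i2,
   Kp i2 i3 i0 i1, Kp i2 i3 i0 i2, Kp i2 i3 i0 i3, Kp i2 i3 i1 i2, Kp i2 i3 i1 i3).

Let K34' c d a b := K34 a b c d.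

Let Kcan := (K11, K33,
   K12 i1 i0, K12 i2 i0, K12 i3 i0, K12 i2 i1, K12 i3 i1, K12 i3 i2,
   K34' i1 i0, K34' i2 i0, K34' i3 i0, K34' i2 i1, K34' i3 i1, K34' i3 i2, Kpair).

(* The components of K between the bases e0^e1 + e2^e3, e0^e2 - e1^e3,
   e0^e3 + e1^e2 of Lambda^+ and e0^e1 - e2^e3, e0^e2 + e1^e3, e0^e3 - e1^e2
   of Lambda^-. *)
Definition block_vanishes : Prop :=
  K i0 i1 i0 i1 - K i2 i3 i2 i3 = 0 /\
  K i0 i1 i0 i2 + K i0 i1 i1 i3 + K i0 i2 i2 i3 + K i1 i3 i2 i3 = 0 /\
  K i0 i1 i0 i3 - K i0 i1 i1 i2 + K i0 i3 i2 i3 - K i1 i2 i2 i3 = 0 /\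
  K i0 i1 i0 i2 - K i0 i2 i2 i3 - K i0 i1 i1 i3 + K i1 i3 i2 i3 = 0 /\
  K i0 i2 i0 i2 - K i1 i3 i1 i3 = 0 /\
  K i0 i2 i0 i3 - K i0 i2 i1 i2 - K i0 i3 i1 i3 + K i1 i2 i1 i3 = 0 /\
  K i0 i1 i0 i3 - K i0 i3 i2 i3 + K i0 i1 i1 i2 - K i1 i2 i2 i3 = 0 /\
  K i0 i2 i0 i3 + K i0 i3 i1 i3 + K i0 i2 i1 i2 + K i1 i2 i1 i3 = 0 /\
  K i0 i3 i0 i3 - K i1 i2 i1 i2 = 0.

(** The value of [K] on the bivectors with coordinates [x] and [y] in the two bases above. *)
Definition block_form (x1 x2 x3 y1 y2 y3 : R) : R :=
  x1 * y1 * (K i0 i1 i0 i1 - K i2 i3 i2 i3)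
  + x1 * y2 * (K i0 i1 i0 i2 + K i0 i1 i1 i3 + K i0 i2 i2 i3 + K i1 i3 i2 i3)
  + x1 * y3 * (K i0 i1 i0 i3 - K i0 i1 i1 i2 + K i0 i3 i2 i3 - K i1 i2 i2 i3)
  + x2 * y1 * (K i0 i1 i0 i2 - K i0 i2 i2 i3 - K i0 i1 i1 i3 + K i1 i3 i2 i3)
  + x2 * y2 * (K i0 i2 i0 i2 - K i1 i3 i1 i3)
  + x2 * y3 * (K i0 i2 i0 i3 - K i0 i2 i1 i2 - K i0 i3 i1 i3 + K i1 i2 i1 i3)
  + x3 * y1 * (K i0 i1 i0 i3 - K i0 i3 i2 i3 + K i0 i1 i1 i2 - K i1 i2 i2 i3)
  + x3 * y2 * (K i0 i2 i0 i3 + K i0 i3 i1 i3 + K i0 i2 i1 i2 + K i1 i2 i1 i3)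
  + x3 * y3 * (K i0 i3 i0 i3 - K i1 i2 i1 i2).

(** Two off-diagonal block entries in symmetric positions have as half sum and half difference, up
    to sign, two Ricci components with complementary index pairs. Each diagonal entry is, up to the
    factor [-2], the Ricci trace over a coordinate plane minus that over the complementary plane. *)
Lemma einstein_block :
  (forall j l, \sum_i K i j l i = (\sum_m \sum_i K i m m i) / 4 * (j == l)%:R) <-> block_vanishes.
Proof.
have KE : forall j l, (\sum_i K i j l i = (\sum_m \sum_i K i m m i) / 4 * (j == l)%:R) <->
   (K i0 j l i0 + K i1 j l i1 + K i2 j l i2 + K i3 j l i3 =
    (K i0 i0 i0 i0 + K i1 i0 i0 i1 + K i2 i0 i0 i2 + K i3 i0 i0 i3
     + (K i0 i1 i1 i0 + K i1 i1 i1 i1 + K i2 i1 i1 i2 + K i3 i1 i1 i3)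
     + (K i0 i2 i2 i0 + K i1 i2 i2 i1 + K i2 i2 i2 i2 + K i3 i2 i2 i3)
     + (K i0 i3 i3 i0 + K i1 i3 i3 i1 + K i2 i3 i3 i2 + K i3 i3 i3 i3)) / 4 * (j == l)%:R).
  by move=> j l; rewrite !sum4.
split.
  move=> H.
  have H' j l := (KE j l).1 (H j l).
  move: {H} (H' i0 i0) (H' i1 i1) (H' i2 i2) (H' i3 i3)
    (H' i0 i1) (H' i0 i2) (H' i0 i3) (H' i1 i2) (H' i1 i3) (H' i2 i3) => {H' KE}.
  rewrite ?Kcan /block_vanishes !eqxx !ord4_neq /=.
  move: (K i0 i1 i0 i1) (K i0 i1 i0 i2) (K i0 i1 i0 i3) (K i0 i1 i1 i2) (K i0 i1 i1 i3) (K i0 i1 i2 i3)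
    (K i0 i2 i0 i2) (K i0 i2 i0 i3) (K i0 i2 i1 i2) (K i0 i2 i1 i3) (K i0 i2 i2 i3) (K i0 i3 i0 i3)
    (K i0 i3 i1 i2) (K i0 i3 i1 i3) (K i0 i3 i2 i3) (K i1 i2 i1 i2) (K i1 i2 i1 i3) (K i1 i2 i2 i3)
    (K i1 i3 i1 i3) (K i1 i3 i2 i3) (K i2 i3 i2 i3).
  move=> k00 k01 k02 k03 k04 k05 k11 k12 k13 k14 k15 k22 k23 k24 k25 k33 k34 k35 k44 k45 k55 *.
  by repeat split; lra.
move=> [B0 [B1 [B2 [B3 [B4 [B5 [B6 [B7 B8]]]]]]]] j l; apply/KE.
move: B0 B1 B2 B3 B4 B5 B6 B7 B8.
elim/ord4_ind: j; elim/ord4_ind: l;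
  rewrite ?Kcan ?eqxx ?ord4_neq /=;
  move: (K i0 i1 i0 i1) (K i0 i1 i0 i2) (K i0 i1 i0 i3) (K i0 i1 i1 i2) (K i0 i1 i1 i3) (K i0 i1 i2 i3)
    (K i0 i2 i0 i2) (K i0 i2 i0 i3) (K i0 i2 i1 i2) (K i0 i2 i1 i3) (K i0 i2 i2 i3) (K i0 i3 i0 i3)
    (K i0 i3 i1 i2) (K i0 i3 i1 i3) (K i0 i3 i2 i3) (K i1 i2 i1 i2) (K i1 i2 i1 i3) (K i1 i2 i2 i3)
    (K i1 i3 i1 i3) (K i1 i3 i2 i3) (K i2 i3 i2 i3);
  move=> k00 k01 k02 k03 k04 k05 k11 k12 k13 k14 k15 k22 k23 k24 k25 k33 k34 k35 k44 k45 k55 *; lra.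
Qed.

Lemma block_sum (x1 x2 x3 y1 y2 y3 : R) (X Y : 'I_4 -> 'I_4 -> R) :
  X i0 i1 = x1 -> X i0 i2 = x2 -> X i0 i3 = x3 -> X i1 i2 = x3 -> X i1 i3 = - x2 -> X i2 i3 = x1 ->
  Y i0 i1 = y1 -> Y i0 i2 = y2 -> Y i0 i3 = y3 -> Y i1 i2 = - y3 -> Y i1 i3 = y2 -> Y i2 i3 = - y1 ->
  \sum_(a < 4) \sum_(b < 4 | (a < b)%N) \sum_(c < 4) \sum_(d < 4 | (c < d)%N)
    X a b * Y c d * K a b c d =
  block_form x1 x2 x3 y1 y2 y3.
Proof.
move=> X01 X02 X03 X12 X13 X23 Y01 Y02 Y03 Y12 Y13 Y23.
rewrite /block_form sum_pairs !sum_pairs X01 X02 X03 X12 X13 X23 Y01 Y02 Y03 Y12 Y13 Y23.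
rewrite ?Kpair.
move: (K i0 i1 i0 i1) (K i0 i1 i0 i2) (K i0 i1 i0 i3) (K i0 i1 i1 i2) (K i0 i1 i1 i3) (K i0 i1 i2 i3)
    (K i0 i2 i0 i2) (K i0 i2 i0 i3) (K i0 i2 i1 i2) (K i0 i2 i1 i3) (K i0 i2 i2 i3) (K i0 i3 i0 i3)
    (K i0 i3 i1 i2) (K i0 i3 i1 i3) (K i0 i3 i2 i3) (K i1 i2 i1 i2) (K i1 i2 i1 i3) (K i1 i2 i2 i3)
    (K i1 i3 i1 i3) (K i1 i3 i2 i3) (K i2 i3 i2 i3).
move=> k00 k01 k02 k03 k04 k05 k11 k12 k13 k14 k15 k22 k23 k24 k25 k33 k34 k35 k44 k45 k55; ring.
Qed.

Lemma block_bilinear (x1 x2 x3 y1 y2 y3 : R) (X Y : 'I_4 -> 'I_4 -> R) : block_vanishes ->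
  X i0 i1 = x1 -> X i0 i2 = x2 -> X i0 i3 = x3 -> X i1 i2 = x3 -> X i1 i3 = - x2 -> X i2 i3 = x1 ->
  Y i0 i1 = y1 -> Y i0 i2 = y2 -> Y i0 i3 = y3 -> Y i1 i2 = - y3 -> Y i1 i3 = y2 -> Y i2 i3 = - y1 ->
  \sum_(a < 4) \sum_(b < 4 | (a < b)%N) \sum_(c < 4) \sum_(d < 4 | (c < d)%N)
    X a b * Y c d * K a b c d = 0.
Proof.
move=> [B0 [B1 [B2 [B3 [B4 [B5 [B6 [B7 B8]]]]]]]] X01 X02 X03 X12 X13 X23 Y01 Y02 Y03 Y12 Y13 Y23.
rewrite (block_sum X01 X02 X03 X12 X13 X23 Y01 Y02 Y03 Y12 Y13 Y23).
by rewrite /block_form B0 B1 B2 B3 B4 B5 B6 B7 B8 !mulr0 !addr0.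
Qed.

Lemma block_vanishes_sum :
  (forall x1 x2 x3 y1 y2 y3 : R, block_form x1 x2 x3 y1 y2 y3 = 0) -> block_vanishes.
Proof.
move=> H; move: (H 1 0 0 1 0 0) (H 1 0 0 0 1 0) (H 1 0 0 0 0 1) (H 0 1 0 1 0 0)
  (H 0 1 0 0 1 0) (H 0 1 0 0 0 1) (H 0 0 1 1 0 0) (H 0 0 1 0 1 0) (H 0 0 1 0 0 1).
rewrite /block_form !(mul0r, mulr0, mul1r, addr0, add0r) => B0 B1 B2 B3 B4 B5 B6 B7 B8.
exact: (conj B0 (conj B1 (conj B2 (conj B3 (conj B4 (conj B5 (conj B6 (conj B7 B8)))))))).
Qed.

End FrameComponents.

Section AlternatingComponents.
Variables (R : realType) (K : 'I_4 -> 'I_4 -> 'I_4 -> 'I_4 -> R).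
Hypotheses (K12 : forall a b c d, K a b c d = - K b a c d)
  (K23 : forall a b c d, K a b c d = - K a c b d)
  (K34 : forall a b c d, K a b c d = - K a b d c)
  (K1 : K i0 i1 i2 i3 = 1).

Let z12 a c d : K a a c d = 0.
Proof. by have := K12 a a c d; move: (K a a c d) => x; lra. Qed.
Let z23 a b d : K a b b d = 0.
Proof. by have := K23 a b b d; move: (K a b b d) => x; lra. Qed.
Let z13 a b d : K a b a d = 0.
Proof. by rewrite K23 z12 oppr0. Qed.
Let z24 a b c : K a b c b = 0.
Proof. by rewrite K34 z23 oppr0. Qed.
Let z14 a b c : K a b c a = 0.
Proof. by rewrite K34 z13 oppr0. Qed.

(** The hypotheses make [K] the Levi-Civita symbol, so only complementary index pairs contribute. *)
Lemma alternating_pairs (X Y : 'I_4 -> 'I_4 -> R) :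
  \sum_(a < 4) \sum_(b < 4 | (a < b)%N) \sum_(c < 4) \sum_(d < 4 | (c < d)%N)
    X a b * Y c d * K a b c d =
  X i0 i1 * Y i2 i3 - X i0 i2 * Y i1 i3 + X i0 i3 * Y i1 i2
  + X i1 i2 * Y i0 i3 - X i1 i3 * Y i0 i2 + X i2 i3 * Y i0 i1.
Proof.
rewrite sum_pairs !sum_pairs !(z13, z14, z23, z24).
have -> : K i0 i2 i1 i3 = -1 by rewrite K23 K1.
have -> : K i0 i3 i1 i2 = 1 by rewrite K23 K34 K1 opprK.
have -> : K i1 i2 i0 i3 = 1 by rewrite K23 K12 K1 opprK.
have -> : K i1 i3 i0 i2 = -1 by rewrite K23 K12 K34 K1 opprK.
have -> : K i2 i3 i0 i1 = 1 by rewrite K23 K12 K34 K23 K1 !opprK.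
rewrite K1; ring.
Qed.

End AlternatingComponents.

(** * Bivectors, the Hodge star and self-duality in an orthonormal frame *)

Section Bivectors.
Variable R : realType.
Notation E := ('rV[R]_4).
Implicit Types (F T : E -> E -> E -> E -> R) (X Y xi eta h e : 'M[R]_4).

Definition contr2 F xi eta : R := contr (fun v w => contr (F v w) eta) xi.

Lemma bivector_entry xi a b : bivector xi -> xi a b = - xi b a.
Proof. by move=> /matrixP/(_ b a); rewrite !mxE. Qed.

Lemma bivector_diag xi a : bivector xi -> xi a a = 0.
Proof. by move=> /(bivector_entry a a); move: (xi a a) => x; lra. Qed.

(** The unrestricted sums meet each index pair twice in either bivector, whence the 4. They are
    introduced because a change of frame acts on them by matrix congruence, which the restriction
    [a < b] obscures. *)
Lemma contr2_bilinear_ext F xi eta : curvlike F -> bivector xi -> bivector eta ->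
  contr2 F xi eta = 4 * bilinear_ext F xi eta.
Proof.
move=> [_ F12 F34 _] bxi beta.
pose S a b := \sum_(c < 4) \sum_(d < 4 | (c < d)%N)
  eta c d * F (basis a) (basis b) (basis c) (basis d).
have cE a b : contr (F (basis a) (basis b)) eta = 2 * S a b.
  rewrite /contr (@sum_pairs_sym R (fun c d =>
    eta c d * F (basis a) (basis b) (basis c) (basis d))) // => [c d|c].
    by rewrite (bivector_entry c d beta) F34 mulrNN.
  by rewrite bivector_diag // mul0r.
have SC a b : S a b = - S b a.
  rewrite /S -sumrN; apply: eq_bigr => c _; rewrite -sumrN; apply: eq_bigr => d _.
  by rewrite F12 mulrN.
rewrite /contr2 {1}/contr; under eq_bigr do under eq_bigr do rewrite cE.
rewrite (@sum_pairs_sym R (fun a b => xi a b * (2 * S a b))); last 2 first.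
- by move=> a b; rewrite (bivector_entry a b bxi) SC mulrN mulrNN.
- by move=> a; rewrite bivector_diag // mul0r.
rewrite /bilinear_ext (_ : 4 = 2 * 2); last by ring.
rewrite -mulrA; congr (_ * _); rewrite mulr_sumr; apply: eq_bigr => a _.
rewrite mulr_sumr; apply: eq_bigr => b _.
rewrite mulrCA; congr (_ * _); rewrite mulr_sumr; apply: eq_bigr => c _.
by rewrite mulr_sumr; apply: eq_bigr => d _; rewrite mulrA.
Qed.

Lemma linform_mulmx (L : E -> R) J : linform L -> linform (fun v => L (v *m J)).
Proof.
move=> lL; apply: linformP => [u v|c u]; first by rewrite mulmxDl linformD.
by rewrite -scalemxAl linformZ.
Qed.

Definition frame_pullback F e : E -> E -> E -> E -> R :=
  fun v w y z => F (v *m e) (w *m e) (y *m e) (z *m e).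

Lemma curvlike_frame F e : curvlike F -> curvlike (frame_pullback F e).
Proof.
move=> [l4 a12 a34 p]; split=> *; rewrite /frame_pullback.
- by apply: (linform_mulmx (L := F _ _ _)).
- exact: a12.
- exact: a34.
- exact: p.
Qed.

Lemma contr2_frame F X Y e : curvlike F ->
  contr2 F (e^T *m X *m e) (e^T *m Y *m e) = contr2 (frame_pullback F e) X Y.
Proof.
move=> cF; rewrite /contr2 -contr_congr; last first.
  split=> u; rewrite /contr.
    apply: linform_sum => a; apply: linform_sum => d; apply: linform_scale.
    exact: curvlike_lin2.
  apply: linform_sum => a; apply: linform_sum => d; apply: linform_scale.
  exact: curvlike_lin1.
congr contr; apply/funext => v; apply/funext => w.
rewrite -contr_congr //; split=> u; [by case: cF|exact: curvlike_lin3].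
Qed.

Lemma bivector_congr X e : bivector X -> bivector (e^T *m X *m e).
Proof. by rewrite /bivector !trmx_mul trmxK mulmxA => ->; rewrite mulmxN mulNmx. Qed.

Lemma bilinear_ext_frame F X Y e : curvlike F -> bivector X -> bivector Y ->
  bilinear_ext F (e^T *m X *m e) (e^T *m Y *m e) = bilinear_ext (frame_pullback F e) X Y.
Proof.
move=> cF bX bY; have := contr2_frame X Y e cF.
rewrite (contr2_bilinear_ext cF (bivector_congr e bX) (bivector_congr e bY)).
rewrite (contr2_bilinear_ext (curvlike_frame e cF) bX bY).
by apply: mulfI; rewrite pnatr_eq0.
Qed.

Definition innerF h : E -> E -> E -> E -> R :=
  fun v w x y => form h v x * form h w y - form h v y * form h w x.

Lemma curvlike_inner h : h^T = h -> curvlike (innerF h).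
Proof.
move=> hT; split=> v w y.
- apply: linform_add; first by apply: linform_scale; exact: (bilform_form h).1.
  apply: linform_opp; under eq_fun do rewrite mulrC.
  by apply: linform_scale; exact: (bilform_form h).1.
- by move=> z; rewrite /innerF; ring.
- by move=> z; rewrite /innerF; ring.
- move=> z; rewrite /innerF (Defs.formC y v hT) (Defs.formC z w hT).
  by rewrite (Defs.formC y w hT) (Defs.formC z v hT); ring.
Qed.

Definition detF : E -> E -> E -> E -> R :=
  fun v w x y => \det (\matrix_(k < 4) nth 0 [:: v; w; x; y] k).

Lemma detF_xrow a b (v w x y v' w' x' y' : E) : a != b ->
  (forall k : 'I_4, nth 0 [:: v'; w'; x'; y'] k = nth 0 [:: v; w; x; y] (tperm a b k)) ->
  detF v' w' x' y' = - detF v w x y.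
Proof.
move=> ab H; rewrite /detF; set A := \matrix_(k < 4) nth 0 [:: v; w; x; y] k.
have -> : (\matrix_(k < 4) nth 0 [:: v'; w'; x'; y'] k) = xrow a b A.
  by apply/matrixP => i j; rewrite !mxE H.
by rewrite /xrow row_permE det_mulmx det_perm odd_tperm ab expr1 mulN1r.
Qed.

Lemma detF12 v w x y : detF w v x y = - detF v w x y.
Proof.
apply: (@detF_xrow i0 i1) => //; elim/ord4_ind; rewrite ?tpermL ?tpermR //.
  by rewrite tpermD.
by rewrite tpermD.
Qed.

Lemma detF23 v w x y : detF v x w y = - detF v w x y.
Proof.
apply: (@detF_xrow i1 i2) => //; elim/ord4_ind; rewrite ?tpermL ?tpermR //.
  by rewrite tpermD.
by rewrite tpermD.
Qed.

Lemma detF34 v w x y : detF v w y x = - detF v w x y.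
Proof.
apply: (@detF_xrow i2 i3) => //; elim/ord4_ind; rewrite ?tpermL ?tpermR //.
  by rewrite tpermD.
by rewrite tpermD.
Qed.

Lemma curvlike_det : curvlike detF.
Proof.
split=> v w x; last 3 first.
- by move=> y; exact: detF12.
- by move=> y; exact: detF34.
- by move=> y; rewrite detF23 detF12 detF34 detF23 !opprK.
have M (b c : R) (y y1 y2 : E) : y = b *: y1 + c *: y2 ->
    detF v w x y = b * detF v w x y1 + c * detF v w x y2.
  move=> yE; apply: (@determinant_multilinear _ _ _ _ _ i3).
  - by apply/rowP => j; rewrite !mxE /= yE !mxE.
  - apply/matrixP => k j; rewrite !mxE; apply: (congr1 (fun u : E => u 0 j)).
    by move: k; case=> -[|[|[|k]]] Hk.
  - apply/matrixP => k j; rewrite !mxE; apply: (congr1 (fun u : E => u 0 j)).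
    by move: k; case=> -[|[|[|k]]] Hk.
apply: linformP => [y1 y2|c y1].
  by rewrite -[LHS]mul1r -[X in _ = X + _]mul1r -[X in _ = _ + X]mul1r mul1r; apply: M; rewrite !scale1r.
by rewrite -[RHS]addr0 -[X in _ = _ + X](mul0r (detF v w x 0)); apply: M; rewrite scale0r addr0.
Qed.

Lemma frame_pullback_det e v w y z : frame_pullback detF e v w y z = \det e * detF v w y z.
Proof.
rewrite mulrC /detF -det_mulmx; congr (\det _); apply/row_matrixP => k.
rewrite row_mul !rowK.
by move: k; apply: ord4_ind.
Qed.

Lemma frame_pullback_inner h e : e *m h *m e^T = 1%:M -> frame_pullback (innerF h) e = innerF 1%:M.
Proof.
move=> eh; apply/funext => v; apply/funext => w; apply/funext => y; apply/funext => z.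
by rewrite /frame_pullback /innerF -!form_congr eh.
Qed.

Lemma bivector_innerE X Y : bilinear_ext (innerF 1%:M) X Y =
  X i0 i1 * Y i0 i1 + X i0 i2 * Y i0 i2 + X i0 i3 * Y i0 i3
  + X i1 i2 * Y i1 i2 + X i1 i3 * Y i1 i3 + X i2 i3 * Y i2 i3.
Proof.
rewrite /bilinear_ext /innerF; under eq_bigr do under eq_bigr do under eq_bigr do
  under eq_bigr do rewrite !form_basis !mxE.
by rewrite sum_pairs !sum_pairs !eqxx !ord4_neq /=; ring.
Qed.

Lemma bivector_wedgeE X Y : bilinear_ext detF X Y =
  X i0 i1 * Y i2 i3 - X i0 i2 * Y i1 i3 + X i0 i3 * Y i1 i2
  + X i1 i2 * Y i0 i3 - X i1 i3 * Y i0 i2 + X i2 i3 * Y i0 i1.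
Proof.
apply: (@alternating_pairs R (fun a b c d => detF (basis a) (basis b) (basis c) (basis d))).
- by move=> a b c d; rewrite detF12.
- by move=> a b c d; rewrite detF23.
- by move=> a b c d; rewrite detF34.
- rewrite /detF (_ : \matrix_(_ < _) _ = 1%:M) ?det1 //.
  by apply/row_matrixP => k; rewrite rowK row1; move: k; apply: ord4_ind.
Qed.

Section Duality.
Variables (h e : 'M[R]_4) (T : E -> E -> E -> E -> R).
Hypotheses (hT : h^T = h) (eh : e *m h *m e^T = 1%:M) (de : 0 < \det e) (cT : curvlike T).

(** Determinants in [eh] give [\det h] as the inverse square of [\det e]; the positive sign of the
    root is where orientation enters. *)
Lemma unit_4vector_frame : unit_4vector h = \det e.
Proof.
have d2 : \det h = ((\det e)^-1) ^+ 2.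
  have dn : \det e != 0 by rewrite gt_eqF.
  have := congr1 determinant eh; rewrite !det_mulmx det_tr det1 => H.
  have -> : \det h = (\det e)^-1 * (\det e * \det h * \det e) * (\det e)^-1 by field.
  by rewrite H; field.
by rewrite /unit_4vector d2 sqrtr_sqr ger0_norm ?invrK // invr_ge0 ltW.
Qed.

Lemma bivector_frameE xi : bivector xi -> exists2 X, bivector X & xi = e^T *m X *m e.
Proof.
move=> bxi; have eu := frame_unit eh.
exists ((invmx e)^T *m xi *m invmx e); first exact: bivector_congr.
by rewrite !mulmxA -trmx_mul mulVmx // trmx1 mul1mx mulmxKV.
Qed.

(** In the frame the wedge product acquires the factor [\det e], and so does the right side through
    [unit_4vector]. Cancelling it leaves the Hodge condition of Euclidean space. *)
Lemma hodge_frame X Z (s : R) : bivector X -> bivector Z ->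
  (bivector_wedge (e^T *m Z *m e) (s *: (e^T *m X *m e)) =
   bivector_inner h (e^T *m Z *m e) (e^T *m X *m e) * unit_4vector h) <->
  s * (Z i0 i1 * X i2 i3 - Z i0 i2 * X i1 i3 + Z i0 i3 * X i1 i2
  + Z i1 i2 * X i0 i3 - Z i1 i3 * X i0 i2 + Z i2 i3 * X i0 i1) =
  Z i0 i1 * X i0 i1 + Z i0 i2 * X i0 i2 + Z i0 i3 * X i0 i3
  + Z i1 i2 * X i1 i2 + Z i1 i3 * X i1 i3 + Z i2 i3 * X i2 i3.
Proof.
move=> bX bZ.
have bsX : bivector (s *: X) by rewrite /bivector linearZ /= bX scalerN.
have -> : s *: (e^T *m X *m e) = e^T *m (s *: X) *m e by rewrite -scalemxAr -scalemxAl.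
rewrite /bivector_wedge /bivector_inner -/detF -/(innerF h).
rewrite (bilinear_ext_frame e curvlike_det bZ bsX).
rewrite (bilinear_ext_frame e (curvlike_inner hT) bZ bX) (frame_pullback_inner eh).
rewrite unit_4vector_frame bivector_innerE.
have -> : bilinear_ext (frame_pullback detF e) Z (s *: X) =
   \det e * bilinear_ext detF Z (s *: X).
  rewrite /bilinear_ext mulr_sumr; apply: eq_bigr => a _.
  rewrite mulr_sumr; apply: eq_bigr => b _.
  rewrite mulr_sumr; apply: eq_bigr => c _.
  rewrite mulr_sumr; apply: eq_bigr => d _.
  by rewrite frame_pullback_det mulrCA.
rewrite bivector_wedgeE ![(s *: X) _ _]mxE.
split=> [H|<-]; last by ring.
have dn : \det e != 0 by rewrite gt_eqF.
by apply: (mulfI dn); rewrite [RHS]mulrC -H; ring.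
Qed.

(** Parametrises the eigenspaces for [s = 1] and [s = -1]; for [s = 0] it spans the bivectors of e1,
    e2, e3, used as test elements. *)
Definition dual_bivector (s x1 x2 x3 : R) : 'M[R]_4 :=
  let E a b := delta_mx a b - delta_mx b a in
  x1 *: (s *: E i0 i1 + E i2 i3) + x2 *: (s *: E i0 i2 - E i1 i3) + x3 *: (s *: E i0 i3 + E i1 i2).

Lemma dual_bivectorP s x1 x2 x3 : bivector (dual_bivector s x1 x2 x3).
Proof.
by apply/matrixP => a b; rewrite !mxE ![(b == _) && _]andbC; ring.
Qed.

Lemma dual_bivectorE s x1 x2 x3 : let D := dual_bivector s x1 x2 x3 in
  (D i0 i1 = s * x1) * (D i0 i2 = s * x2) * (D i0 i3 = s * x3) *
  (D i1 i2 = x3) * (D i1 i3 = - x2) * (D i2 i3 = x1).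
Proof.
have dE (a b c d : 'I_4) : (delta_mx a b - delta_mx b a : 'M[R]_4) c d =
    ((c == a) && (d == b))%:R - ((c == b) && (d == a))%:R by rewrite !mxE.
have DE (A1 A2 A3 A4 A5 A6 : 'M[R]_4) a b :
    (x1 *: (s *: A1 + A2) + x2 *: (s *: A3 - A4) + x3 *: (s *: A5 + A6)) a b =
    x1 * (s * A1 a b + A2 a b) + x2 * (s * A3 a b - A4 a b) + x3 * (s * A5 a b + A6 a b).
  by rewrite !mxE.
by do ![split]; rewrite /dual_bivector DE !dE !eqxx !ord4_neq /=; ring.
Qed.

Lemma hodge_eigenspaceP s X : s * s = 1 -> bivector X ->
  hodge_eigenspace s h (e^T *m X *m e) <->
  [/\ X i0 i1 = s * X i2 i3, X i0 i2 = - (s * X i1 i3) & X i0 i3 = s * X i1 i2].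
Proof.
move=> ss bX; have bE := bivector_congr e bX; split=> [[_ [_ H]]|[H1 H2 H3]].
  (* Testing against the bivectors without e0 gives three equations; solved by [s * s = 1] they are
     the ones claimed. *)
  have Z y1 y2 y3 := (hodge_frame s bX (dual_bivectorP 0 y1 y2 y3)).1
    (H _ (bivector_congr e (dual_bivectorP 0 y1 y2 y3))).
  move: (Z 1 0 0) (Z 0 1 0) (Z 0 0 1); rewrite !dual_bivectorE.
  move: (X i0 i1) (X i0 i2) (X i0 i3) (X i1 i2) (X i1 i3) (X i2 i3) => a b c d f k.
  move=> h1 h2 h3.
  have -> : k = s * a by clear -h1; lra.
  have -> : f = - (s * b) by clear -h2; lra.
  have -> : d = s * c by clear -h3; lra.
  by rewrite mulrN !mulrA ss !mul1r opprK.
split=> //; split.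
  by rewrite /bivector linearZ /= bE scalerN.
move=> xi /bivector_frameE[Z bZ ->]; apply/(hodge_frame s bX bZ).
rewrite H1 H2 H3 !(mulrDr, mulrN, mulrBr).
have E t u : s * (t * (s * u)) = t * u by rewrite mulrCA mulrA mulrA -[t * s * s]mulrA ss mulr1.
by rewrite !E; ring.
Qed.

Lemma einstein_duality : el_tensor T h = 0 <->
  (forall xi eta, Lambda_plus h xi -> Lambda_minus h eta -> bilinear_ext T xi eta = 0).
Proof.
pose K a b c d := frame_pullback T e (basis a) (basis b) (basis c) (basis d).
have [_ F12 F34 Fp] := curvlike_frame e cT.
have K12 a b c d : K a b c d = - K b a c d by rewrite /K F12.
have K34 a b c d : K a b c d = - K a b d c by rewrite /K F34.
have Kp a b c d : K a b c d = K c d a b by rewrite /K Fp.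
have KE a b c d : K a b c d = T (row a e) (row b e) (row c e) (row d e).
  by rewrite /K /frame_pullback /Defs.basis -!rowE.
have -> : el_tensor T h = 0 <-> block_vanishes K.
  rewrite -(el_tensor_frame eh cT) -(einstein_block K12 K34 Kp).
  have sE : \sum_m \sum_i K i m m i = scal T (invmx h).
    by rewrite -(scal_frame eh cT); apply: eq_bigr => m _; apply: eq_bigr => i _; rewrite KE.
  have fE j l : form h (row j e) (row l e) = (j == l)%:R by rewrite form_row eh mxE.
  have RE j l : \sum_i K i j l i = \sum_i T (row i e) (row j e) (row l e) (row i e).
    by apply: eq_bigr => i _; rewrite KE.
  by rewrite sE; split=> H j l; move: (H j l); rewrite fE RE.
have BE X Y : bivector X -> bivector Y ->
    bilinear_ext T (e^T *m X *m e) (e^T *m Y *m e) =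
    \sum_(a < 4) \sum_(b < 4 | (a < b)%N) \sum_(c < 4) \sum_(d < 4 | (c < d)%N)
      X a b * Y c d * K a b c d.
  exact: bilinear_ext_frame.
have s1 : 1 * 1 = 1 :> R by rewrite mulr1.
have sN : -1 * -1 = 1 :> R by rewrite mulrNN mulr1.
split=> [B xi eta Lxi Leta|H].
  have [X bX xiE] := bivector_frameE Lxi.1; have [Y bY etaE] := bivector_frameE Leta.1.
  move: Lxi Leta; rewrite xiE etaE => /(hodge_eigenspaceP s1 bX)[X1 X2 X3].
  move=> /(hodge_eigenspaceP sN bY)[Y1 Y2 Y3]; rewrite BE //.
  apply: (block_bilinear Kp B (x1 := X i0 i1) (x2 := X i0 i2) (x3 := X i0 i3)
     (y1 := Y i0 i1) (y2 := Y i0 i2) (y3 := Y i0 i3)) => //.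
  - by rewrite X3 mul1r.
  - by rewrite X2 mul1r opprK.
  - by rewrite X1 mul1r.
  - by rewrite Y3 mulN1r opprK.
  - by rewrite Y2 mulN1r opprK.
  - by rewrite Y1 mulN1r opprK.
have {}H x1 x2 x3 y1 y2 y3 : \sum_(a < 4) \sum_(b < 4 | (a < b)%N)
    \sum_(c < 4) \sum_(d < 4 | (c < d)%N)
    dual_bivector 1 x1 x2 x3 a b * dual_bivector (-1) y1 y2 y3 c d * K a b c d = 0.
  have bX := dual_bivectorP 1 x1 x2 x3; have bY := dual_bivectorP (-1) y1 y2 y3.
  rewrite -(BE _ _ bX bY); apply: H.
    apply/(hodge_eigenspaceP s1 bX); rewrite !dual_bivectorE.
    by split; ring.
  apply/(hodge_eigenspaceP sN bY); rewrite !dual_bivectorE.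
  by split; ring.
apply: block_vanishes_sum => x1 x2 x3 y1 y2 y3.
(* The basis of [dual_bivector (-1)] is the negative of the one used in [block_form], hence the
   signs on [y]. *)
have := dual_bivectorE 1 x1 x2 x3; have := dual_bivectorE (-1) (- y1) (- y2) (- y3) => /= DY DX.
rewrite -(H x1 x2 x3 (- y1) (- y2) (- y3)); apply/esym.
by apply: (block_sum Kp); rewrite ?DX ?DY ?mul1r ?mulN1r ?opprK.
Qed.

End Duality.
End Bivectors.

(** * Integration over open subsets of R^4 *)

Section Lebesgue4.
Variable R : realType.
Notation E := ('rV[R]_4).
Local Notation mR := (measurableTypeR R).
Local Notation mR4 := (mR * mR * mR * mR)%type.

(** [lebesgue4] is declared as a bare set function; this is the same product with its measure
    structure. *)
Definition mu4 : {measure set _ -> \bar R} :=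
  (((@lebesgue_measure R \x @lebesgue_measure R) \x @lebesgue_measure R)
     \x @lebesgue_measure R)%E.

Definition box4 (A B C D : set R) : set (R * R * R * R) := ((A `*` B) `*` C) `*` D.

Lemma measurable_box4 (A B C D : set mR) :
  measurable A -> measurable B -> measurable C -> measurable D ->
  measurable (box4 A B C D : set mR4).
Proof. by move=> mA mB mC mD; do 3!apply: measurableX => //. Qed.

Lemma mu4_box (A B C D : set mR) :
  measurable A -> measurable B -> measurable C -> measurable D ->
  mu4 (box4 A B C D) = (lebesgue_measure A * lebesgue_measure B *
    lebesgue_measure C * lebesgue_measure D)%E.
Proof.
move=> mA mB mC mD.
apply: etrans (product_measure1E _ _ (measurableX (measurableX mA mB) mC) mD) _.
congr (_ * _)%E; apply: etrans (product_measure1E _ _ (measurableX mA mB) mC) _.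
by congr (_ * _)%E; exact: product_measure1E.
Qed.

Lemma point4E (z : R * R * R * R) : [/\ point4 z 0 i0 = z.1.1.1, point4 z 0 i1 = z.1.1.2,
  point4 z 0 i2 = z.1.2 & point4 z 0 i3 = z.2].
Proof. by case: z => [[[a b] c] d]; rewrite !mxE. Qed.

Lemma ball_point4 (x : E) (r : R) (z : R * R * R * R) : 0 < r ->
  `|x 0 i0 - z.1.1.1| < r -> `|x 0 i1 - z.1.1.2| < r ->
  `|x 0 i2 - z.1.2| < r -> `|x 0 i3 - z.2| < r -> ball x r (point4 z).
Proof.
move=> r0 h0 h1 h2 h3; have [e0 e1 e2 e3] := point4E z.
split=> // i j; rewrite ord1 {i}.
by move: j; apply: ord4_ind; rewrite /ball /= ?e0 ?e1 ?e2 ?e3.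
Qed.

(** The topology lives on row vectors and the sigma-algebra on an iterated product. They are linked
    by writing an open set as a countable union of boxes with rational endpoints. *)
Lemma open_measurable4 (U : set E) : open U ->
  measurable ([set z | U (point4 z)] : set mR4).
Proof.
move=> oU.
pose Q := ((rat * rat) * (rat * rat) * (rat * rat) * (rat * rat))%type.
pose I (q : rat * rat) : set R := `]ratr q.1, ratr q.2[%classic.
pose Bx (q : Q) := box4 (I q.1.1.1) (I q.1.1.2) (I q.1.2) (I q.2).
pose F (q : Q) := if `[< Bx q `<=` [set z | U (point4 z)] >] then Bx q else set0.
have -> : [set z | U (point4 z)] = \bigcup_q F q.
  apply/seteqP; split=> [z Uz|z [q _]]; last by rewrite /F; case: asboolP => [H /H //|_ []].
  have /nbhs_ballP[r /= r0 rU] : nbhs (point4 z) U by exact: open_nbhs_nbhs.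
  have pick (c : R) : exists q : rat * rat, (c \in `]ratr q.1, ratr q.2[%R) /\
      forall d : R, (d \in `]ratr q.1, ratr q.2[%R) -> `|c - d| < r.
    have r2 : 0 < r / 2 by rewrite divr_gt0.
    have [a] : exists q, ratr q \in `]c - r / 2, c[%R by apply: rat_in_itvoo; lra.
    have [b] : exists q, ratr q \in `]c, c + r / 2[%R by apply: rat_in_itvoo; lra.
    rewrite !in_itv /= => /andP[b1 b2] /andP[a1 a2]; exists (a, b); split.
      by rewrite in_itv /= a2 b1.
    move=> d; rewrite in_itv /= => /andP[d1 d2]; rewrite ltr_norml; apply/andP; split; lra.
  have [q0 [z0 b0]] := pick z.1.1.1; have [q1 [z1 b1]] := pick z.1.1.2.
  have [q2 [z2 b2]] := pick z.1.2; have [q3 [z3 b3]] := pick z.2.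
  exists (q0, q1, q2, q3) => //; rewrite /F; case: asboolP => [_|[]]; first by do ![split].
  move=> y [[[y0 y1] y2] y3]; apply: rU; have [e0 e1 e2 e3] := point4E z.
  by apply: ball_point4; rewrite ?e0 ?e1 ?e2 ?e3 //; [apply: b0|apply: b1|apply: b2|apply: b3].
apply: countable_bigcupT_measurable => [|q]; first exact: countableP.
rewrite /F; case: ifP => _; last exact: measurable0.
by apply: measurable_box4; exact: measurable_itv.
Qed.

Section ContinuousOnOpen.
Variables (U : set E) (f : E -> R).
Hypotheses (oU : open U) (cf : forall x, U x -> {for x, continuous f}).

Local Notation D := [set z : mR4 | U (point4 z)].
Local Notation g := (fun z : mR4 => f (point4 z) : mR).

Lemma open_preimage (P : set R) : open P -> open (U `&` f @^-1` P).
Proof.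
move=> oP; rewrite openE => x [Ux Px]; apply: filterI; first exact: open_nbhs_nbhs.
by apply: (cf Ux); exact: open_nbhs_nbhs.
Qed.

Lemma continuous_measurable4 : measurable_fun D g.
Proof.
apply: (measurability _ (RGenOInfty.measurableE R)).
move=> _ [_ [a ->] <-].
by apply: (@open_measurable4 (U `&` f @^-1` `]a, +oo[)); apply: open_preimage; exact: interval_open.
Qed.

(** A bounded measurable function that vanishes outside a box of finite measure. *)
Lemma integrable_compact_support (C N : R) :
  (forall x, U x -> `|f x| <= C) -> (forall x, U x -> f x != 0 -> forall k, `|x 0 k| <= N) ->
  mu4.-integrable D (EFin \o g).
Proof.
move=> fC fN.
have mD : measurable D by exact: open_measurable4.
pose I : set mR := `[-N, N]%classic.
pose B := box4 I I I I.
have mI : measurable I by exact: measurable_itv.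
have mB : measurable B by exact: measurable_box4.
have muI : (lebesgue_measure I < +oo)%E.
  by rewrite lebesgue_measure_itv /=; case: ifP => _ //; rewrite -EFinB ltry.
have muB : (mu4 B < +oo)%E.
  by rewrite mu4_box // ltey_eq !fin_numM // ge0_fin_numE.
apply/(integrable_mkcond _ mD).
have -> : (EFin \o g) \_ D = (EFin \o g) \_ (D `&` B).
  apply/funext => z; rewrite !patchE; case: ifPn => zD; last first.
    by case: ifPn => //; rewrite inE => -[+ _]; rewrite notin_setE in zD.
  case: ifPn => //; rewrite notin_setE => nB.
  have [fz|fz] := eqVneq (f (point4 z)) 0; first by rewrite /= fz.
  rewrite inE in zD; have zN := fN _ zD fz; case: nB; split=> //.
  have [e0 e1 e2 e3] := point4E z.
  by do ![split]; rewrite /I /= in_itv /= -ler_norml;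
    [have := zN i0|have := zN i1|have := zN i2|have := zN i3]; rewrite ?e0 ?e1 ?e2 ?e3.
apply/(integrable_mkcond _ (measurableI _ _ mD mB)).
apply: measurable_bounded_integrable.
- exact: measurableI.
- by apply: le_lt_trans muB; apply: le_measure; rewrite ?inE //; exact: measurableI.
- by apply: measurable_funS continuous_measurable4.
- exists C; split; first by rewrite num_real.
  by move=> M CM z /= [Dz _]; apply: le_trans (fC _ Dz) (ltW CM).
Qed.

(** The integrand vanishes almost everywhere. A positive value would persist, by continuity, on a
    box of positive measure. *)
Lemma Rintegral_eq0 : (forall x, U x -> 0 <= f x) -> mu4.-integrable D (EFin \o g) ->
  \int[mu4]_(z in D) g z = 0 -> forall x, U x -> f x = 0.
Proof.
move=> f0 fi intf x Ux; apply: contrapT => fx.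
have mD : measurable D by exact: open_measurable4.
have fx0 : 0 < f x by rewrite lt_neqAle f0 // andbT eq_sym; apply/eqP.
have aeD : ae_eq mu4 D (EFin \o g) (cst 0%E).
  apply/ae_eq_integral_abs => //; first by case/integrableP: fi.
  have -> : (\int[mu4]_(z in D) `|(EFin \o g) z|)%E = (\int[mu4]_(z in D) (g z)%:E)%E.
    by apply: eq_integral => z; rewrite inE /= => Dz; rewrite ger0_norm // f0.
  (* [Rintegral] also sends infinite integrals to [0]; finiteness recovers the vanishing of the
     extended integral. *)
  have := integrable_fin_num mD fi; move: intf; rewrite /Rintegral /comp /=.
  by case: (\int[mu4]_(z in D) _)%E => [r /= ->||].
have [N [mN muN DN]] := aeD.
pose W := U `&` f @^-1` `]0, +oo[.
have WN z : W (point4 z) -> N z.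
  move=> [Uz fz]; apply: DN => /= /(_ Uz) [] fz0.
  by move: fz; rewrite /= in_itv /= andbT fz0 ltxx.
have /nbhs_ballP[r /= r0 rW] : nbhs x W.
  apply: open_nbhs_nbhs; split; first by apply: open_preimage; exact: interval_open.
  by split=> //=; rewrite in_itv /= fx0.
pose I k : set mR := `]x 0 k - r, x 0 k + r[%classic.
have mI k : measurable (I k) by exact: measurable_itv.
have IE k d : I k d -> `|x 0 k - d| < r.
  by rewrite /I /= in_itv /= => /andP[d1 d2]; rewrite ltr_norml; apply/andP; split; lra.
have BN : box4 (I i0) (I i1) (I i2) (I i3) `<=` N.
  move=> z [[[z0 z1] z2] z3]; apply: WN; apply: rW.
  by apply: ball_point4 => //; exact: IE.
have : (mu4 (box4 (I i0) (I i1) (I i2) (I i3)) <= mu4 N)%E.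
  by apply: le_measure; rewrite ?inE //; exact: measurable_box4.
have muI k : lebesgue_measure (I k) = (2 * r)%:E.
  rewrite lebesgue_measure_itv /= lte_fin -EFinB; case: ifPn => [_|]; first by congr (_%:E); ring.
  by move/negP; case; lra.
rewrite muN mu4_box // !muI -!EFinM lee_fin leNgt => /negP; apply.
by rewrite !mulr_gt0.
Qed.

End ContinuousOnOpen.

End Lebesgue4.

(** * Continuity and partitions of unity *)

Section ContinuousMatrices.
Variables (R : realType) (T : topologicalType).
Implicit Types x : T.

Lemma continuous_ext (U : topologicalType) (f g : T -> U) x :
  (forall y, g y = f y) -> {for x, continuous f} -> {for x, continuous g}.
Proof. by move=> /funext ->. Qed.

Lemma continuous_bigsum (I : Type) (r : seq I) (P : pred I) (f : I -> T -> R) x :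
  (forall i, P i -> {for x, continuous (f i)}) ->
  {for x, continuous (fun y => \sum_(i <- r | P i) f i y)}.
Proof. by move=> cf; apply: cvg_big => //; exact: add_continuous. Qed.

Lemma continuous_bigprod (I : Type) (r : seq I) (P : pred I) (f : I -> T -> R) x :
  (forall i, P i -> {for x, continuous (f i)}) ->
  {for x, continuous (fun y => \prod_(i <- r | P i) f i y)}.
Proof. by move=> cf; apply: cvg_big => //; exact: mul_continuous. Qed.

Lemma continuous_det n (f : T -> 'M[R]_n) x :
  (forall i j, {for x, continuous (fun y => f y i j : R)}) ->
  {for x, continuous (fun y => \det (f y))}.
Proof.
move=> cf; apply: continuous_bigsum => s _; apply: continuousM; first exact: cvg_cst.
by apply: continuous_bigprod => i _; exact: cf.
Qed.

Lemma continuous_invmx n (f : T -> 'M[R]_n) x i j :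
  (forall i j, {for x, continuous (fun y => f y i j : R)}) -> f x \in unitmx ->
  {for x, continuous (fun y => invmx (f y) i j : R)}.
Proof.
move=> cf fu.
have cd := continuous_det cf.
have dn : \det (f x) != 0 by rewrite -unitfE -unitmxE.
have fy : \forall y \near x, f y \in unitmx.
  by move: cd => /cvgr_neq0 /(_ dn); apply: filterS => y; rewrite unitmxE unitfE.
have E : \forall y \near x, (\det (f y))^-1 * cofactor (f y) j i = invmx (f y) i j.
  by apply: filterS fy => y yu; rewrite /invmx yu !mxE.
have : {for x, continuous (fun y => (\det (f y))^-1 * cofactor (f y) j i)}.
  apply: continuousM; first exact: continuousV.
  apply: continuousM; first exact: cvg_cst.
  apply: continuous_det => k l.
  by apply: continuous_ext (@cf (lift j k) (lift i l)) => y; rewrite !mxE.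
rewrite /prop_for /continuous_at (nbhs_singleton E) => H.
exact: (cvg_trans (near_eq_cvg E) H).
Qed.

Lemma continuous_mulmx m n p (f : T -> 'M[R]_(m, n)) (g : T -> 'M[R]_(n, p)) x :
  (forall i j, {for x, continuous (fun y => f y i j : R)}) ->
  (forall i j, {for x, continuous (fun y => g y i j : R)}) ->
  forall i j, {for x, continuous (fun y => (f y *m g y) i j : R)}.
Proof.
move=> cf cg i j; apply: continuous_ext => [y|]; first by rewrite mxE; reflexivity.
by apply: continuous_bigsum => k _; apply: continuousM; [exact: cf|exact: cg].
Qed.

Section Curvature.
Notation E := ('rV[R]_4).
Variables (C : T -> E -> E -> E -> E -> R) (M : T -> 'M[R]_4) (x : T).
Hypotheses (cC : forall a b c d,
    {for x, continuous (fun y => C y (basis a) (basis b) (basis c) (basis d))})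
  (cM : forall i j, {for x, continuous (fun y => M y i j : R)}) (Mu : M x \in unitmx).

Let cI i j : {for x, continuous (fun y => invmx (M y) i j : R)}.
Proof. exact: continuous_invmx. Qed.

Lemma continuous_ricci i j :
  {for x, continuous (fun y => ricci (C y) (invmx (M y)) i j : R)}.
Proof.
apply: continuous_ext => [y|]; first by rewrite mxE; reflexivity.
apply: continuous_bigsum => a _; apply: continuous_bigsum => d _.
by apply: continuousM; [exact: cI|exact: cC].
Qed.

Lemma continuous_scal : {for x, continuous (fun y => scal (C y) (invmx (M y)))}.
Proof.
rewrite /scal /contr; apply: continuous_bigsum => a _; apply: continuous_bigsum => d _.
apply: continuousM; first exact: cI.
by apply: continuous_ext (@continuous_ricci a d) => y; rewrite form_basis.
Qed.

Lemma continuous_sqrt_det : {for x, continuous (fun y => Num.sqrt (\det (M y)))}.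
Proof.
apply: (@continuous_comp _ _ _ (fun y => \det (M y)) Num.sqrt); first exact: continuous_det.
exact: sqrt_continuous.
Qed.

Lemma continuous_el_tensor i j : {for x, continuous (fun y => el_tensor (C y) (M y) i j : R)}.
Proof.
apply: (@continuous_ext R (fun y => scal (C y) (invmx (M y)) / 2 * M y i j
  - 2 * ricci (C y) (invmx (M y)) i j)).
  by move=> y; rewrite mxE [X in X + _]mxE [X in _ + X]mxE [X in - X]mxE.
apply: continuousB; apply: continuousM => //.
- by apply: continuousM; [exact: continuous_scal|exact: cvg_cst].
- exact: cvg_cst.
- exact: continuous_ricci.
Qed.

Lemma continuous_variation (v : T -> 'M[R]_4) :
  (forall i j, {for x, continuous (fun y => v y i j : R)}) ->
  {for x, continuous (fun y => \tr (invmx (M y) *m el_tensor (C y) (M y) *m invmx (M y) *m v y)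
    * Num.sqrt (\det (M y)))}.
Proof.
move=> cv; apply: continuousM; last exact: continuous_sqrt_det.
apply: continuous_bigsum => i _; apply: continuous_mulmx => //.
apply: continuous_mulmx => //; apply: continuous_mulmx => //.
exact: continuous_el_tensor.
Qed.

End Curvature.
End ContinuousMatrices.

(** * Partitions of unity on a compact Hausdorff space with an atlas *)

Section PartitionOfUnity.
Variables (R : realType) (M : topologicalType) (A : oriented_atlas R M).
Hypotheses (hM : hausdorff_space M) (cM : compact [set: M]).

(** Urysohn's lemma in a compact Hausdorff, hence normal, space. The set where [f] is positive lies
    in the chart but its closure might not, so [f] is cut at one half: [u + |u|] vanishes outside
    the closed set where [f] is at least one half. *)
Lemma chart_bump (p : M) : exists c : idx A * (M -> R),
  [/\ continuous c.2, (forall q, 0 <= c.2 q), 0 < c.2 p &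
      exists K : set M, [/\ compact K, K `<=` dom c.1 & forall q, ~ K q -> c.2 q = 0]].
Proof.
have [i ip] := dom_cover A p.
have nM := compact_normal hM cM.
have c1 : closed (~` dom i) by apply: open_closedC; exact: dom_open.
have c2 : closed [set p] by apply: accessible_closed_set1; exact: hausdorff_accessible.
have dj : ~` dom i `&` [set p] = set0 by apply/seteqP; split=> // q [/= nq qp]; apply: nq; rewrite qp.
have /(uniform_separatorP (R := R))[f [cf _ f0 f1]] := (normal_separatorP (R := R)).1 nM _ _ c1 c2 dj.
pose u q := f q - 2^-1.
have cu q : {for q, continuous u} by apply: continuousB; [exact: cf|exact: cvg_cst].
exists (i, fun q => u q + `|u q|); split=> /=.
- move=> q; apply: continuousD; first exact: cu.
  by apply: (@continuous_comp _ _ _ u Num.norm); [exact: cu|exact: norm_continuous].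
- by move=> q; rewrite -lerBlDl sub0r -normrN ler_norm.
- have fp : f p = 1 by apply: f1; exists p.
  have up : 0 < u p by rewrite /u fp; lra.
  by rewrite addr_gt0 // normr_gt0 gt_eqF.
exists [set q | 2^-1 <= f q]; split.
- apply: (subclosed_compact _ cM) => //.
  by apply: (@closed_comp _ _ f [set r | 2^-1 <= r]) => [q _|]; [exact: cf|exact: closed_ge].
- move=> q /= fq; apply: contrapT => nq; have fq0 : f q = 0 by apply: f0; exists q.
  by move: fq; rewrite fq0; lra.
- move=> q /= /negP; rewrite -ltNge => fq.
  by rewrite ler0_norm ?subrr // /u subr_le0 ltW.
Qed.

Lemma partition_of_unity_exists : exists s, partition_of_unity (A := A) s.
Proof.
have [c cP] := choice chart_bump.
have [D DM] : exists D : seq M, forall q, exists2 p, p \in D & 0 < (c p).2 q.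
  (* An empty [M] is covered by the empty list; otherwise [p0] provides the pointed structure with
     which [compact_cover] is used. *)
  have [[p0 _]|M0] := pselect (exists p : M, True); last first.
    by exists [::] => q; case: M0; exists q.
  pose Mp : ptopologicalType := HB.pack M (isPointed.Build M p0).
  have cMp : cover_compact [set: Mp] by rewrite -compact_cover.
  have [|q _|D _ DM] := cMp M setT (fun p => [set q | 0 < (c p).2 q]).
  - move=> p _; have [cp _ _ _] := cP p.
    by apply: (@open_comp M R (c p).2 [set r | 0 < r]) => [q _|]; [exact: cp|exact: open_gt].
  - by exists q => //; have [_ _ + _] := cP q.
  exists (finmap.enum_fset D) => q; have [p pD cq] := DM q I.
  by exists p.
pose S q := \sum_(p <- D) (c p).2 q.
have c0 p q : 0 <= (c p).2 q by have [_ + _ _] := cP p; exact.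
have S0 q : 0 < S q.
  have [p pD cp] := DM q; rewrite /S (big_rem p) //= ltr_pwDl //.
  by apply: sumr_ge0 => i _.
exists [seq ((c p).1, fun q => (c p).2 q / S q) | p <- D]; split.
  move=> i rho /mapP[p pD [-> ->]]; have [cc _ _ [K [cK Kd K0]]] := cP p; split.
  - move=> q; apply: continuousM; first exact: cc.
    apply: continuousV; first by rewrite gt_eqF.
    by apply: continuous_bigsum => k _; have [+ _ _ _] := cP k; exact.
  - by move=> q; rewrite divr_ge0 // ltW.
  - by exists K; split=> // q /K0 ->; rewrite mul0r.
by move=> q; rewrite big_map /= -mulr_suml divff // gt_eqF // S0.
Qed.

End PartitionOfUnity.

(** * Uniform bounds over compact sets and positivity of perturbed metrics *)

Section CompactBounds.
Variables (R : realType) (T : topologicalType) (A : set T) (f : T -> R).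
Hypotheses (cA : compact A) (cf : forall a, A a -> {for a, continuous f}).

Let cfA : {within A, continuous f}.
Proof. by apply: continuous_in_subspaceT => a; rewrite inE => /cf. Qed.

Lemma compact_norm_bound : exists2 C : R, 0 <= C & forall a, A a -> `|f a| <= C.
Proof.
have [A0|A0] := pselect (A !=set0); last first.
  by exists 0 => // a Aa; case: A0; exists a.
have [M _ fM] := compact_EVT_max A0 cA cfA; have [m _ fm] := compact_EVT_min A0 cA cfA.
exists (`|f M| + `|f m|) => [|a Aa]; first exact: addr_ge0.
rewrite ler_norml; apply/andP; split.
  apply: le_trans (fm a (mem_set Aa)); rewrite opprD -lerBrDr.
  have := ler_norm (- f m); have := normr_ge0 (f M); rewrite normrN; lra.
apply: le_trans (fM a (mem_set Aa)) _; have := ler_norm (f M); have := normr_ge0 (f m); lra.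
Qed.

Lemma compact_positive_bound : (forall a, A a -> 0 < f a) ->
  exists2 m : R, 0 < m & forall a, A a -> m <= f a.
Proof.
move=> f0; have [A0|A0] := pselect (A !=set0); last first.
  by exists 1 => // a Aa; case: A0; exists a.
have [m Am fm] := compact_EVT_min A0 cA cfA; exists (f m) => [|a Aa].
  by apply: f0; rewrite inE in Am.
by apply: fm; rewrite inE.
Qed.

End CompactBounds.

Section SPDPerturbation.
Variables (R : realType).
Notation E := ('rV[R]_4).
Variables (h v : E -> 'M[R]_4) (K : set E).
Hypotheses (cK : compact K)
  (ch : forall x, K x -> forall i j, {for x, continuous (fun y => h y i j : R)})
  (cv : forall x, K x -> forall i j, {for x, continuous (fun y => v y i j : R)})
  (hpos : forall x, K x -> spd (h x)) (vT : forall x, K x -> (v x)^T = v x).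

Lemma continuous_form_pair (B : E -> 'M[R]_4) (p : E * E) :
  (forall i j, {for p.1, continuous (fun y => B y i j : R)}) ->
  {for p, continuous (fun q : E * E => (q.2 *m B q.1 *m q.2^T) 0 0)}.
Proof.
move=> cB.
apply: (@continuous_ext _ R (fun q : E * E => \sum_a \sum_b q.2 0 a * q.2 0 b * B q.1 a b)).
  by move=> q; rewrite -/(Defs.form _ _ _) formE.
have c2 a : {for p, continuous (fun q : E * E => q.2 0 a)}.
  apply: (@continuous_comp _ _ _ (snd : E * E -> E) (fun u : E => u 0 a)); first exact: cvg_snd.
  exact: coord_continuous.
apply: continuous_bigsum => a _; apply: continuous_bigsum => b _.
apply: continuousM; first by apply: continuousM; exact: c2.
apply: (@continuous_comp _ _ _ (fst : E * E -> E) (fun u : E => B u a b)); first exact: cvg_fst.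
exact: cB.
Qed.

Lemma quadratic_scale (B : 'M[R]_4) (c : R) (u : E) :
  ((c *: u) *m B *m (c *: u)^T) 0 0 = c ^+ 2 * (u *m B *m u^T) 0 0.
Proof.
by rewrite linearZ /= -scalemxAr -!scalemxAl scalerA mxE expr2.
Qed.

Lemma quadratic_pencil (B C : 'M[R]_4) (t : R) (u : E) :
  (u *m (B + t *: C) *m u^T) 0 0 = (u *m B *m u^T) 0 0 + t * (u *m C *m u^T) 0 0.
Proof. by rewrite mulmxDr mulmxDl -scalemxAr -scalemxAl mxE [X in _ + X]mxE. Qed.

(** On the compact product of [K] with the unit sphere, [h] has a positive lower bound [m] and [v]
    an upper bound [V]; homogeneity extends the estimate to all nonzero vectors. *)
Lemma spd_perturbation : exists2 eps : R, 0 < eps &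
  forall x (t : R), K x -> `|t| < eps -> spd (h x + t *: v x).
Proof.
pose S := [set u : E | `|u| = 1].
have cS : compact S.
  apply: bounded_closed_compact.
    by exists 1; split; [rewrite num_real|move=> r r1 u /= ->; rewrite ltW].
  by apply: (@closed_comp E R Num.norm [set 1]) => [u _|];
    [exact: norm_continuous|exact: closed_eq].
have cKS : compact (K `*` S) by exact: compact_setX.
have [|q [Kq Sq]|m m0 hm] := @compact_positive_bound R (E * E)%type (K `*` S)
    (fun q => (q.2 *m h q.1 *m q.2^T) 0 0) cKS.
- by move=> q [Kq _]; apply: continuous_form_pair; exact: ch.
- apply: (hpos Kq).2; apply/eqP => q0; move: Sq; rewrite /S /= q0 normr0 => /eqP.
  by rewrite eq_sym oner_eq0.
have [q [Kq _]|V V0 hV] := @compact_norm_bound R (E * E)%type (K `*` S)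
    (fun q => (q.2 *m v q.1 *m q.2^T) 0 0) cKS.
  by apply: continuous_form_pair; exact: cv.
have V1 : 0 < V + 1 by rewrite ltr_wpDl.
(* The [1] guards against [V = 0]. *)
exists (m / (V + 1)); first by rewrite divr_gt0.
move=> x t Kx; rewrite ltr_pdivlMr // => tm; split.
  by rewrite linearD /= linearZ /= vT // (hpos Kx).1.
move=> w w0; pose u := `|w|^-1 *: w.
have nw : `|w| != 0 by rewrite normr_eq0.
have Su : S u by rewrite /S /u /= normrZ normfV normr_id mulVf.
have wE : w = `|w| *: u by rewrite /u scalerA mulfV // scale1r.
have -> : (w *m (h x + t *: v x) *m w^T) 0 0 =
    `|w| ^+ 2 * ((u *m h x *m u^T) 0 0 + t * (u *m v x *m u^T) 0 0).
  by rewrite {1 2}wE quadratic_scale quadratic_pencil.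
apply: mulr_gt0; first by rewrite exprn_gt0 // lt_neqAle eq_sym nw normr_ge0.
have := hm (x, u) (conj Kx Su); have := hV (x, u) (conj Kx Su) => /= h1 h2.
have : `|t * (u *m v x *m u^T) 0 0| < m.
  rewrite normrM; apply: le_lt_trans tm; apply: ler_wpM2l => //.
  by apply: le_trans h1 _; rewrite lerDl.
rewrite ltr_norml => /andP[h3 _].
by rewrite -ltrBlDr sub0r (lt_le_trans _ h2) // -ltrNl.
Qed.

End SPDPerturbation.

Section ChartMixedScal.
Variables (R : realType).
Notation E := ('rV[R]_4).
Variables (U : set E) (g : E -> 'M[R]_4).
Hypothesis mg : metric_on U g.

Lemma curvlike_Rm x : U x -> curvlike (Rm g x).
Proof.
move=> Ux; split=> *; [exact: (Rm_lin4 mg)|exact: (Rm_anti12 mg)|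
  exact: (Rm_anti34 mg)|exact: (Rm_pair mg)].
Qed.

(** Positivity provides an oriented frame, so [xget] does not return its default [0]; the trace over
    whichever frame it picks is a contraction with [invmx B]. *)
Lemma mixed_scalE x (B : 'M[R]_4) : U x -> spd B ->
  mixed_scal g x B = scal (Rm g x) (invmx B).
Proof.
move=> Ux sB; rewrite /mixed_scal.
have := xgetPex 0 (orientable_frame sB); rewrite -/(oriented_frame _ _).
set e := xget _ _ => -[eB _].
exact: (scal_frame eB (curvlike_Rm Ux)).
Qed.

End ChartMixedScal.

(** * The first variation in a chart *)

Section ChartVariation.
Variables (R : realType).
Notation E := ('rV[R]_4).
Local Notation mR := (measurableTypeR R).
Local Notation mR4 := (mR * mR * mR * mR)%type.
Variables (U K : set E) (g h v : E -> 'M[R]_4) (rho : E -> R).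
Hypotheses (mg : metric_on U g)
  (ch : forall x, U x -> forall i j, {for x, continuous (fun y => h y i j : R)})
  (cv : forall x, U x -> forall i j, {for x, continuous (fun y => v y i j : R)})
  (hpos : forall x, U x -> spd (h x)) (vT : forall x, U x -> (v x)^T = v x)
  (crho : forall x, U x -> {for x, continuous rho})
  (rho0 : forall x, U x -> ~ K x -> rho x = 0)
  (cK : compact K) (KU : K `<=` U).

Let oU : open U. Proof. by case: mg. Qed.

(** Agrees with the frame-based density wherever [h x + t *: v x] is positive, and is an explicit
    function of its entries. *)
Definition chart_density t x : R :=
  scal (Rm g x) (invmx (h x + t *: v x)) * Num.sqrt (\det (h x + t *: v x)).

Definition chart_variation t x : R :=
  let M := h x + t *: v x in
  \tr (invmx M *m el_tensor (Rm g x) M *m invmx M *m v x) * Num.sqrt (\det M).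

Lemma spd_unit n (B : 'M[R]_n.+2) : spd B -> B \in unitmx /\ 0 < \det B.
Proof.
move=> /orientable_frame[e [eB de]].
have dB : \det e * \det B * \det e = 1 by rewrite -{2}(det_tr e) -!det_mulmx eB det1.
have B0 : 0 < \det B.
  rewrite -(pmulr_rgt0 _ de) -(pmulr_lgt0 _ de) dB; exact: ltr01.
by rewrite unitmxE unitfE gt_eqF.
Qed.

Lemma cRm x a b c d : U x ->
  {for x, continuous (fun y => Rm g y (basis a) (basis b) (basis c) (basis d))}.
Proof. by move=> Ux; exact: smooth_on_continuous (smooth_Rm mg _ _ _ _) Ux. Qed.

(** Differentiation under the integral needs the derivative on a whole interval. Taking
    [h x + t *: v x] as new base point reduces it to the derivative at [0]. *)
Lemma is_derive_chart_density t x : U x -> spd (h x + t *: v x) ->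
  is_derive t (1 : R) (chart_density ^~ x) (chart_variation t x).
Proof.
move=> Ux sM; pose M := h x + t *: v x.
have [Mu dM] := spd_unit sM.
have D := is_derive_density (v x) (curvlike_Rm mg Ux) Mu sM.1 dM.
have E1 : (chart_density ^~ x) =
   (fun s => scal (Rm g x) (invmx (M + s *: v x)) * Num.sqrt (\det (M + s *: v x))) \o (fun s => s - t).
  by apply/funext => s; rewrite /chart_density /= /M -addrA -scalerDl addrCA subrr addr0.
have D0 : is_derive t (1 : R) (fun s : R => s - t) 1.
  by apply: (is_derive_eq (is_deriveB (is_derive_id t (1 : R)) (is_derive_cst t t (1 : R))));
    rewrite subr0.
rewrite E1; have := @is_derive1_comp R _ (fun s => s - t) t _ _ _ D0.
rewrite subrr => /(_ _ _ D) H.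
by apply: (is_derive_eq H); rewrite mulr1.
Qed.

Lemma continuous_density t x : U x -> spd (h x + t *: v x) ->
  {for x, continuous (chart_density t)}.
Proof.
move=> Ux sM; have [Mu _] := spd_unit sM.
have cM i j : {for x, continuous (fun y => (h y + t *: v y) i j : R)}.
  apply: (@continuous_ext _ R (fun y => h y i j + t * v y i j)) => [y|].
    by rewrite mxE [X in _ + X]mxE.
  by apply: continuousD; [exact: ch|apply: continuousM; [exact: cst_continuous|exact: cv]].
apply: continuousM; last exact: continuous_sqrt_det.
by apply: continuous_scal => // a b c d; exact: cRm.
Qed.

(** Joint continuity in point and time, so that the time derivative is bounded on a compact
    product. *)
Lemma continuous_chart_variation t x : U x -> spd (h x + t *: v x) ->
  {for (x, t), continuous (fun q : E * R => chart_variation q.2 q.1)}.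
Proof.
move=> Ux sM; have [Mu _] := spd_unit sM.
have c1 (f : E -> R) : {for x, continuous f} -> {for (x, t), continuous (fun q : E * R => f q.1)}.
  by move=> cf; apply: (@continuous_comp _ _ _ (fst : E * R -> E) f); [exact: cvg_fst|exact: cf].
have c2 : {for (x, t), continuous (snd : E * R -> R)} by exact: cvg_snd.
apply: (@continuous_variation R (E * R)%type (fun q => Rm g q.1)
  (fun q => h q.1 + q.2 *: v q.1) (x, t)).
- by move=> a b c d; apply: (c1 (fun y => Rm g y (basis a) (basis b) (basis c) (basis d))); exact: cRm.
- move=> i j; apply: (@continuous_ext _ R (fun q : E * R => h q.1 i j + q.2 * v q.1 i j)) => [y|].
    by rewrite mxE [X in _ + X]mxE.
  apply: continuousD; first by apply: (c1 (fun y => h y i j)); exact: ch.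
  by apply: continuousM => //; apply: (c1 (fun y => v y i j)); exact: cv.
- exact: Mu.
- by move=> i j; apply: (c1 (fun y => v y i j)); exact: cv.
Qed.

(** Densities of [h + t *: v] are controlled on [K] only. Since [K] is closed, the product with
    [rho] is locally zero at the other points of [U]. *)
Lemma continuous_cutoff (f : E -> R) x : (forall y, K y -> {for y, continuous f}) ->
  U x -> {for x, continuous (fun y => rho y * f y)}.
Proof.
move=> cf Ux; have [Kx|nK] := pselect (K x).
  by apply: continuousM; [exact: crho|exact: cf].
have E0 : \forall y \near x, cst 0 y = rho y * f y.
  have oK : open (U `&` ~` K).
    apply: openI => //; apply: closed_openC; apply: compact_closed cK.
    exact: norm_hausdorff.
  have : nbhs x (U `&` ~` K) by exact: open_nbhs_nbhs.
  by apply: filterS => y [Uy nKy]; rewrite rho0 // mul0r.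
rewrite /prop_for /continuous_at -(nbhs_singleton E0).
exact: (cvg_trans (near_eq_cvg E0) (cvg_cst _)).
Qed.

Lemma integrable_cutoff (f : E -> R) : (forall y, K y -> {for y, continuous f}) ->
  (@mu4 R).-integrable [set z | U (point4 z)] (EFin \o (fun z => rho (point4 z) * f (point4 z))).
Proof.
move=> cf; have cF x (Ux : U x) := continuous_cutoff cf Ux.
have [C C0 fC] := compact_norm_bound cK (fun y Ky => cF y (KU Ky)).
have [N [_ hN]] := compact_bounded cK.
have N1 : N < N + 1 by rewrite ltrDl.
apply: (@integrable_compact_support R U (fun y => rho y * f y) oU cF C (N + 1)).
- move=> x Ux; have [Kx|nK] := pselect (K x); first exact: fC.
  by rewrite rho0 // mul0r normr0.
- move=> x Ux fx k; have Kx : K x.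
    by apply: contrapT => nK; move: fx; rewrite rho0 // mul0r eqxx.
  apply: le_trans (hN _ N1 x Kx).
  by rewrite [leRHS]/Num.Def.normr /= mx_normrE;
  exact: (le_bigmax _ (fun ij => `|x ij.1 ij.2|) (0, k)).
Qed.

Lemma is_derive_cutoff_density t x : U x -> (K x -> spd (h x + t *: v x)) ->
  is_derive t (1 : R) (fun s => rho x * chart_density s x) (rho x * chart_variation t x).
Proof.
move=> Ux sM; have [Kx|nK] := pselect (K x).
  exact: (is_deriveZ _ (is_derive_chart_density Ux (sM Kx))).
rewrite rho0 // mul0r (_ : (fun s => _) = cst 0); first exact: is_derive_cst.
by apply/funext => s; rewrite mul0r.
Qed.

Hypothesis rho_ge0 : forall x, 0 <= rho x.

Lemma is_derive_chart_action : is_derive (0 : R) (1 : R)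
  (fun t : R => \int[@mu4 R]_(z in [set z | U (point4 z)])
     (rho (point4 z) * mixed_scal g (point4 z) (h (point4 z) + t *: v (point4 z)) *
        Num.sqrt (\det (h (point4 z) + t *: v (point4 z)))))
  (\int[@mu4 R]_(z in [set z | U (point4 z)]) (rho (point4 z) * chart_variation 0 (point4 z))).
Proof.
have [eps eps0 hspd] := spd_perturbation cK (fun x Kx => ch (KU Kx)) (fun x Kx => cv (KU Kx))
  (fun x Kx => hpos (KU Kx)) (fun x Kx => vT (KU Kx)).
(* Half of [eps], so that the closed interval of radius [d], needed for compactness, keeps the
   perturbed metric positive. *)
pose d := eps / 2.
have d0 : 0 < d by rewrite divr_gt0.
have deps : d < eps by rewrite /d; lra.
have cKI : compact (K `*` `[- d, d]) by apply: compact_setX => //; exact: segment_compact.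
have Ieps t : t \in `[- d, d] -> `|t| < eps.
  by rewrite in_itv /= -ler_norml => /le_lt_trans; apply.
have [q [Kq Iq]|C C0 VC] := @compact_norm_bound R (E * R)%type _
    (fun q => chart_variation q.2 q.1) cKI.
  have := @continuous_chart_variation q.2 q.1 (KU Kq).
  by rewrite -surjective_pairing; apply; apply: hspd => //; exact: Ieps.
pose D := [set z : mR4 | U (point4 z)].
pose f (t : R) (z : mR4) :=
  rho (point4 z) * chart_density t (point4 z).
have mD : measurable D by exact: open_measurable4.
have I0 : `]- d, d[%classic (0 : R) by rewrite /= in_itv /= oppr_lt0 d0.
have Id t : `]- d, d[%classic t -> forall x, K x -> spd (h x + t *: v x).
  move=> /= td x Kx; apply: hspd => //; apply: Ieps.
  by move: td; rewrite !in_itv /= => /andP[? ?]; rewrite !ltW.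
have intf t : `]- d, d[%classic t -> (@mu4 R).-integrable D (EFin \o f t).
  move=> /Id Kt; apply: integrable_cutoff => y Ky.
  by apply: continuous_density; [exact: KU|exact: Kt].
have derf t z : `]- d, d[%classic t -> D z ->
    is_derive t (1 : R) (f ^~ z) (rho (point4 z) * chart_variation t (point4 z)).
  by move=> /Id Kt Dz; apply: is_derive_cutoff_density => // Kz; exact: Kt.
(* The dominating function: the constant [C] alone need not be integrable over the chart, its
   product with the cutoff is. *)
pose G (z : mR4) := rho (point4 z) * C.
have G0 z : 0 <= G z by rewrite mulr_ge0.
have iG : (@mu4 R).-integrable D (EFin \o G).
  by apply: (@integrable_cutoff (fun=> C)) => y Ky; exact: cst_continuous.
have derf1 t z : `]- d, d[%classic t -> D z -> derivable (f ^~ z) t 1.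
  by move=> It Dz; have := derf t z It Dz; case.
have p1E t z : `]- d, d[%classic t -> D z ->
    partial1of2 f t z = rho (point4 z) * chart_variation t (point4 z).
  move=> It Dz; have := derf t z It Dz => -[_ <-].
  by rewrite /partial1of2 derive1E.
have G_ub t z : `]- d, d[%classic t -> D z -> `|partial1of2 f t z| <= G z.
  move=> It Dz; rewrite p1E // normrM ger0_norm //.
  have [Kz|nK] := pselect (K (point4 z)); last by rewrite /G rho0 // !mul0r.
  apply: ler_wpM2l => //; apply: (VC (point4 z, t)); split=> //=.
  by move: It; rewrite /= !in_itv /= => /andP[? ?]; rewrite !ltW.
have DF := derivable_under_integral mD I0 intf derf1 G0 iG G_ub.
have DE := differentiation_under_integral mD I0 intf derf1 G0 iG G_ub.
have H : is_derive (0 : R) (1 : R) (fun t : R => \int[@mu4 R]_(z in D) f t z)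
    (\int[@mu4 R]_(z in D) (rho (point4 z) * chart_variation 0 (point4 z))).
  apply: DeriveDef DF _; rewrite -derive1E DE; apply: eq_Rintegral => z.
  by rewrite inE => Dz; rewrite p1E.
apply: near_eq_is_derive H.
have nI : \forall t \near (0 : R), `]- d, d[%classic t.
  by apply: open_nbhs_nbhs; split; [exact: interval_open|exact: I0].
apply: filterS nI => t /Id Kt; apply: eq_Rintegral => z; rewrite inE => Dz.
(* Positivity of the perturbed metric is known on [K] only; elsewhere the cutoff annihilates both
   sides, whatever [mixed_scal] returns. *)
rewrite /f -mulrA; have [Kz|nK] := pselect (K (point4 z)); last by rewrite rho0 // !mul0r.
by rewrite (mixed_scalE mg) //; exact: Kt.
Qed.

End ChartVariation.

(** * Tensors on the manifold *)

Section Atlas.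
Variables (R : realType) (M : topologicalType) (A : oriented_atlas R M).
Implicit Types (i j : idx A).

Lemma inv_dom i x : img i x -> dom i (inv i x) /\ crd i (inv i x) = x.
Proof. by move=> [p ip <-]; rewrite crdK. Qed.

Lemma overlapP i j x : overlap i j x <-> img i x /\ dom j (inv i x).
Proof.
split=> [[p [ip jp] <-]|[ix jx]]; first by rewrite crdK //; split=> //; exists p.
by have [ip xE] := inv_dom ix; exists (inv i x).
Qed.

Lemma overlap_img i j x : overlap i j x -> img i x.
Proof. by move=> /overlapP[]. Qed.

Lemma transition_img i j x : overlap i j x -> img j (transition i j x).
Proof. by move=> /overlapP[_ jx]; exists (inv i x). Qed.

Lemma overlap_open i j : open (overlap i j).
Proof.
rewrite openE => x ox; have [ix jx] := (overlapP i j x).1 ox.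
have c : \forall y \near x, dom j (inv i y).
  have nj : nbhs (inv i x) (dom j) by apply: open_nbhs_nbhs; split=> //; exact: dom_open.
  exact: (Defs.inv_continuous ix nj).
have o : \forall y \near x, img i y by apply: open_nbhs_nbhs; split=> //; exact: img_open.
by apply: filterS2 o c => y iy jy; apply/overlapP.
Qed.

Lemma transition_unit i j x : overlap i j x -> 'J (transition i j) x \in unitmx.
Proof. by move=> /transition_oriented J0; rewrite unitmxE unitfE gt_eqF. Qed.

Lemma crd_image_compact i (K : set M) : compact K -> K `<=` dom i -> compact (crd i @` K).
Proof.
move=> cK Ki; apply: continuous_compact cK.
by apply: continuous_in_subspaceT => p; rewrite inE => /Ki; exact: crd_continuous.
Qed.

End Atlas.

(** * Metrics and curvature across charts *)

Section MetricTensor.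
Variables (R : realType) (M : topologicalType) (A : oriented_atlas R M).
Variable h : tensor_field A.
Hypothesis mh : riemannian_metric h.

Lemma riemannian_spd i x : img i x -> spd (h i x).
Proof. by have [[_ hT] hpos] := mh => ix; split; [exact: hT|move=> u; exact: hpos ix u]. Qed.

Lemma riemannian_metric_on i : metric_on (img i) (h i).
Proof.
have [[[sh _] hT] _] := mh; split=> //; first exact: img_open.
- by move=> x; exact: hT.
- by move=> x /riemannian_spd/spd_unit[].
Qed.

Lemma riemannian_metric_overlap i j : metric_on (overlap i j) (h i).
Proof.
have [_ sh hT hU] := riemannian_metric_on i; split.
- exact: overlap_open.
- by move=> a b s x /overlap_img ix; exact: sh.
- by move=> x /overlap_img; exact: hT.
- by move=> x /overlap_img; exact: hU.
Qed.

Lemma riemannian_congr i j x : overlap i j x ->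
  h i x = 'J (transition i j) x *m h j (transition i j x) *m ('J (transition i j) x)^T.
Proof. by move=> ox; have [[[_ +] _] _] := mh; exact. Qed.

Lemma Rm_transition i j x v w y z : overlap i j x ->
  Rm (h i) x v w y z =
  let J := 'J (transition i j) x in
  Rm (h j) (transition i j x) (v *m J) (w *m J) (y *m J) (z *m J).
Proof.
move=> ox /=.
have phiU y' : overlap i j y' -> img j (transition i j y') by exact: transition_img.
have sphi := @transition_smooth _ _ A i j.
have E1 u := pushforwardE sphi u ox.
rewrite -!E1; apply: (Rm_pullback (riemannian_metric_overlap i j) (riemannian_metric_on j)) => //.
- exact: transition_unit.
- exact: riemannian_congr.
Qed.

End MetricTensor.

(** * The Euler-Lagrange tensor as a global tensor field *)

Section EulerLagrangeTensor.
Variables (R : realType) (M : topologicalType) (A : oriented_atlas R M).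
Variables g h : tensor_field A.
Hypotheses (mg : riemannian_metric g) (mh : riemannian_metric h).

Definition el_field : tensor_field A := fun i x => el_tensor (Rm (g i) x) (h i x).

Lemma el_field_transition i j x : overlap i j x -> let J := 'J (transition i j) x in
  el_field i x = J *m el_field j (transition i j x) *m J^T.
Proof.
move=> ox /=; have jx := transition_img ox.
apply: el_tensor_pullback.
- exact (curvlike_Rm (riemannian_metric_on mg i) (overlap_img ox)).
- exact: (curvlike_Rm (riemannian_metric_on mg j) jx).
- exact: transition_unit.
- by have [] := spd_unit (riemannian_spd mh jx).
- exact: riemannian_congr.
- by move=> v w y z; exact: Rm_transition.
Qed.

Lemma el_field_smooth : smooth_symmetric_tensor el_field.
Proof.
split; last first.
  move=> i x ix; apply: el_tensor_sym; first exact (curvlike_Rm (riemannian_metric_on mg i) ix).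
  by have [] := riemannian_spd mh ix.
split; last by move=> i j x; exact: el_field_transition.
move=> i a b; have oi := @img_open _ _ A i.
have [_ sh _ hu] := riemannian_metric_on mh i.
have sI c d : smooth_on (img i) (fun x => invmx (h i x) c d : R) by exact: smooth_on_invmx.
have sr c d : smooth_on (img i) (fun x => ricci (Rm (g i) x) (invmx (h i x)) c d : R).
  apply: (@smooth_on_ext _ _ oi _ (fun x => \sum_k \sum_l invmx (h i x) k l *
      Rm (g i) x (basis k) (basis c) (basis d) (basis l))) => [x _|].
    by rewrite [RHS]mxE.
  apply: smooth_on_sum => // k _; apply: smooth_on_sum => // l _.
  by apply: smooth_onM => //; exact: smooth_Rm (riemannian_metric_on mg i) _ _ _ _.
apply: (@smooth_on_ext _ _ oi _ (fun x => (\sum_k \sum_l invmx (h i x) k l *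
   ricci (Rm (g i) x) (invmx (h i x)) k l) * 2^-1 * h i x a b
   + - (2 * ricci (Rm (g i) x) (invmx (h i x)) a b))) => [x _|].
  rewrite /el_field /el_tensor [RHS]mxE [X in _ = X + _]mxE [X in _ = _ + X]mxE
    [X in _ = _ + - X]mxE.
  congr (_ * _ * _ + _); apply: eq_bigr => k _; apply: eq_bigr => l _.
  by rewrite form_basis.
apply: smooth_onD => //; last first.
  by apply: smooth_onN => //; apply: smooth_onM => //; exact: smooth_on_cst.
apply: smooth_onM => //; apply: smooth_onM => //; last exact: smooth_on_cst.
by apply: smooth_on_sum => // k _; apply: smooth_on_sum => // l _; exact: smooth_onM.
Qed.

Lemma euler_lagrange_el : euler_lagrange g h <-> forall i x, img i x -> el_field i x = 0.
Proof.
split=> [el i x ix|el0 i x ix e [eh de] j l].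
  have [e [eh de]] := orientable_frame (riemannian_spd mh ix).
  apply/(el_tensor_frame eh (curvlike_Rm (riemannian_metric_on mg i) ix)) => j l.
  rewrite -(mixed_scalE (riemannian_metric_on mg i) ix (riemannian_spd mh ix)).
  exact: (el i x ix e (conj eh de) j l).
rewrite (mixed_scalE (riemannian_metric_on mg i) ix (riemannian_spd mh ix)).
by apply: (el_tensor_frame eh (curvlike_Rm (riemannian_metric_on mg i) ix)).2; exact: el0.
Qed.

Lemma duality_el : Rm_preserves_duality g h <-> forall i x, img i x -> el_field i x = 0.
Proof.
have D i x (ix : img i x) : el_field i x = 0 <-> (forall xi eta,
    Lambda_plus (h i x) xi -> Lambda_minus (h i x) eta -> Rm_bivector (g i) x xi eta = 0).
  have [e [eh de]] := orientable_frame (riemannian_spd mh ix).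
  by apply: einstein_duality eh de _; [have [] := riemannian_spd mh ix|
    exact (curvlike_Rm (riemannian_metric_on mg i) ix)].
by split=> H i x ix; apply/(D i x ix); exact: H.
Qed.

End EulerLagrangeTensor.

(** * Critical points *)

Section FirstVariation.
Variables (R : realType) (M : topologicalType) (A : oriented_atlas R M).
Notation E := ('rV[R]_4).
Hypotheses (hM : hausdorff_space M) (cM : compact [set: M]).
Variables g h : tensor_field A.
Hypotheses (mg : riemannian_metric g) (mh : riemannian_metric h).

Local Notation pou := (xget [::] [set s | partition_of_unity (A := A) s]).

(** Existence of a partition rules out the default [[::]], for which every integral would be an
    empty sum. *)
Let pouP : partition_of_unity pou.
Proof. exact: (xgetPex [::] (partition_of_unity_exists A hM cM)). Qed.

Lemma chart_cutoff i rho : (i, rho) \in pou -> exists K : set E,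
  [/\ compact K, K `<=` img i,
      forall x, img i x -> {for x, continuous (fun y => rho (inv i y))},
      forall x, img i x -> ~ K x -> rho (inv i x) = 0 &
      forall x, 0 <= rho (inv i x)].
Proof.
move=> /pouP.1 [crho rho0 [K [cK Ki K0]]]; exists (crd i @` K); split.
- exact: crd_image_compact.
- by move=> _ [p Kp <-]; exists p => //; exact: Ki.
- move=> x ix; apply: (@continuous_comp _ _ _ (inv i) rho); last exact: crho.
  exact: Defs.inv_continuous.
- move=> x ix nK; apply: K0 => Kx; apply: nK; exists (inv i x) => //.
  by have [] := inv_dom ix.
- by move=> x; exact: rho0.
Qed.

Lemma tensor_continuous (v : tensor_field A) i x a b : smooth_tensor v -> img i x ->
  {for x, continuous (fun y => v i y a b : R)}.
Proof. by move=> [sv _]; exact: smooth_on_continuous (sv i a b). Qed.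

Definition action_variation (v : tensor_field A) : R :=
  \sum_(c <- pou) \int[@mu4 R]_(z in [set z | img c.1 (point4 z)])
    (c.2 (inv c.1 (point4 z)) * chart_variation (g c.1) (h c.1) (v c.1) 0 (point4 z)).

Lemma is_derive_action v : smooth_symmetric_tensor v ->
  is_derive (0 : R) (1 : R) (fun t : R => mixed_action g (fun i x => h i x + t *: v i x))
    (action_variation v).
Proof.
move=> [sv vT]; apply: is_derive_bigsum => -[i rho] irho.
have [K [cK Ki crho rho0 rho_ge0]] := chart_cutoff irho.
have [[sh _] _] := mh.
exact: (is_derive_chart_action (riemannian_metric_on mg i)
  (fun x ix a b => @tensor_continuous h _ x a b sh ix)
  (fun x ix a b => @tensor_continuous v _ x a b sv ix)
  (fun x ix => riemannian_spd mh ix) (vT i) crho rho0 cK Ki rho_ge0).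
Qed.

Lemma critical_pointE : critical_point g h <->
  forall v, smooth_symmetric_tensor v -> action_variation v = 0.
Proof.
split=> H v sv; last exact: is_derive_eq (is_derive_action sv) (H v sv).
by have [_ <-] := is_derive_action sv; have [_ ->] := H v sv.
Qed.

Let el := el_field g h.

Lemma chart_variation_el_ge0 i x : img i x ->
  0 <= chart_variation (g i) (h i) (el i) 0 x /\
  (chart_variation (g i) (h i) (el i) 0 x = 0 -> el i x = 0).
Proof.
move=> ix; have [hT _] := riemannian_spd mh ix.
have [e [eh _]] := orientable_frame (riemannian_spd mh ix).
have [_ dh] := spd_unit (riemannian_spd mh ix).
have [_ elT] := el_field_smooth mg mh.
have [t0 tE] := trace_frame_ge0 eh (elT i x ix).
have sd : 0 < Num.sqrt (\det (h i x)) by rewrite sqrtr_gt0.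
rewrite /chart_variation scale0r addr0 -/(el_field g h i x) -/el; split.
  by rewrite mulr_ge0 // ltW.
by move=> /eqP; rewrite mulf_eq0 (gt_eqF sd) orbF => /eqP; exact: tE.
Qed.

(* Testing against the variation v = el makes the first variation a sum of
   integrals of squares. *)
Lemma critical_el : critical_point g h <-> forall i x, img i x -> el i x = 0.
Proof.
rewrite critical_pointE; split=> [H|H v sv]; last first.
  apply: big1 => -[i rho] _ /=; rewrite (@eq_Rintegral _ _ _ _ _ (fun=> 0)) => [|z].
    by rewrite /Rintegral integral0.
  rewrite inE => /= iz; rewrite /chart_variation scale0r addr0.
  have el0 := H _ _ iz; rewrite /el /el_field in el0; rewrite el0.
  by rewrite mulmx0 !mul0mx mxtrace0 mul0r mulr0.
have sel := el_field_smooth mg mh.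
have vanish j rho p : (j, rho) \in pou -> dom j p -> 0 < rho p -> el j (crd j p) = 0.
  move=> jr jp rp.
  pose F (c : idx A * (M -> R)) x := c.2 (inv c.1 x) * chart_variation (g c.1) (h c.1) (el c.1) 0 x.
  have F0 c : c \in pou -> forall x, img c.1 x -> 0 <= F c x.
    case: c => i r /chart_cutoff[K [_ _ _ _ r0]] x ix.
    by rewrite mulr_ge0 ?r0 //; have [] := chart_variation_el_ge0 ix.
  have I0 c : c \in pou -> 0 <= \int[@mu4 R]_(z in [set z | img c.1 (point4 z)]) F c (point4 z).
    by move=> cp; apply: Rintegral_ge0 => z; exact: F0.
  (* A vanishing sum of nonnegative chart integrals: each one vanishes, in particular that of
     [(j, rho)]. *)
  have := H _ sel; rewrite /action_variation big_seq => /eqP.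
  rewrite psumr_eq0 => [/allP/(_ _ jr)/implyP/(_ jr)/eqP Ij|c]; last exact: I0.
  have [K [cK Ki crho rho0 rho_ge0]] := chart_cutoff jr.
  have cf x : img j x -> {for x, continuous (fun y => chart_variation (g j) (h j) (el j) 0 y)}.
    move=> jx; have [[sh _] _] := mh; have [[sv _] _] := sel.
    have sM : spd (h j x + 0 *: el j x) by rewrite scale0r addr0; exact: riemannian_spd.
    have c := continuous_chart_variation (riemannian_metric_on mg j)
      (fun x ix a b => @tensor_continuous h _ x a b sh ix)
      (fun x ix a b => @tensor_continuous el _ x a b (proj1 sel) ix) jx sM.
    apply: (@continuous_comp _ _ _ (fun y => (y, 0 : R))
      (fun q : E * R => chart_variation (g j) (h j) (el j) q.2 q.1)); last exact: c.
    by apply: (@cvg_pair _ _ _ (nbhs x) (nbhs x) (nbhs (0 : R)) _ _ _ id (cst 0));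
      [exact: cvg_id|exact: cvg_cst].
  have jx : img j (crd j p) by exists p.
  have cF x : img j x -> {for x, continuous (F (j, rho))}.
    by move=> ix; apply: continuousM; [exact: crho|exact: cf].
  have iF := integrable_cutoff (riemannian_metric_on mg j) crho rho0 cK Ki
    (fun y Ky => cf y (Ki y Ky)).
  have := @Rintegral_eq0 R _ (F (j, rho)) (@img_open _ _ A j) cF (F0 _ jr) iF Ij _ jx.
  rewrite /F /= crdK // => /eqP; rewrite mulf_eq0 (gt_eqF rp) /= => /eqP.
  by have [_] := chart_variation_el_ge0 jx; apply.
move=> i x ix.
(* The functions sum to 1, so one is positive at the point. It gives the vanishing in its own chart
   [j], possibly different from [i], and the transition law carries it back. *)
have [[j rho] jr rp] : exists2 c, c \in pou & 0 < c.2 (inv i x).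
  apply: contrapT => N; have := pouP.2 (inv i x); rewrite big_seq big1 => [/eqP|[j rho] jr].
    by rewrite eq_sym oner_eq0.
  apply/eqP; rewrite eq_le leNgt; apply/andP; split; last by have [_ + _] := pouP.1 _ _ jr; exact.
  by apply/negP => rp; apply: N; exists (j, rho).
have jx : dom j (inv i x).
  have [_ _ [K [_ Kj K0]]] := pouP.1 _ _ jr; apply: Kj; apply: contrapT => /K0 r0.
  by move: rp; rewrite /= r0 ltxx.
rewrite /el (@el_field_transition _ _ _ _ _ mg mh i j x); last by apply/overlapP.
by rewrite -/el (vanish _ _ _ jr jx rp) mulmx0 mul0mx.
Qed.

End FirstVariation.

Theorem proposition2 (R : realType) (M : topologicalType)
  (A : oriented_atlas R M)
  (hM : hausdorff_space M) (cM : compact [set: M])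
  (g : tensor_field A) (hg : riemannian_metric g) :
  forall h : tensor_field A, riemannian_metric h ->
    (critical_point g h <-> euler_lagrange g h) /\
    (critical_point g h <-> Rm_preserves_duality g h).
Proof.
move=> h mh; have C := critical_el hM cM hg mh.
have EL := euler_lagrange_el hg mh; have D := duality_el hg mh.
by split; apply: (iff_trans C); apply: iff_sym.
Qed.
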